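(* Let $X\subseteq S=(\mathbb{C}^m,0)$ be a normal crossing singularity, i.e. an arbitrary equidimensional union of coordinate subspaces, of codimension $k\in\{1,\ldots,m-1\}$. Then $X$ is a free singularity.
   Context: A coordinate subspace is a germ $X_E=\{x_i=0 : i\in E\}$ for $E\subseteq\{1,\ldots,m\}$. So a normal crossing singularity of codimension $k$ is $X=\bigcup_{j=1}^rX_{E_j}$ with $E_1,\ldots,E_r$ pairwise distinct subsets of $\{1,\ldots,m\}$ of cardinality $k$, with reduced structure. Freeness: $\mathcal{O}_S=\mathbb{C}\{x_1,\ldots,x_m\}$. For a reduced equidimensional germ $X$ of codimension $k$ with radical ideal $\mathcal{I}_X$ and $\mathcal{O}_X=\mathcal{O}_S/\mathcal{I}_X$, choose a regular sequence $(f_1,\ldots,f_k)\subseteq\mathcal{I}_X$ generating a radical ideal $\mathcal{I}_C$ (such sequences exist), and let $\mathcal{J}_{X/C}\subseteq\mathcal{O}_X$ be the ideal generated by the images of the $k\times k$ minors of the Jacobian matrix of $(f_1,\ldots,f_k)$; up to isomorphism this module does not depend on the choice. $X$ is called free if $\mathcal{J}_{X/C}$ is a Cohen-Macaulay module. *)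

(* Defs.v *)
From HB Require Import structures.
From mathcomp Require Import all_boot all_order all_algebra complex.
From mathcomp Require Import all_classical all_reals topology normedtype sequences.
Set Implicit Arguments.
Unset Strict Implicit.
Unset Printing Implicit Defensive.
Import Order.TTheory GRing.Theory Num.Theory numFieldNormedType.Exports.
Local Open Scope classical_set_scope.
Local Open Scope ring_scope.

Section MultiIndex.
Variable m : nat.

Definition mindex := {ffun 'I_m -> nat}.
Definition mzero : mindex := [ffun=> 0%N].
Definition madd (a b : mindex) : mindex := [ffun i => (a i + b i)%N].
Definition munit (i : 'I_m) : mindex := [ffun j => (j == i) : nat].
Definition mdegree (a : mindex) : nat := (\sum_i a i)%N.

(* the multi-indices with all entries < N, as a finite type *)
Definition mbox (N : nat) := {ffun 'I_m -> 'I_N}.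
Definition box_index (N : nat) (b : mbox N) : mindex := [ffun i => val (b i)].
Definition in_box (N : nat) (a : mindex) := [forall i, (a i < N)%N].

Lemma mindexP (a b : mindex) : (forall i, a i = b i) -> a = b.
Proof. by move=> e; apply/ffunP. Qed.

Lemma box_index_inj N : injective (@box_index N).
Proof.
move=> a b /ffunP e; apply/ffunP => i; apply: val_inj.
by have := e i; rewrite !ffunE.
Qed.

Lemma box_indexP N a : reflect (exists b : mbox N, box_index b = a) (in_box N a).
Proof.
apply: (iffP forallP) => [h|[b <-] i]; last by rewrite ffunE ltn_ord.
by exists [ffun i => Ordinal (h i)]; apply/mindexP => i; rewrite !ffunE.
Qed.

Lemma maddC : commutative madd.
Proof. by move=> a b; apply/ffunP => i; rewrite !ffunE addnC. Qed.

Lemma maddA : associative madd.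
Proof. by move=> a b c; apply/ffunP => i; rewrite !ffunE addnA. Qed.

Lemma madd0 : left_id mzero madd.
Proof. by move=> a; apply/ffunP => i; rewrite !ffunE. Qed.

Lemma maddI (a : mindex) : injective (madd a).
Proof.
move=> b c /ffunP e; apply/ffunP => i.
by have := e i; rewrite !ffunE; apply: addnI.
Qed.

Lemma mdegreeD a b : mdegree (madd a b) = (mdegree a + mdegree b)%N.
Proof. by rewrite /mdegree -big_split; apply: eq_bigr => i _; rewrite ffunE. Qed.

Lemma mdegree_ge (a : mindex) i : (a i <= mdegree a)%N.
Proof. by rewrite /mdegree (bigD1 i) //= leq_addr. Qed.

Lemma mdegree0 : mdegree mzero = 0%N.
Proof. by rewrite /mdegree big1 // => i _; rewrite ffunE. Qed.

Lemma mdegree_unit i : mdegree (munit i) = 1%N.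
Proof.
rewrite /mdegree (bigD1 i) //= ffunE eqxx big1 ?addn0 // => j ne.
by rewrite ffunE (negbTE ne).
Qed.

Lemma in_box_degree a : in_box (mdegree a).+1 a.
Proof. by apply/forallP => i; rewrite ltnS mdegree_ge. Qed.

Lemma in_boxDl N a b : in_box N (madd a b) -> in_box N a.
Proof.
move=> /forallP h; apply/forallP => i; apply: leq_ltn_trans (h i).
by rewrite ffunE leq_addr.
Qed.

Lemma in_boxDr N a b : in_box N (madd a b) -> in_box N b.
Proof. by rewrite maddC; apply: in_boxDl. Qed.

Lemma in_boxW N N' a : (N <= N')%N -> in_box N a -> in_box N' a.
Proof.
by move=> le /forallP h; apply/forallP => i; apply: leq_trans (h i) le.
Qed.

End MultiIndex.

Section BoxSums.
Variables (m : nat) (V : nmodType).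
Implicit Types (F : mindex m -> V).

Lemma box_sum_widen N N' (P : pred (mindex m)) F : (N <= N')%N ->
  (forall a, P a -> in_box N' a -> in_box N a) ->
  \sum_(b : mbox m N | P (box_index b)) F (box_index b) =
  \sum_(b : mbox m N' | P (box_index b)) F (box_index b).
Proof.
move=> le hP; pose w (b : mbox m N) : mbox m N' := [ffun i => widen_ord le (b i)].
have wE b : box_index (w b) = box_index b by apply/ffunP => i; rewrite !ffunE.
have winj : injective w.
  by move=> a b e; apply: box_index_inj; rewrite -!wE e.
transitivity (\sum_(b in [set w b | b : mbox m N & P (box_index b)]%SET) F (box_index b)).
  rewrite big_imset /=; last by move=> ? ? _ _; apply: winj.
  by apply: eq_big => [b|b _]; rewrite ?inE ?wE.
apply: eq_bigl => b; apply/imsetP/idP => [[c]|Pb].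
  by rewrite inE => Pc ->; rewrite wE.
have /box_indexP [c ec] : in_box N (box_index b).
  by apply: hP => //; apply/box_indexP; exists b.
by exists c; rewrite ?inE ?ec //; apply: box_index_inj; rewrite wE.
Qed.

Lemma box_sum1 N (a : mindex m) F :
  \sum_(b : mbox m N | box_index b == a) F (box_index b) =
  if in_box N a then F a else 0.
Proof.
case: box_indexP => [[b <-]|h].
  rewrite (big_pred1 b) // => c /=.
  by apply/eqP/eqP => [/box_index_inj|->].
by rewrite big_pred0 // => b; apply/eqP => e; apply: h; exists b.
Qed.

End BoxSums.

Section PowerSeries.
Variables (K : numFieldType) (m : nat).
Local Notation idx := (mindex m).
Implicit Types f g h : idx -> K.

Definition abs_psum f (r : K) (N : nat) : K :=
  \sum_(b : mbox m N) `|f (box_index b)| * r ^+ mdegree (box_index b).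

(* absolute convergence on some polydisc; 0 < r forces r to be real *)
Definition ps_convergent f := exists2 r : K, 0 < r &
  exists M : K, forall N, abs_psum f r N <= M.

(* (f g)_a = \sum_(b + c = a) f_b g_c; all b, c involved have entries at most
   the total degree of a *)
Definition ps_mul f g : idx -> K := fun a =>
  \sum_(b : mbox m (mdegree a).+1)
    \sum_(c : mbox m (mdegree a).+1 | madd (box_index b) (box_index c) == a)
      f (box_index b) * g (box_index c).

Definition ps_one : idx -> K := fun a => (a == mzero m)%:R.

Definition ps_deriv (i : 'I_m) f : idx -> K := fun a =>
  f (madd a (munit i)) *+ (a i).+1.

Lemma ps_mul_box N f g a : in_box N a ->
  ps_mul f g a =
  \sum_(b : mbox m N) \sum_(c : mbox m N | madd (box_index b) (box_index c) == a)
      f (box_index b) * g (box_index c).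
Proof.
move=> aN.
have key N1 N2 : (N1 <= N2)%N -> in_box N1 a ->
  \sum_(b : mbox m N1) \sum_(c : mbox m N1 | madd (box_index b) (box_index c) == a)
      f (box_index b) * g (box_index c) =
  \sum_(b : mbox m N2) \sum_(c : mbox m N2 | madd (box_index b) (box_index c) == a)
      f (box_index b) * g (box_index c).
  move=> le a1.
  transitivity (\sum_(b : mbox m N1) \sum_(c : mbox m N2 |
     madd (box_index b) (box_index c) == a) f (box_index b) * g (box_index c)).
    apply: eq_bigr => b _.
    apply: (@box_sum_widen m K N1 N2 (fun c => madd (box_index b) c == a)
       (fun c => f (box_index b) * g c)) => // c /eqP e _.
    by apply: (@in_boxDr _ _ (box_index b)); rewrite e.
  pose G x := \sum_(c : mbox m N2 | madd x (box_index c) == a) f x * g (box_index c).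
  transitivity (\sum_(b : mbox m N2 | in_box N1 (box_index b)) G (box_index b)).
    rewrite -(@box_sum_widen m K N1 N2 (in_box N1) G) //.
    apply: eq_big => // b; apply/esym/box_indexP; by exists b.
  rewrite [RHS](bigID (fun b => in_box N1 (box_index b))) /=.
  rewrite [X in _ = _ + X]big1 ?addr0 // => b nb.
  rewrite big1 // => c /eqP e.
  by move: nb; rewrite (@in_boxDl _ _ _ (box_index c)) // e.
by case/orP: (leq_total N (mdegree a).+1) => le; rewrite /ps_mul;
  [rewrite -(key N) | apply: key; rewrite ?in_box_degree].
Qed.

Lemma ps_mulC : commutative ps_mul.
Proof.
move=> f g; apply/funext => a; rewrite /ps_mul (exchange_big_dep predT) //=.
apply: eq_bigr => b _; apply: eq_big => [c|c _]; last exact: mulrC.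
by rewrite maddC.
Qed.

Lemma ps_mul1 : left_id ps_one ps_mul.
Proof.
move=> f; apply/funext => a; rewrite /ps_mul.
set N := (mdegree a).+1.
have /box_indexP [z ez] : in_box N (mzero m).
  by apply/forallP => i; rewrite ffunE.
rewrite (bigD1 z) //= [X in _ + X]big1 ?addr0; last first.
  move=> b nb; rewrite big1 // => c _; rewrite /ps_one.
  case: eqP => [e|]; last by rewrite mul0r.
  by move: nb; rewrite (@box_index_inj m N b z) ?eqxx // e ez.
rewrite /ps_one ez eqxx.
under eq_bigl do rewrite madd0.
by rewrite (@box_sum1 m K N a (fun c => 1 * f c)) in_box_degree mul1r.
Qed.

Lemma ps_mulDl : left_distributive ps_mul (fun f g : idx -> K => f + g).
Proof.
move=> f g h; apply/funext => a.
change (ps_mul (f + g) h a = ps_mul f h a + ps_mul g h a).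
rewrite /ps_mul -big_split; apply: eq_bigr => b _ /=.
by rewrite -big_split; apply: eq_bigr => c _; apply: mulrDl.
Qed.

Lemma ps_mul3 N f g h a : in_box N a ->
  ps_mul f (ps_mul g h) a =
  \sum_(b : mbox m N) \sum_(c : mbox m N) \sum_(d : mbox m N |
     madd (box_index b) (madd (box_index c) (box_index d)) == a)
     f (box_index b) * (g (box_index c) * h (box_index d)).
Proof.
move=> aN; rewrite (ps_mul_box _ _ aN); apply: eq_bigr => b _.
pose s (c d : mbox m N) := madd (box_index c) (box_index d).
transitivity (\sum_(e : mbox m N | madd (box_index b) (box_index e) == a)
  \sum_(c : mbox m N) \sum_(d : mbox m N)
    if box_index e == s c d then
      f (box_index b) * (g (box_index c) * h (box_index d)) else 0).
  apply: eq_bigr => e _; rewrite (@ps_mul_box N); last by apply/box_indexP; exists e.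
  rewrite big_distrr; apply: eq_bigr => c _; rewrite big_distrr big_mkcond /=.
  by apply: eq_bigr => d _; rewrite eq_sym.
rewrite exchange_big; apply: eq_bigr => c _.
rewrite exchange_big [RHS]big_mkcond; apply: eq_bigr => d _ /=.
rewrite -big_mkcondr /=.
pose F (x : idx) := if madd (box_index b) x == a then
  f (box_index b) * (g (box_index c) * h (box_index d)) else 0.
transitivity (\sum_(e : mbox m N | box_index e == s c d) F (box_index e)).
  by rewrite /F -big_mkcondr; apply: eq_bigl => e; rewrite andbC.
rewrite box_sum1 /F; case: ifP => // /negbT nb.
case: eqP => // e; case/negP: nb.
by apply: (@in_boxDr _ _ (box_index b)); rewrite e.
Qed.

Lemma ps_mulA : associative ps_mul.
Proof.
move=> f g h; apply/funext => a.
rewrite [ps_mul (ps_mul f g) h]ps_mulC.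
rewrite !(@ps_mul3 (mdegree a).+1) ?in_box_degree //.
rewrite [RHS]exchange_big; apply: eq_bigr => b _.
rewrite [RHS](exchange_big_dep predT) //=.
apply: eq_bigr => c _; apply: eq_big => [d|d _]; last by rewrite [RHS]mulrC mulrA.
by rewrite [madd (box_index d) _]maddC -maddA.
Qed.

Lemma abs_psumW f r s N : 0 < s -> s <= r -> abs_psum f s N <= abs_psum f r N.
Proof.
move=> s0 sr; apply: ler_sum => b _; apply: ler_wpM2l; first exact: normr_ge0.
by apply: lerXn2r => //; rewrite nnegrE ltW // (lt_le_trans s0).
Qed.

Lemma ps_convergent_common f g : ps_convergent f -> ps_convergent g ->
  exists2 r : K, 0 < r & exists M : K, forall N,
    abs_psum f r N <= M /\ abs_psum g r N <= M.
Proof.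
move=> [r r0 [M hM]] [s s0 [M' hM']].
have pos u t (h : idx -> K) N : 0 < u -> abs_psum h u N <= t -> 0 <= t.
  move=> u0; apply: le_trans; apply: sumr_ge0 => b _.
  by rewrite mulr_ge0 ?normr_ge0 // exprn_ge0 // ltW.
have M0 : 0 <= M by apply: pos (hM 0%N).
have M0' : 0 <= M' by apply: pos (hM' 0%N).
have [le|/ltW le] := real_leP (gtr0_real r0) (gtr0_real s0);
    [exists r => // | exists s => //]; exists (M + M') => N; split.
- by rewrite (le_trans (hM N)) // lerDl.
- by rewrite (le_trans (abs_psumW _ _ r0 le)) // (le_trans (hM' N)) // lerDr.
- by rewrite (le_trans (abs_psumW _ _ s0 le)) // (le_trans (hM N)) // lerDl.
- by rewrite (le_trans (hM' N)) // lerDr.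
Qed.

Lemma ps_convergent0 : ps_convergent 0.
Proof.
exists 1; first exact: ltr01.
by exists 0 => N; rewrite /abs_psum big1 // => b _; rewrite normr0 mul0r.
Qed.

Lemma ps_convergentN f : ps_convergent f -> ps_convergent (- f).
Proof.
move=> [r r0 [M hM]]; exists r => //; exists M => N; apply: (le_trans _ (hM N)).
by apply: ler_sum => b _; rewrite normrN.
Qed.

Lemma ps_convergentD f g : ps_convergent f -> ps_convergent g ->
  ps_convergent (f + g).
Proof.
move=> cf /(ps_convergent_common cf) [r r0 [M hM]]; exists r => //.
exists (M + M) => N; have [h1 h2] := hM N.
apply: (le_trans _ (lerD h1 h2)); rewrite /abs_psum -big_split /=.
apply: ler_sum => b _; rewrite -mulrDl ler_wpM2r ?ler_normD //.
by rewrite exprn_ge0 // ltW.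
Qed.

Lemma ps_convergent1 : ps_convergent ps_one.
Proof.
exists 1; first exact: ltr01.
exists 1 => N; rewrite /abs_psum.
rewrite (bigID (fun b => box_index b == mzero m)) /= [X in _ + X]big1 ?addr0.
  rewrite (@box_sum1 m K N _ (fun b => `|ps_one b| * 1 ^+ mdegree b)).
  by case: ifP => // _; rewrite /ps_one eqxx normr1 expr1n mulr1.
by move=> b /negbTE nb; rewrite /ps_one nb normr0 mul0r.
Qed.

Lemma abs_psum_mul f g r N : 0 < r ->
  abs_psum (ps_mul f g) r N <= abs_psum f r N * abs_psum g r N.
Proof.
move=> r0; rewrite /abs_psum.
pose F (b c : mbox m N) : K := `|f (box_index b)| * `|g (box_index c)| *
  r ^+ (mdegree (box_index b) + mdegree (box_index c)).
have F0 b c : 0 <= F b c.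
  by rewrite /F !mulr_ge0 ?normr_ge0 // exprn_ge0 // ltW.
apply: (@le_trans _ _ (\sum_(a : mbox m N) \sum_(b : mbox m N)
  \sum_(c : mbox m N | madd (box_index b) (box_index c) == box_index a) F b c)).
  apply: ler_sum => a _; rewrite (@ps_mul_box N); last by apply/box_indexP; exists a.
  apply: (@le_trans _ _ ((\sum_b \sum_(c : mbox m N |
    madd (box_index b) (box_index c) == box_index a)
    `|f (box_index b)| * `|g (box_index c)|) * r ^+ mdegree (box_index a))).
    apply: ler_wpM2r; first by rewrite exprn_ge0 // ltW.
    apply: (le_trans (ler_norm_sum _ _ _)); apply: ler_sum => b _.
    apply: (le_trans (ler_norm_sum _ _ _)); apply: ler_sum => c _.
    by rewrite normrM.
  rewrite mulr_suml; apply: ler_sum => b _.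
  rewrite mulr_suml; apply: ler_sum => c /eqP e.
  by rewrite /F -e mdegreeD.
rewrite exchange_big mulr_suml /=; apply: ler_sum => b _.
rewrite (exchange_big_dep predT) //= mulr_sumr; apply: ler_sum => c _ /=.
have -> : `|f (box_index b)| * r ^+ mdegree (box_index b) *
  (`|g (box_index c)| * r ^+ mdegree (box_index c)) = F b c.
  by rewrite /F exprD mulrACA.
under eq_bigl do rewrite eq_sym.
rewrite (@box_sum1 m K N _ (fun=> F b c)).
by case: ifP.
Qed.

Lemma ps_convergentM f g : ps_convergent f -> ps_convergent g ->
  ps_convergent (ps_mul f g).
Proof.
move=> cf /(ps_convergent_common cf) [r r0 [M hM]]; exists r => //.
exists (M * M) => N; have [h1 h2] := hM N.
apply: (le_trans (abs_psum_mul _ _ _ r0)).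
by apply: ler_pM => //; apply: sumr_ge0 => b _;
  rewrite mulr_ge0 ?normr_ge0 // exprn_ge0 // ltW.
Qed.

Lemma ps_convergent_deriv i f : ps_convergent f -> ps_convergent (ps_deriv i f).
Proof.
move=> [r r0 [M hM]]; exists (r / 2); first by rewrite divr_gt0.
exists (r^-1 * M) => N.
apply: (@le_trans _ _ (r^-1 * abs_psum f r N.+1)); last first.
  by rewrite ler_wpM2l // invr_ge0 ltW.
rewrite /abs_psum mulr_sumr.
have hi (b : mbox m N) : in_box N.+1 (madd (box_index b) (munit i)).
  apply/forallP => j; rewrite !ffunE.
  apply: (@leq_ltn_trans (b j).+1); last by rewrite ltnS ltn_ord.
  by rewrite -addn1 leq_add2l; case: eqP.
pose w (b : mbox m N) : mbox m N.+1 := [ffun j => Ordinal (forallP (hi b) j)].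
have wE b : box_index (w b) = madd (box_index b) (munit i).
  by apply/ffunP => j; rewrite [LHS]ffunE ffunE.
have winj : injective w.
  move=> a b e; apply: box_index_inj; apply: (@maddI m (munit i)).
  by rewrite ![madd (munit i) _]maddC -!wE e.
pose G (x : idx) := r^-1 * (`|f x| * r ^+ mdegree x).
have G0 x : 0 <= G x.
  by rewrite /G !mulr_ge0 ?invr_ge0 ?normr_ge0 ?exprn_ge0 // ltW.
apply: (@le_trans _ _ (\sum_(b in [set w b | b : mbox m N]%SET) G (box_index b))).
  rewrite big_imset /=; last by move=> ? ? _ _; apply: winj.
  apply: ler_sum => b _; rewrite wE /ps_deriv normrMn /G.
  set x := madd _ _; rewrite mdegreeD mdegree_unit addn1 exprS.
  rewrite [X in _ <= X](_ : _ = `|f x| * r ^+ mdegree (box_index b)); last first.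
    by rewrite mulrCA mulKf // gt_eqF.
  rewrite mulrnAl -mulrnAr ler_wpM2l ?normr_ge0 //.
  rewrite expr_div_n -mulrnAr ger_pMr ?exprn_gt0 //.
  rewrite -[X in X <= _]mulr_natl ler_pdivrMr ?exprn_gt0 // mul1r -natrX ler_nat.
  by apply: (leq_ltn_trans (mdegree_ge _ _)); apply: ltn_expl.
rewrite [X in _ <= X](bigID (mem [set w b | b : mbox m N]%SET)) /= lerDl.
by apply: sumr_ge0 => b _; apply: G0.
Qed.

Definition monomial (z : 'rV[K]_m) (a : idx) : K := \prod_i z 0 i ^+ a i.

Definition ps_partial f (z : 'rV[K]_m) (N : nat) : K :=
  \sum_(b : mbox m N) f (box_index b) * monomial z (box_index b).

Lemma monomialD z a b : monomial z (madd a b) = monomial z a * monomial z b.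
Proof.
by rewrite /monomial -big_split; apply: eq_bigr => i _; rewrite ffunE exprD.
Qed.

Lemma norm_monomial (z : 'rV[K]_m) (s : K) a : (forall i, `|z 0 i| <= s) ->
  `|monomial z a| <= s ^+ mdegree a.
Proof.
move=> zs; rewrite /monomial normr_prod /mdegree.
rewrite expr_sum; apply: ler_prod => i _; rewrite normr_ge0 normrX /=.
by apply: lerXn2r (zs i); rewrite nnegrE ?normr_ge0 // (le_trans _ (zs i)).
Qed.

Lemma norm_ps_partial f (z : 'rV[K]_m) r M N : 0 < r -> (forall i, `|z 0 i| <= r) ->
  abs_psum f r N <= M -> `|ps_partial f z N| <= M.
Proof.
move=> r0 zr; apply: le_trans; apply: (le_trans (ler_norm_sum _ _ _)).
by apply: ler_sum => b _; rewrite normrM ler_wpM2l ?norm_monomial.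
Qed.

Lemma ps_partialM f g (z : 'rV[K]_m) r M N : 0 < r -> (forall i, `|z 0 i| <= r / 2) ->
  abs_psum f r N <= M -> abs_psum g r N <= M ->
  `|ps_partial (ps_mul f g) z N - ps_partial f z N * ps_partial g z N|
    <= M * M * 2 ^- N.
Proof.
move=> r0 zr hf hg.
pose F (b c : mbox m N) := f (box_index b) * g (box_index c) *
  monomial z (madd (box_index b) (box_index c)).
pose S b c := in_box N (madd (@box_index m N b) (@box_index m N c)).
have -> : ps_partial (ps_mul f g) z N = \sum_(b : mbox m N) \sum_(c : mbox m N | S b c) F b c.
  transitivity (\sum_(a : mbox m N) \sum_(b : mbox m N) \sum_(c : mbox m N |
      madd (box_index b) (box_index c) == box_index a) F b c).
    apply: eq_bigr => a _; rewrite (@ps_mul_box N); last by apply/box_indexP; exists a.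
    rewrite mulr_suml; apply: eq_bigr => b _; rewrite mulr_suml.
    by apply: eq_bigr => c /eqP e; rewrite /F e.
  rewrite exchange_big; apply: eq_bigr => b _ /=.
  rewrite (exchange_big_dep predT) //= [RHS]big_mkcond; apply: eq_bigr => c _ /=.
  under eq_bigl do rewrite eq_sym.
  by rewrite (@box_sum1 m K N _ (fun=> F b c)).
have -> : ps_partial f z N * ps_partial g z N =
    \sum_(b : mbox m N) \sum_(c : mbox m N) F b c.
  rewrite /ps_partial mulr_suml; apply: eq_bigr => b _; rewrite mulr_sumr.
  by apply: eq_bigr => c _; rewrite /F monomialD mulrACA.
rewrite -sumrB.
apply: (@le_trans _ _ (abs_psum f r N * abs_psum g r N * 2 ^- N)); last first.
  have pos h : 0 <= abs_psum h r N.
    by apply: sumr_ge0 => b _; rewrite mulr_ge0 ?normr_ge0 // exprn_ge0 // ltW.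
  by rewrite ler_wpM2r ?invr_ge0 ?exprn_ge0 // ler_pM.
rewrite /abs_psum !mulr_suml.
apply: (le_trans (ler_norm_sum _ _ _)); apply: ler_sum => b _.
rewrite mulr_sumr mulr_suml.
rewrite [X in _ - X](bigID (S b)) /= opprD addrA subrr add0r normrN.
apply: (le_trans (ler_norm_sum _ _ _)).
rewrite big_mkcond; apply: ler_sum => c _ /=.
set B := (X in _ <= X).
have B0 : 0 <= B.
  by rewrite /B !mulr_ge0 ?normr_ge0 ?invr_ge0 ?exprn_ge0 // ltW.
case: ifP => // nS; rewrite /F !normrM.
have -> : B = `|f (box_index b)| * `|g (box_index c)| *
    (r ^+ mdegree (madd (box_index b) (box_index c)) * 2 ^- N).
  by rewrite /B mdegreeD exprD mulrACA !mulrA.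
rewrite ler_wpM2l ?mulr_ge0 ?normr_ge0 //.
apply: (le_trans (norm_monomial _ zr)); rewrite expr_div_n ler_wpM2l //.
  by rewrite exprn_ge0 // ltW.
rewrite lef_pV2 ?posrE ?exprn_gt0 // ler_eXn2l ?ltr1n //.
move: nS; rewrite /S /in_box negb_forall => /existsP [j]; rewrite -leqNgt => le.
exact: leq_trans le (mdegree_ge _ _).
Qed.

End PowerSeries.

Section ConvergentSeries.
Variables (K : numFieldType) (m : nat).

Definition conv_pred : {pred (mindex m -> K)} := fun f => `[< ps_convergent f >].

Lemma conv_pred_closed : zmod_closed conv_pred.
Proof.
split; first by apply/asboolP; apply: ps_convergent0.
move=> f g /asboolP cf /asboolP cg; apply/asboolP.
by apply: ps_convergentD => //; apply: ps_convergentN.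
Qed.
HB.instance Definition _ := GRing.isZmodClosed.Build _ conv_pred conv_pred_closed.

(* K{x_1, ..., x_m} *)
Record cseries := CSeries { coef :> mindex m -> K; _ : coef \in conv_pred }.
HB.instance Definition _ := [isSub for coef].
HB.instance Definition _ := [Choice of cseries by <:].
HB.instance Definition _ := [SubChoice_isSubZmodule of cseries by <:].

Lemma coef_conv (f : cseries) : ps_convergent f.
Proof. by apply/asboolP; apply: (valP f). Qed.

Definition cs_build f (cf : ps_convergent f) : cseries := CSeries (asboolT cf).

Definition cs_one := cs_build (@ps_convergent1 K m).
Definition cs_mul (f g : cseries) := cs_build (ps_convergentM (coef_conv f) (coef_conv g)).

Lemma cs_mulA : associative cs_mul.
Proof. by move=> f g h; apply: val_inj; apply: ps_mulA. Qed.
Lemma cs_mulC : commutative cs_mul.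
Proof. by move=> f g; apply: val_inj; apply: ps_mulC. Qed.
Lemma cs_mul1 : left_id cs_one cs_mul.
Proof. by move=> f; apply: val_inj; apply: ps_mul1. Qed.
Lemma cs_mulDl : left_distributive cs_mul +%R.
Proof. by move=> f g h; apply: val_inj; apply: ps_mulDl. Qed.
Lemma cs_one_neq0 : cs_one != 0.
Proof.
apply/eqP => /(congr1 (fun f : cseries => f (mzero m))) /=.
by rewrite /ps_one eqxx; apply/eqP; rewrite oner_eq0.
Qed.
HB.instance Definition _ := GRing.Zmodule_isComNzRing.Build cseries
  cs_mulA cs_mulC cs_mul1 cs_mulDl cs_one_neq0.

Definition pderiv (i : 'I_m) (f : cseries) : cseries :=
  cs_build (ps_convergent_deriv i (coef_conv f)).

Definition jacobian k (f : k.-tuple cseries) : 'M[cseries]_(k, m) :=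
  \matrix_(i, j) pderiv j (tnth f i).

Definition max_minors k (A : 'M[cseries]_(k, m)) : set cseries :=
  [set a | exists2 g : 'I_k -> 'I_m, {homo g : i j / (i < j)%N} &
           a = \det (colsub g A)].

End ConvergentSeries.

Section Ideals.
Variable A : comPzRingType.

Definition is_ideal (I : set A) :=
  [/\ I 0, forall x y, I x -> I y -> I (x + y) & forall a x, I x -> I (a * x)].

Record ideal := Ideal { ideal_set :> set A; _ : is_ideal ideal_set }.

Lemma idealP (I : ideal) : is_ideal I.
Proof. by case: I. Qed.

Lemma span_is_ideal (S : set A) : is_ideal (smallest is_ideal S).
Proof.
split => [I [[]] //|x y hx hy I hI|a x hx I hI].
  by have [_ h _] := hI.1; apply: h; [apply: hx | apply: hy].
by have [_ _ h] := hI.1; apply: h; apply: hx.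
Qed.

Definition span_ideal (S : set A) : ideal := Ideal (span_is_ideal S).

Definition radical_ideal (I : set A) :=
  is_ideal I /\ forall a n, I (a ^+ n) -> I a.

Definition prime_ideal (I : set A) :=
  [/\ is_ideal I, ~ I 1 & forall a b, I (a * b) -> I a \/ I b].

(* the maximal ideal when A is local *)
Definition nonunits : set A := [set a | ~ exists b, a * b = 1].

Definition ideal_pred (I : ideal) : {pred A} := fun x => x \in ideal_set I.

Lemma ideal_pred_zmod I : zmod_closed (ideal_pred I).
Proof.
have [h0 hD hM] := idealP I; split=> [|x y]; rewrite !inE //= => hx hy.
by apply: hD => //; rewrite -mulN1r; apply: hM.
Qed.
HB.instance Definition _ I := GRing.isZmodClosed.Build A (ideal_pred I) (ideal_pred_zmod I).

Definition quo (I : ideal) := Quotient.quot (ideal_pred I).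
HB.instance Definition _ I := GRing.Zmodule.on (quo I).

End Ideals.

Section QuotientRing.
Variables (A : comPzRingType) (I : ideal A).
Local Notation Q := (quo I).

Definition quo_pi (x : A) : Q := (\pi_(Quotient.quot (ideal_pred I)) x)%qT.
Definition quo_mul (x y : Q) : Q :=
  quo_pi (generic_quotient.repr (x : Quotient.quot (ideal_pred I)) *
          generic_quotient.repr (y : Quotient.quot (ideal_pred I))).

Lemma quo_piP x y : quo_pi x = quo_pi y <-> ideal_set I (x - y).
Proof.
split=> [/eqP|h]; first by rewrite -Quotient.idealrBE inE.
by apply/eqP; rewrite -Quotient.idealrBE inE.
Qed.

Lemma quo_piE (x : Q) : exists a, quo_pi a = x.
Proof.
by exists (generic_quotient.repr (x : Quotient.quot (ideal_pred I)));
  apply: generic_quotient.reprK.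
Qed.

Lemma quo_piD x y : quo_pi (x + y) = quo_pi x + quo_pi y.
Proof. exact: (raddfD (\pi_(Quotient.quot (ideal_pred I)))%qT). Qed.

Lemma quo_piM x y : quo_pi (x * y) = quo_mul (quo_pi x) (quo_pi y).
Proof.
rewrite /quo_mul; set x' := generic_quotient.repr _; set y' := generic_quotient.repr _.
have hx : ideal_set I (x - x') by apply/quo_piP; rewrite [RHS]generic_quotient.reprK.
have hy : ideal_set I (y - y') by apply/quo_piP; rewrite [RHS]generic_quotient.reprK.
apply/quo_piP; have [_ hD hM] := idealP I.
have -> : x * y - x' * y' = y * (x - x') + x' * (y - y').
  by rewrite !mulrBr addrA (mulrC y x') subrK (mulrC y).
by apply: hD; apply: hM.
Qed.

Lemma quo_mulA : associative quo_mul.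
Proof.
move=> x y z; have [a <-] := quo_piE x; have [b <-] := quo_piE y.
by have [c <-] := quo_piE z; rewrite -!quo_piM mulrA.
Qed.
Lemma quo_mulC : commutative quo_mul.
Proof.
move=> x y; have [a <-] := quo_piE x; have [b <-] := quo_piE y.
by rewrite -!quo_piM mulrC.
Qed.
Lemma quo_mul1 : left_id (quo_pi 1) quo_mul.
Proof. by move=> x; have [a <-] := quo_piE x; rewrite -quo_piM mul1r. Qed.
Lemma quo_mulDl : left_distributive quo_mul +%R.
Proof.
move=> x y z; have [a <-] := quo_piE x; have [b <-] := quo_piE y.
by have [c <-] := quo_piE z; rewrite -!(quo_piM, quo_piD) mulrDl.
Qed.
HB.instance Definition _ := GRing.Zmodule_isComPzRing.Build Q
  quo_mulA quo_mulC quo_mul1 quo_mulDl.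

End QuotientRing.

Section IdealModule.
Variables (A : comPzRingType) (J : ideal A).

Definition ideal_submod : {pred A^o} := ideal_pred J.

Lemma ideal_submod_closed : submod_closed ideal_submod.
Proof.
have [h0 hD hM] := idealP J.
by split=> [|a x y]; rewrite !inE //= => hx hy; apply: hD => //; apply: hM.
Qed.
HB.instance Definition _ :=
  GRing.isSubmodClosed.Build A A^o ideal_submod ideal_submod_closed.

Record ideal_mod := IdealMod { ideal_mod_val :> A^o; _ : ideal_mod_val \in ideal_submod }.
HB.instance Definition _ := [isSub for ideal_mod_val].
HB.instance Definition _ := [Choice of ideal_mod by <:].
HB.instance Definition _ := [SubChoice_isSubZmodule of ideal_mod by <:].
HB.instance Definition _ := [SubZmodule_isSubLmodule of ideal_mod by <:].

End IdealModule.

Section CohenMacaulay.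
Variables (A : comPzRingType) (M : lmodType A).

Definition seq_submod (s : seq A) : set M :=
  [set v | exists w : 'I_(size s) -> M,
    v = \sum_(i < size s) s`_i *: w i].

Definition regular_seq (s : seq A) :=
  (forall i v, (i < size s)%N ->
     seq_submod (take i s) (s`_i *: v) -> seq_submod (take i s) v) /\
  exists v, ~ seq_submod s v.

Definition has_depth (d : nat) :=
  (exists s, [/\ {in s, forall a, nonunits a}, regular_seq s & size s = d]) /\
  forall s, {in s, forall a, nonunits a} -> regular_seq s -> (size s <= d)%N.

Definition annihilator : set A := [set a | forall v : M, a *: v = 0].

Definition prime_chain (I : set A) (n : nat) (p : nat -> set A) :=
  (forall i, (i <= n)%N -> prime_ideal (p i) /\ I `<=` p i) /\
  (forall i, (i < n)%N -> p i `<` p i.+1).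

(* dim M is the Krull dimension of A / Ann M *)
Definition has_dim (d : nat) :=
  (exists p, prime_chain annihilator d p) /\
  forall n p, prime_chain annihilator n p -> (n <= d)%N.

(* for A local Noetherian and M finitely generated; has_depth forces M to be
   nonzero, since the empty sequence is regular only if M is *)
Definition cohen_macaulay := exists d, has_depth d /\ has_dim d.

End CohenMacaulay.

Definition cplx (R : realType) : numFieldType := R[i].

Section Germs.
Variables (R : realType) (m : nat).
Local Notation C := (cplx R).
Local Notation OS := (cseries C m).

(* ps_partial f z converges to f(z) for z close to 0, so this says that f vanishes
   on X near 0 *)
Definition vanishing (X : set 'rV[C]_m) : set OS :=
  [set f | \forall z \near (0 : 'rV[C]_m),
     X z -> ps_partial f z N @[N --> \oo] --> (0 : C)].

Lemma near_small (s : C) : 0 < s ->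
  \forall z \near (0 : 'rV[C]_m), forall i : 'I_m, `|(z : 'rV[C]_m) 0 i| <= s.
Proof.
move=> s0; apply/nbhs_ballP; exists s => //= z hz i.
move: hz; rewrite [X in X -> _]/ball /= => -[_ /(_ 0 i)].
by rewrite /ball /= mxE sub0r normrN => /ltW.
Qed.

Lemma complex_archi (x : C) : exists n : nat, `|x| <= n%:R.
Proof.
have /complex_realP [y ->] : `|x| \is Num.real by apply: normr_real.
exists (Num.bound `|y|); rewrite -(rmorph_nat (real_complex R)) lecR.
by apply: (le_trans (ler_norm y)); apply/ltW/archi_boundP.
Qed.

Lemma half_cvg0 (M : C) : M * 2 ^- N @[N --> \oo] --> (0 : C).
Proof.
apply/cvgr0Pnorm_lt => e e0.
have [n hn] := complex_archi (M / e).
exists n.+1 => // N /= nN; rewrite normrM normfV normrX normr_nat.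
rewrite ltr_pdivrMr ?exprn_gt0 // -ltr_pdivrMl // mulrC.
rewrite -(gtr0_norm e0) -normfV -normrM; apply: (le_lt_trans hn).
rewrite -natrX ltr_nat; apply: (leq_ltn_trans (leq_trans (leqnSn n) nN)).
exact: ltn_expl.
Qed.

Lemma vanishing_is_ideal X : is_ideal (vanishing X).
Proof.
split.
- rewrite /vanishing /mkset; near=> z => _.
  rewrite (_ : (fun N => _) = fun=> (0 : C)); first exact: cvg_cst.
  by apply/funext => N; rewrite /ps_partial big1 // => b _; rewrite mul0r.
- move=> f g; rewrite /vanishing /mkset => hf hg; near=> z => Xz.
  rewrite (_ : (fun N => _) = fun N => ps_partial f z N + ps_partial g z N).
    by rewrite -[0]addr0; apply: cvgD; [move: Xz; near: z | move: Xz; near: z].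
  apply/funext => N; rewrite /ps_partial -big_split; apply: eq_bigr => b _.
  exact: mulrDl.
- move=> a f; rewrite /vanishing /mkset => hf.
  have [r r0 [M hM]] := ps_convergent_common (coef_conv a) (coef_conv f).
  have r20 : 0 < r / 2 by rewrite divr_gt0.
  near=> z => Xz.
  have zr : forall i, `|z 0 i| <= r / 2 by near: z; apply: near_small.
  have zr' i : `|z 0 i| <= r.
    by apply: (le_trans (zr i)); rewrite ler_pdivrMr // ler_peMr ?ler1n // ltW.
  have hz : ps_partial f z N @[N --> \oo] --> (0 : C) by move: Xz; near: z.
  have Hd N : `|ps_partial (a * f) z N - ps_partial a z N * ps_partial f z N|
      <= M * M * 2 ^- N.
    by have [h1 h2] := hM N; apply: (ps_partialM r0 zr h1 h2).
  have Hb N : `|ps_partial a z N| <= M.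
    by have [h1 _] := hM N; apply: (norm_ps_partial r0 zr' h1).
  apply/cvgr0Pnorm_lt => e e0.
  have M0 : 0 <= M by apply: le_trans (Hb 0%N).
  have e1 : 0 < e / 2 by rewrite divr_gt0.
  have e2 : 0 < e / 2 / (M + 1) by rewrite divr_gt0 // ltr_wpDl.
  near=> N.
  have A1 : `|M * M * 2 ^- N| < e / 2.
    near: N; exact: (cvgr0_norm_lt _ (half_cvg0 (M * M)) _ e1).
  have A2 : `|ps_partial f z N| < e / 2 / (M + 1).
    near: N; exact: (cvgr0_norm_lt _ hz _ e2).
  rewrite -(subrK (ps_partial a z N * ps_partial f z N) (ps_partial (a * f) z N)).
  apply: (le_lt_trans (ler_normD _ _)); rewrite [e]splitr; apply: ltr_leD.
    apply: (le_lt_trans (Hd N)); apply: le_lt_trans A1.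
    by rewrite ger0_norm // !mulr_ge0 // invr_ge0 exprn_ge0.
  rewrite normrM; apply: le_trans (_ : M * (e / 2 / (M + 1)) <= _).
    by apply: ler_pM; rewrite ?normr_ge0 // ltW.
  rewrite mulrCA ger_pMr // ler_pdivrMr ?ltr_wpDl // mul1r lerDl.
  exact: ler01.
Unshelve. all: by end_near.
Qed.

(* the ideal I_X of the reduced germ at 0 of X *)
Definition germ_ideal (X : set 'rV[C]_m) : ideal OS := Ideal (vanishing_is_ideal X).

Definition germ_ring (X : set 'rV[C]_m) := quo (germ_ideal X).

(* the sequences (f_1, ..., f_k) defining a reduced complete intersection C
   that contains X *)
Definition reduced_ci k (X : set 'rV[C]_m) (f : k.-tuple OS) :=
  [/\ forall i, vanishing X (tnth f i),
      @regular_seq OS OS^o f &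
      radical_ideal (span_ideal [set` f])].

Definition jacobian_ideal k (X : set 'rV[C]_m) (f : k.-tuple OS) : ideal (germ_ring X) :=
  span_ideal (@quo_pi OS (germ_ideal X) @` max_minors (jacobian f)).

(* For X equidimensional of codimension k the isomorphism class of
   jacobian_ideal X f does not depend on f and some f exists, so that the two
   conjuncts together say that J_{X/C} is Cohen-Macaulay for one, equivalently
   for every, choice of f. *)
Definition free_singularity k (X : set 'rV[C]_m) :=
  (exists f : k.-tuple OS, reduced_ci X f) /\
  forall f : k.-tuple OS, reduced_ci X f ->
    cohen_macaulay (ideal_mod (jacobian_ideal X f)).

Definition coord_subspace (E : {set 'I_m}) : set 'rV[C]_m :=
  [set z | forall i, i \in E -> z 0 i = 0].

Definition normal_crossing k (X : set 'rV[C]_m) :=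
  exists r (E : 'I_r -> {set 'I_m}),
    [/\ (0 < r)%N, injective E, forall j, #|E j| = k &
        X = \bigcup_j coord_subspace (E j)].

End Germs.

(* Main.v *)
(* Write A for the ring of convergent power series and P_E for the prime of the
   coordinate subspace X_E.  If f is a regular sequence of length k in I_X
   generating a radical ideal, then the Jacobian minor with columns g lies in P_E
   unless g enumerates E, and the minor Delta_E does not lie in P_E: this prime is
   minimal over (f), so t x_i = sum_a c_ia f_a (i in E) for some t outside P_E, and
   differentiating this modulo P_E shows that Delta_E divides a power of t.  Hence
   J_{X/C} is isomorphic to the direct sum of the A / P_{E_j}, which are regular
   rings of dimension m - k; sufficiently general linear forms are a regular
   sequence on all of them at once.

   The minimality of P_E, the dimension and the upper bound for the depth all follow
   from the fact that chains of primes of A have length at most m.  For this, the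
   dimension of A / (Q + m^N) is O(N^m) for Q = 0 and drops by a factor N at every
   strict inclusion of primes Q < Q', by the Artin-Rees property, which comes from
   the division theorem for convergent power series.

   A complete intersection containing X is cut out by products f_t = prod_j l_{t,j}
   of linear forms l_{t,j} in general position subject to vanishing on X_{E_j}. *)
From HB Require Import structures.
Require Import Defs.
From mathcomp Require Import all_boot all_order all_algebra complex.
From mathcomp Require Import all_classical all_reals topology normedtype sequences.
From mathcomp Require Import zify.
Set Implicit Arguments.
Unset Strict Implicit.
Unset Printing Implicit Defensive.
Import Order.TTheory GRing.Theory Num.Theory numFieldNormedType.Exports.
Local Open Scope classical_set_scope.
Local Open Scope ring_scope.

(** * Exponents and coefficients *)

Section Exponents.
Variable m : nat.
Local Notation idx := (mindex m).
Implicit Types a b c mu : idx.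

(** Heights are bounded below by regular elements: if [a] is regular modulo [I], a prime over
    [I + (a)] contains a strictly smaller prime over [I] that avoids [a]. They are bounded above
    only through the bound [m] on all chains: a prime strictly below P_E and containing (f) would
    give a chain of length k + 1 ending at P_E, which the m - k remaining coordinates prolong to
    length m + 1.

    Convergence is the obstacle in the division theorem. The degree-lexicographic order is replaced
    by a positive integral weight w, so that at a point with coordinates e^(w_i), e small, the
    leading term dominates the tail and the error of one division step has at most half the norm.
    Evaluation at such points also shows that a series vanishing on X_E has no monomial free of the
    variables of E.

    No linear change of coordinates is applied to series: ideals of linear forms are shown to be
    prime by dividing down to series free of pivot variables and by differentiating along the kernel
    of an echelon matrix. *)

Definition mle a b := [forall i, (a i <= b i)%N].
Definition msub a b : idx := [ffun i => (a i - b i)%N].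

Lemma mleP a b : reflect (exists c, madd a c = b) (mle a b).
Proof.
apply: (iffP forallP) => [h|[c <-] i]; last by rewrite ffunE leq_addr.
by exists (msub b a); apply/ffunP => i; rewrite !ffunE subnKC.
Qed.

Lemma msubK a c : msub (madd a c) a = c.
Proof. by apply/ffunP => i; rewrite !ffunE addKn. Qed.

Lemma maddK a b : mle a b -> madd a (msub b a) = b.
Proof. by case/mleP => c <-; rewrite msubK. Qed.

Definition wdeg (w : 'I_m -> nat) a : nat := (\sum_i w i * a i)%N.

Lemma wdegD w a b : wdeg w (madd a b) = (wdeg w a + wdeg w b)%N.
Proof.
by rewrite /wdeg -big_split; apply: eq_bigr => i _; rewrite ffunE mulnDr.
Qed.

Lemma mdegree_le_wdeg w a : (forall i, 0 < w i)%N -> (mdegree a <= wdeg w a)%N.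
Proof. by move=> w0; apply: leq_sum => i _; rewrite leq_pmull. Qed.

Lemma mdegree_eq0 a : mdegree a = 0%N -> a = mzero m.
Proof.
move=> h; apply/ffunP => i; rewrite ffunE; apply/eqP.
by rewrite -leqn0 -h mdegree_ge.
Qed.

Lemma madd_eq0 a b : madd a b = mzero m -> a = mzero m /\ b = mzero m.
Proof.
by move=> e; split; apply/ffunP => i; move/ffunP/(_ i): e; rewrite !ffunE;
  move/eqP; rewrite addn_eq0 => /andP [/eqP ea /eqP eb]; rewrite ?ea ?eb.
Qed.

Fixpoint digits (B : nat) (s : seq nat) : nat :=
  if s is x :: s' then (x * B ^ size s' + digits B s')%N else 0%N.

Lemma digits_lt B s : all (fun x => x < B)%N s -> (digits B s < B ^ size s)%N.
Proof.
elim: s => //= x s ih /andP [xB /ih h]; rewrite expnS.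
apply: (@leq_trans (x * B ^ size s + B ^ size s)); first by rewrite ltn_add2l.
by rewrite -mulSnr leq_mul2r xB orbT.
Qed.

Lemma digitsE B s : digits B s = (\sum_(i < size s) nth 0 s i * B ^ (size s - i.+1))%N.
Proof.
elim: s => [|x s ih] /=; first by rewrite big_ord0.
by rewrite big_ord_recl /= subn1 /= ih; congr (_ + _)%N; apply: eq_bigr.
Qed.

(** The head is minimised, then the tail among the sequences with that head. Only the entries of [s]
    have to be below [B]: at the first difference [t] is larger by at least one unit, which
    outweighs all later digits of [s], whatever the later entries of [t] are. *)
Lemma lex_min_digits n (S : set (seq nat)) : (forall s, S s -> size s = n) -> S !=set0 ->
  exists s, S s /\ forall t, S t -> (head 0 s <= head 0 t)%N /\
    (t <> s -> forall B, all (fun x => x < B)%N s -> (digits B s < digits B t)%N).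
Proof.
elim: n S => [|n ih] S sz [s0 Ss0].
  exists s0; split=> // t St.
  by rewrite (size0nil (sz _ St)) (size0nil (sz _ Ss0)).
have ex : exists x, `[< exists s, S (x :: s) >].
  case: s0 Ss0 (sz _ Ss0) => //= x s Ss _; exists x; apply/asboolP; by exists s.
pose x := ex_minn ex.
have /asboolP [s1 Sx] : `[< exists s, S (x :: s) >] by rewrite /x; case: ex_minnP.
have xmin t : S t -> (x <= head 0 t)%N.
  case: t => [|y t] St; first by move: (sz _ St).
  by rewrite /x; case: ex_minnP => z _; apply; apply/asboolP; exists t.
have [||s [Ss hs]] := ih [set s | S (x :: s)].
- by move=> s /sz [].
- by exists s1.
exists (x :: s); split=> // t St; split; first exact: xmin.
case: t St => [/sz //|y t St] ne B /= /andP [xB sB].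
have szt : size t = size s by move: (sz _ St) (sz _ Ss) => /= [->] [->].
have := xmin _ St; rewrite /= leq_eqVlt => /orP [/eqP e|lt].
  rewrite -e szt ltn_add2l; apply: (hs t _).2 => //; first by rewrite /= e.
  by move=> ets; apply: ne; rewrite e ets.
apply: leq_trans (leq_addr _ _); rewrite szt.
apply: (@leq_trans (x * B ^ size s + B ^ size s)).
  by rewrite ltn_add2l digits_lt.
by rewrite -mulSnr leq_mul2r lt orbT.
Qed.

(* For [B] large, comparing [lexw B]-weighted degrees amounts to comparing
   degrees first and then exponents lexicographically. *)
Definition lexw (B : nat) (i : 'I_m) : nat := (B ^ m + B ^ (m - i.+1))%N.

Lemma lexw_gt0 B i : (0 < B)%N -> (0 < lexw B i)%N.
Proof. by move=> B0; rewrite addn_gt0 expn_gt0 B0. Qed.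

(** The least element for the degree-lexicographic order, stated through weights because division is
    done with a weight. Any [B] above the degree of [mu] alone separates [mu] from all of [S], so
    one weight works for infinitely many exponents. *)
Definition initial (S : set idx) mu := S mu /\ forall a, S a ->
  (mdegree mu <= mdegree a)%N /\
  (a <> mu -> forall B, (mdegree mu < B)%N -> (wdeg (lexw B) mu < wdeg (lexw B) a)%N).

(** An exponent is encoded as its degree followed by its entries; read in base [B], this sequence is
    the [lexw B]-weighted degree. *)
Lemma initial_ex (S : set idx) : S !=set0 -> exists mu, initial S mu.
Proof.
move=> [a0 Sa0].
pose key a := mdegree a :: [seq a i | i <- enum 'I_m].
have szk a : size (key a) = m.+1 by rewrite /= size_map size_enum_ord.
have keyE B a : digits B (key a) = wdeg (lexw B) a.
  rewrite /= digitsE size_map size_enum_ord /wdeg /lexw.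
  under [RHS]eq_bigr do rewrite mulnDl.
  rewrite big_split /= -big_distrr /= mulnC; congr (_ + _)%N.
  apply: eq_bigr => i _; rewrite mulnC; congr (_ * _)%N.
  by rewrite (nth_map i) ?size_enum_ord // nth_ord_enum.
have [||s [[mu Smu <-] hmin]] := @lex_min_digits m.+1 [set key a | a in S].
- by move=> s [a _ <-].
- by exists (key a0), a0.
exists mu; split=> // a Sa.
have [h1 h2] := hmin _ (ex_intro2 _ _ a Sa erefl); split=> // ne B muB.
rewrite -!keyE; apply: h2.
  move=> e; apply: ne; apply/ffunP => i; move: e => [_ /eq_in_map e].
  by apply: e; rewrite mem_enum.
rewrite /= muB /=; apply/allP => _ /mapP [i _ ->].
exact: leq_ltn_trans (mdegree_ge _ _) muB.
Qed.

End Exponents.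

Section Coefficients.
Variables (K : numFieldType) (m : nat).
Local Notation idx := (mindex m).
Implicit Types (u v : idx -> K) (a mu : idx).

Lemma ps_mul_congr u v u' v' a :
  (forall b c, madd b c = a -> u b * v c = u' b * v' c) ->
  ps_mul u v a = ps_mul u' v' a.
Proof.
move=> h; apply: eq_bigr => b _; apply: eq_bigr => c /eqP e; exact: h.
Qed.

Lemma ps_mul_eq0 u v a :
  (forall b c, madd b c = a -> u b * v c = 0) -> ps_mul u v a = 0.
Proof.
move=> h; rewrite /ps_mul big1 // => b _; rewrite big1 // => c /eqP; exact: h.
Qed.

Lemma ps_mul_neq0 u v a : ps_mul u v a <> 0 ->
  exists b c, [/\ madd b c = a, u b <> 0 & v c <> 0].
Proof.
move=> h; apply: contrapT => hn; apply: h; apply: ps_mul_eq0 => b c e.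
have [->|/eqP ub] := eqVneq (u b) 0; first by rewrite mul0r.
have [->|/eqP vc] := eqVneq (v c) 0; first by rewrite mulr0.
by case: hn; exists b, c.
Qed.

Lemma ps_mul_single u v b0 c0 :
  (forall b c, madd b c = madd b0 c0 -> b <> b0 -> u b * v c = 0) ->
  ps_mul u v (madd b0 c0) = u b0 * v c0.
Proof.
set a := madd b0 c0 => h; rewrite /ps_mul; set N := (mdegree a).+1.
have /box_indexP [z ez] : in_box N b0.
  by apply: (@in_boxDl _ _ _ c0); rewrite in_box_degree.
rewrite (bigD1 z) //= [X in _ + X]big1 ?addr0 => [|b nb]; last first.
  rewrite big1 // => c /eqP e; apply: h => // ebz; case/eqP: nb.
  by apply: box_index_inj; rewrite ebz ez.
rewrite ez (eq_bigl (fun c : mbox m N => box_index c == c0)).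
  rewrite (@box_sum1 m K N c0 (fun c => u b0 * v c)).
  by rewrite (@in_boxDr _ _ b0) // in_box_degree.
by move=> c; rewrite (inj_eq (@maddI m b0)).
Qed.

Lemma abs_psum_ge0 u (r : K) N : 0 <= r -> 0 <= abs_psum u r N.
Proof.
by move=> r0; apply: sumr_ge0 => b _; rewrite mulr_ge0 ?normr_ge0 // exprn_ge0.
Qed.

Lemma abs_psum_widen u (r : K) N N' : (N <= N')%N ->
  (forall a, u a != 0 -> in_box N' a -> in_box N a) ->
  abs_psum u r N = abs_psum u r N'.
Proof.
move=> le h; rewrite /abs_psum.
have aux n : \sum_(b : mbox m n) `|u (box_index b)| * r ^+ mdegree (box_index b) =
    \sum_(b : mbox m n | u (box_index b) != 0)
      `|u (box_index b)| * r ^+ mdegree (box_index b).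
  rewrite [LHS](bigID (fun b => u (box_index b) != 0)) /= addrC big1 ?add0r //.
  by move=> b; rewrite negbK => /eqP ->; rewrite normr0 mul0r.
rewrite !aux.
exact: (@box_sum_widen m K N N' (fun a => u a != 0)
  (fun a => `|u a| * r ^+ mdegree a)).
Qed.

Lemma abs_psum_mono u (r : K) N N' : 0 <= r -> (N <= N')%N ->
  abs_psum u r N <= abs_psum u r N'.
Proof.
move=> r0 le; pose u' a := if in_box N a then u a else 0.
have -> : abs_psum u r N = abs_psum u' r N.
  by apply: eq_bigr => b _; rewrite /u'; case: box_indexP => // [[]]; exists b.
rewrite (abs_psum_widen _ le); last by move=> a; rewrite /u'; case: ifP; rewrite ?eqxx.
apply: ler_sum => b _; rewrite ler_wpM2r ?exprn_ge0 // /u'.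
by case: ifP => //; rewrite normr0.
Qed.

Lemma ps_convergent_fin N u : (forall a, u a <> 0 -> in_box N a) -> ps_convergent u.
Proof.
move=> h; exists 1; rewrite ?ltr01 //; exists (abs_psum u 1 N) => N'.
apply: (le_trans (abs_psum_mono u ler01 (leq_addr N N'))).
rewrite [X in _ <= X](@abs_psum_widen _ _ N (N' + N)) ?leq_addl //.
by move=> a /eqP /h.
Qed.

Lemma ps_convergent_le u v : ps_convergent v -> (forall a, `|u a| <= `|v a|) ->
  ps_convergent u.
Proof.
move=> [r r0 [M hM]] h; exists r => //; exists M => N; apply: (le_trans _ (hM N)).
by apply: ler_sum => b _; rewrite ler_wpM2r ?exprn_ge0 // ltW.
Qed.

Local Notation A := (cseries K m).
Implicit Types f g h : A.

Lemma cs_ext f g : (forall a, f a = g a) -> f = g.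
Proof. by move=> e; apply: val_inj; apply/funext. Qed.

Lemma coefD f g a : (f + g) a = f a + g a. Proof. by []. Qed.
Lemma coefB f g a : (f - g) a = f a - g a. Proof. by []. Qed.
Lemma coefM f g a : (f * g) a = ps_mul f g a. Proof. by []. Qed.
Lemma coef0 a : (0 : A) a = 0. Proof. by []. Qed.
Lemma coef1 a : (1 : A) a = (a == mzero m)%:R. Proof. by []. Qed.

Lemma coef_sum I (s : seq I) (P : pred I) (F : I -> A) a :
  (\sum_(i <- s | P i) F i) a = \sum_(i <- s | P i) F i a.
Proof. by elim/big_rec2: _ => // i x y _ <-. Qed.

Lemma coefMz f g : (f * g) (mzero m) = f (mzero m) * g (mzero m).
Proof.
rewrite coefM -{1}[mzero m]madd0; apply: ps_mul_single => b c.
by rewrite madd0 => /madd_eq0 [-> _].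
Qed.

Lemma cs_restrict_conv f (P : idx -> bool) :
  ps_convergent (fun a => if P a then f a else 0).
Proof.
by apply: (ps_convergent_le (coef_conv f)) => a; case: ifP; rewrite ?normr0.
Qed.
Definition cs_restrict f P : A := cs_build (cs_restrict_conv f P).

Lemma cs_fin_conv N u : ps_convergent (fun a => if in_box N a then u a else 0).
Proof. by apply: (@ps_convergent_fin N) => a; case: ifP. Qed.
Definition cs_fin N u : A := cs_build (cs_fin_conv N u).

Definition cst (x : K) : A := cs_fin 1 (fun a => x * (a == mzero m)%:R).

Lemma coef_cst x a : cst x a = x * (a == mzero m)%:R.
Proof.
rewrite /=; case: ifP => // /forallP h; case: eqP => [e|]; last by rewrite mulr0.
by case: h => i; rewrite e ffunE.
Qed.

Lemma coef_cstM x f a : (cst x * f) a = x * f a.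
Proof.
rewrite coefM -{1}[a]madd0 ps_mul_single; first by rewrite coef_cst eqxx mulr1.
by move=> b c _ nb; rewrite coef_cst; case: eqP => // _; rewrite mulr0 mul0r.
Qed.

Definition mono mu : A := cs_fin (mdegree mu).+1 (fun a => (a == mu)%:R).

Lemma coef_mono mu a : mono mu a = (a == mu)%:R.
Proof.
rewrite /=; case: ifP => //; case: eqP => // ->.
by rewrite in_box_degree.
Qed.

Lemma coef_monoM mu f a : (mono mu * f) (madd mu a) = f a.
Proof.
rewrite coefM ps_mul_single ?coef_mono ?eqxx ?mul1r // => b c _ nb.
by rewrite coef_mono; case: eqP => // _; rewrite mul0r.
Qed.

Lemma coef_monoM0 mu f a : ~ mle mu a -> (mono mu * f) a = 0.
Proof.
move=> nle; apply: contrapT => /ps_mul_neq0 [b [c [e]]].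
rewrite coef_mono; case: eqP => // eb _ _; apply: nle; apply/mleP.
by exists c; rewrite -eb.
Qed.

Lemma mono_inj mu f g : mono mu * f = mono mu * g -> f = g.
Proof. by move=> e; apply: cs_ext => a; rewrite -(coef_monoM mu f) e coef_monoM. Qed.

End Coefficients.

(** * Derivations, coordinate primes and weighted norms *)

Arguments coef : simpl never.
Section Derivations.
Variables (K : numFieldType) (m : nat).
Local Notation idx := (mindex m).
Local Notation A := (cseries K m).
Implicit Types f g h : A.

Lemma coef_pderiv (i : 'I_m) f a : pderiv i f a = f (madd a (munit i)) *+ (a i).+1.
Proof. by []. Qed.

Lemma coef_euler (i : 'I_m) f a : (mono K (munit i) * pderiv i f) a = f a *+ a i.
Proof.
have [/mleP [c <-]|/negP nle] := boolP (mle (munit i) a).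
  by rewrite coef_monoM coef_pderiv maddC !ffunE eqxx add1n.
rewrite coef_monoM0 //; case e: (a i) => [|n]; first by rewrite mulr0n.
case: nle; apply/forallP => j; rewrite ffunE; case: eqP => // ->.
by rewrite e.
Qed.

(** After multiplication by x_i, which is cancellable, the derivative becomes the Euler operator
    scaling the coefficient at [a] by [a i]; the product rule is then the additivity of
    exponents. *)
Lemma pderivM (i : 'I_m) f g : pderiv i (f * g) = pderiv i f * g + f * pderiv i g.
Proof.
apply: (@mono_inj _ _ (munit i)); rewrite mulrDr mulrA (mulrCA _ f).
apply: cs_ext => a; rewrite coef_euler coefD.
rewrite [(f * g) a]coefM [(_ * g) a]coefM [(f * _) a]coefM /ps_mul -sumrMnl -big_split.
apply: eq_bigr => b _; rewrite -sumrMnl -big_split; apply: eq_bigr => c /eqP e /=.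
have -> : a i = (box_index b i + box_index c i)%N.
  by rewrite -[LHS](congr1 (fun x : idx => x i) e) ffunE.
by rewrite !coef_euler mulrnDr mulrnAl mulrnAr.
Qed.

Lemma pderivD (i : 'I_m) f g : pderiv i (f + g) = pderiv i f + pderiv i g.
Proof. by apply: cs_ext => a; rewrite coefD !coef_pderiv coefD mulrnDl. Qed.

Lemma pderiv_sum (i : 'I_m) T (s : seq T) (F : T -> A) :
  pderiv i (\sum_(j <- s) F j) = \sum_(j <- s) pderiv i (F j).
Proof.
elim/big_rec2: _ => [|j x y _ <-]; last exact: pderivD.
by apply: cs_ext => a; rewrite coef_pderiv coef0 mul0rn.
Qed.

End Derivations.

Section CoordinatePrimes.
Variables (K : numFieldType) (m : nat).
Local Notation idx := (mindex m).
Local Notation A := (cseries K m).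
Implicit Types (f g h : A) (E : {set 'I_m}).

Definition off E (a : idx) := forall i, i \in E -> a i = 0%N.

(** Described by coefficients, which makes membership independent of any choice of generators;
    [coord_prime_linear] identifies it with the ideal generated by the variables of [E]. *)
Definition coord_prime E : set A := [set f | forall a, off E a -> f a = 0].

Lemma offD E a b : off E (madd a b) <-> off E a /\ off E b.
Proof.
split=> [h|[ha hb] i iE]; last by rewrite ffunE ha ?hb.
by split=> i /h; rewrite ffunE => /eqP; rewrite addn_eq0 => /andP [/eqP ? /eqP ?].
Qed.

Lemma off0 E : off E (mzero m).
Proof. by move=> i _; rewrite ffunE. Qed.

Lemma coord_prime_is_ideal E : is_ideal (coord_prime E).
Proof.
split=> // [f g hf hg a ha|f g hg a ha].
  by rewrite coefD hf ?hg ?addr0.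
apply: ps_mul_eq0 => b c e; rewrite hg ?mulr0 //.
by move: ha; rewrite -e => /offD [].
Qed.

(** Any other contributing pair has strictly larger weight in its first entry and no smaller weight
    in the second, so it cannot add up to [madd mu nu]. The sets [S] and [T] may be parts of the
    supports, provided the contributing pairs stay inside them. *)
Lemma initialM (u v : idx -> K) (S T : set idx) mu nu : initial S mu -> initial T nu ->
  (forall b c, madd b c = madd mu nu -> u b <> 0 -> v c <> 0 -> S b /\ T c) ->
  ps_mul u v (madd mu nu) = u mu * v nu.
Proof.
move=> [Smu hS] [Tnu hT] h; apply: ps_mul_single => b c e nb.
have [->|/eqP ub] := eqVneq (u b) 0; first by rewrite mul0r.
have [->|/eqP vc] := eqVneq (v c) 0; first by rewrite mulr0.
have [/hS [_ /(_ nb) Sb] /hT [_ Tc]] := h _ _ e ub vc.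
pose B := (mdegree mu + mdegree nu).+1.
have l1 : (wdeg (lexw B) mu < wdeg (lexw B) b)%N by apply: Sb; rewrite ltnS leq_addr.
have l2 : (wdeg (lexw B) nu <= wdeg (lexw B) c)%N.
  have [->//|/eqP nc] := eqVneq c nu; apply/ltnW/Tc => //.
  by rewrite ltnS leq_addl.
have := congr1 (wdeg (lexw B)) e; rewrite !wdegD => e'.
by have := leq_add l1 l2; rewrite addSn e' ltnn.
Qed.

(** The initial terms are taken among the monomials free of [E]; since factors of such a monomial
    are again free of [E], the product of the two initial coefficients is a coefficient of the
    product. *)
Lemma coord_primeP E : prime_ideal (coord_prime E).
Proof.
split; first exact: coord_prime_is_ideal.
  move=> /(_ _ (@off0 E)); rewrite coef1 eqxx; apply/eqP; exact: oner_neq0.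
move=> f g fg; apply: contrapT => /not_orP [nf ng].
have ex h : ~ coord_prime E h -> [set a | off E a /\ h a <> 0] !=set0.
  by move=> /existsNP [a /not_implyP [? ?]]; exists a.
have [mu imu] := initial_ex (ex _ nf); have [nu inu] := initial_ex (ex _ ng).
have [[omu fmu] _] := imu; have [[onu gnu] _] := inu.
have oD : off E (madd mu nu) by apply/offD.
have /eqP := fg _ oD.
rewrite coefM (initialM imu inu); last by move=> b c e fb gc; move: oD; rewrite -e => /offD [].
by rewrite mulf_eq0 => /orP [] /eqP.
Qed.

Lemma coord_prime0 : coord_prime (finset.set0 : {set 'I_m}) = [set 0 : A].
Proof.
apply/seteqP; split=> [f h|f -> //]; apply: cs_ext => a; apply: h => i.
by rewrite inE.
Qed.

Lemma coord_primeS E (F : {set 'I_m}) : E \subset F -> coord_prime E `<=` coord_prime F.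
Proof. by move=> /fintype.subsetP EF f hf a ha; apply: hf => i /EF; apply: ha. Qed.

Lemma coord_prime_mono E a : coord_prime E (mono K a) <-> ~ off E a.
Proof.
split=> [h /h /eqP|h b ob]; first by rewrite coef_mono eqxx oner_eq0.
by rewrite coef_mono; case: eqP => // e; case: h; rewrite -e.
Qed.

Lemma coord_prime_var E i : coord_prime E (mono K (munit i)) <-> i \in E.
Proof.
split=> [/coord_prime_mono h|iE].
  apply: contrapT => /negP iE; apply: h => j jE; rewrite ffunE.
  by case: eqP => // e; move: iE; rewrite -e jE.
by apply/coord_prime_mono => /(_ i iE) /eqP; rewrite ffunE eqxx.
Qed.

Lemma coord_prime_pderiv E i f : i \notin E -> coord_prime E f ->
  coord_prime E (pderiv i f).
Proof.
move=> iE h a ha; rewrite coef_pderiv h ?mul0rn //; apply/offD; split=> // j jE.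
by rewrite ffunE; case: eqP => // e; move: iE; rewrite -e jE.
Qed.

End CoordinatePrimes.

Section WeightedNorm.
Variables (K : numFieldType) (m : nat) (w : 'I_m -> nat).
Hypothesis w0 : forall i, (0 < w i)%N.
Local Notation idx := (mindex m).
Implicit Types (u v : idx -> K) (e : K).

(** The truncated sum of absolute values at the point with coordinates [e ^+ w i]. As [e] shrinks,
    the terms of lowest weight dominate. *)
Definition wnorm e u (N : nat) : K :=
  \sum_(b : mbox m N) `|u (box_index b)| * e ^+ wdeg w (box_index b).

Lemma wnormE e u N : 0 < e ->
  wnorm e u N = abs_psum (fun a => u a * e ^+ wdeg w a) 1 N.
Proof.
move=> e0; apply: eq_bigr => b _.
by rewrite expr1n mulr1 normrM [`|e ^+ _|]ger0_norm // exprn_ge0 // ltW.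
Qed.

Lemma wnormM e u v N : 0 < e -> wnorm e (ps_mul u v) N <= wnorm e u N * wnorm e v N.
Proof.
move=> e0; rewrite !wnormE //; apply: le_trans (abs_psum_mul _ _ _ ltr01).
rewrite le_eqVlt; apply/orP; left; apply/eqP; apply: eq_bigr => a _; congr (`|_| * _).
rewrite /ps_mul mulr_suml; apply: eq_bigr => b _.
rewrite mulr_suml; apply: eq_bigr => c /eqP E.
have -> : wdeg w (box_index a) = (wdeg w (box_index b) + wdeg w (box_index c))%N.
  by rewrite -[in LHS]E wdegD.
by rewrite exprD mulrACA.
Qed.

Lemma wnormD e u v N : 0 < e -> wnorm e (u \+ v) N <= wnorm e u N + wnorm e v N.
Proof.
move=> e0; rewrite -big_split /=; apply: ler_sum => b _ /=.
by rewrite -mulrDl ler_wpM2r ?ler_normD // exprn_ge0 // ltW.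
Qed.

Lemma wnorm_ge0 e u N : 0 < e -> 0 <= wnorm e u N.
Proof.
by move=> e0; apply: sumr_ge0 => b _; rewrite mulr_ge0 // exprn_ge0 // ltW.
Qed.

Lemma wnorm_sum e I (s : seq I) (F : I -> idx -> K) N : 0 < e ->
  wnorm e (fun a => \sum_(i <- s) F i a) N <= \sum_(i <- s) wnorm e (F i) N.
Proof.
move=> e0; rewrite exchange_big /=; apply: ler_sum => b _ /=.
by rewrite -mulr_suml ler_wpM2r ?ler_norm_sum // exprn_ge0 // ltW.
Qed.

Lemma wnorm_shift e u mu N : 0 < e ->
  wnorm e (fun b => u (madd mu b)) N * e ^+ wdeg w mu <= wnorm e u (mdegree mu + N)%N.
Proof.
move=> e0.
have hi (b : mbox m N) : in_box (mdegree mu + N) (madd mu (box_index b)).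
  apply/forallP => j; by rewrite !ffunE -addnS leq_add ?mdegree_ge ?ltn_ord.
pose s (b : mbox m N) : mbox m (mdegree mu + N) := [ffun j => Ordinal (forallP (hi b) j)].
have sE b : box_index (s b) = madd mu (box_index b).
  by apply/ffunP => j; rewrite [LHS]ffunE ffunE.
have sinj : injective s.
  move=> a b E; apply: box_index_inj; apply: (@maddI m mu).
  by rewrite -!sE E.
rewrite [X in _ <= X](bigID (mem [set s b | b : mbox m N]%SET)) /=.
rewrite big_imset /=; last by move=> ? ? _ _; apply: sinj.
rewrite -[X in X <= _]addr0; apply: lerD; last first.
  by apply: sumr_ge0 => b _; rewrite mulr_ge0 // exprn_ge0 // ltW.
rewrite mulr_suml; apply: ler_sum => b _.
by rewrite sE wdegD exprD [e ^+ wdeg w mu * _]mulrC mulrA.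
Qed.

Lemma wnorm_conv e u M : 0 < e -> e <= 1 -> (forall N, wnorm e u N <= M) ->
  ps_convergent u.
Proof.
move=> e0 e1 h; pose W := (\sum_i w i)%N.
have e' : 0 < e ^+ W by rewrite exprn_gt0.
(* [W] bounds every weight, so the weighted degree is at most [W] times the degree; with [e <= 1]
   the radius [e ^+ W] is admissible. *)
exists (e ^+ W) => //; exists M => N; apply: (le_trans _ (h N)).
apply: ler_sum => b _; rewrite ler_wpM2l // -exprM.
apply: ler_wiXn2l => //; first exact: ltW.
rewrite /mdegree big_distrr /=; apply: leq_sum => i _.
by rewrite leq_mul2r /W (bigD1 i) //= leq_addr orbT.
Qed.

(** Passing from a fixed radius parameter [s] to [e] multiplies each term by [(e / s)] to its
    weight, hence by at most [(e / s) ^+ k.+1]; the factor of [e] beyond [e ^+ k] absorbs all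
    constants. *)
Lemma wnorm_small u k (eta : K) : ps_convergent u -> 0 < eta ->
  (forall a, u a <> 0 -> (k < wdeg w a)%N) ->
  exists2 e0 : K, 0 < e0 & forall e, 0 < e -> e <= e0 ->
    forall N, wnorm e u N <= eta * e ^+ k.
Proof.
move=> [r r0 [M hM]] eta0 hu.
have M0 : 0 <= M by apply: le_trans (hM 0%N); apply: abs_psum_ge0; apply: ltW.
(* Below both 1 and [r], so that [s] to the weighted degree is at most [r] to the degree. *)
pose s := r / (1 + r).
have r1 : 0 < 1 + r by rewrite addr_gt0.
have s0 : 0 < s by rewrite divr_gt0.
have s1 : s <= 1 by rewrite /s ler_pdivrMr // mul1r lerDr.
have sr : s <= r by rewrite /s ler_pdivrMr // ler_peMr ?lerDl // ltW.
have hs N : wnorm s u N <= M.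
  apply: (le_trans _ (hM N)); apply: ler_sum => b _; rewrite ler_wpM2l //.
  apply: (@le_trans _ _ (s ^+ mdegree (box_index b))).
    by apply: ler_wiXn2l; rewrite ?(ltW s0) // mdegree_le_wdeg.
  by apply: lerXn2r => //; rewrite nnegrE ltW.
pose D := M / s ^+ k.+1 + 1.
have D0 : 0 < D by rewrite ltr_wpDl // divr_ge0 // exprn_ge0 // ltW.
pose e0 := (s^-1 + D / eta)^-1.
have e0i : 0 < s^-1 + D / eta by rewrite addr_gt0 ?invr_gt0 // divr_gt0.
have e00 : 0 < e0 by rewrite invr_gt0.
exists e0 => // e epos ele N.
have es : e <= s.
  apply: (le_trans ele); rewrite -[s]invrK /e0 lef_pV2 ?posrE ?invr_gt0 //.
  by rewrite lerDl divr_ge0 // ltW.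
have eD : e * D <= eta.
  rewrite -ler_pdivlMr //; apply: (le_trans ele).
  have -> : eta / D = (D / eta)^-1 by rewrite invf_div.
  rewrite lef_pV2 ?posrE ?divr_gt0 //.
  by rewrite lerDr invr_ge0 ltW.
have q0 : 0 <= e / s by rewrite divr_ge0 // ltW.
have q1 : e / s <= 1 by rewrite ler_pdivrMr // mul1r.
apply: (@le_trans _ _ ((e / s) ^+ k.+1 * M)).
  apply: le_trans (ler_wpM2l _ (hs N)); last by rewrite exprn_ge0.
  rewrite mulr_sumr; apply: ler_sum => b _.
  have [->|/eqP /hu lt] := eqVneq (u (box_index b)) 0.
    by rewrite normr0 !mul0r mulr0.
  rewrite mulrCA ler_wpM2l //.
  have -> : e ^+ wdeg w (box_index b) = (e / s) ^+ wdeg w (box_index b) * s ^+ wdeg w (box_index b).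
    by rewrite -exprMn divfK // gt_eqF.
  by rewrite ler_wpM2r ?exprn_ge0 ?(ltW s0) //; apply: ler_wiXn2l.
have -> : (e / s) ^+ k.+1 * M = e * (M / s ^+ k.+1) * e ^+ k.
  rewrite expr_div_n exprS -!mulrA; congr (e * _).
  by rewrite [in RHS]mulrA [RHS]mulrC [M * _]mulrC.
rewrite ler_wpM2r ?exprn_ge0 ?(ltW epos) //; apply: le_trans eD.
by rewrite ler_wpM2l ?(ltW epos) // lerDl ler01.
Qed.

End WeightedNorm.

(** The inverse of a sum of inverses serves as a lower bound for finitely many positive elements, in
    place of a minimum, as the order of [K] is only partial. *)
Lemma small_common (K : numFieldType) n (P : 'I_n -> K -> Prop) :
  (forall i, exists2 e0, 0 < e0 & forall e, 0 < e -> e <= e0 -> P i e) ->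
  exists e, [/\ 0 < e, e <= 1 & forall i, P i e].
Proof.
move=> h; have /choice [c hc] : forall i, exists e0, 0 < e0 /\ forall e, 0 < e -> e <= e0 -> P i e.
  by move=> i; have [e0 ? ?] := h i; exists e0.
pose S := 1 + \sum_i (c i)^-1.
have ci0 i : 0 < (c i)^-1 by rewrite invr_gt0; apply: (hc i).1.
have S1 : 1 <= S by rewrite lerDl sumr_ge0 // => i _; apply: ltW.
have S0 : 0 < S by apply: lt_le_trans S1.
exists S^-1; split; rewrite ?invr_gt0 ?invf_le1 // => i.
apply: (hc i).2; first by rewrite invr_gt0.
rewrite -[c i]invrK lef_pV2 ?posrE // /S (bigD1 i) //= addrCA lerDl.
by rewrite addr_ge0 // sumr_ge0 // => j _; apply: ltW.
Qed.

(** * Division in the ring of convergent power series *)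

Section Division.
Variables (K : numFieldType) (m s : nat) (w : 'I_m -> nat).
Variables (g : 'I_s -> cseries K m) (mu : 'I_s -> mindex m).
Hypothesis w0 : forall i, (0 < w i)%N.
Hypothesis lc0 : forall i, g i (mu i) <> 0.
Hypothesis g_gt : forall i a, g i a <> 0 -> a <> mu i -> (wdeg w (mu i) < wdeg w a)%N.
Local Notation idx := (mindex m).
Local Notation A := (cseries K m).
Implicit Types (u v f : idx -> K) (a : idx).

(** [sel] charges each exponent to at most one divisor, [qt i u] divides the terms of [u] charged to
    [i] by the leading term of [g i], and [err u] is minus what the tails then contribute. If
    [F = f + err F], then [f] is the sum of the [qt i F] times [g i], plus the terms of [F] charged
    to no divisor. *)
Let sel a := [pick i | mle (mu i) a].
Let qt i u : idx -> K := fun b =>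
  if sel (madd (mu i) b) == Some i then u (madd (mu i) b) / g i (mu i) else 0.
Let tail i : idx -> K := fun a => if a == mu i then 0 else g i a.
Let err u : idx -> K := fun a => - \sum_i ps_mul (qt i u) (tail i) a.

Let tail_gt i a : tail i a <> 0 -> (wdeg w (mu i) < wdeg w a)%N.
Proof. by rewrite /tail; case: eqP => // ne h; apply: g_gt. Qed.

Let err_local u v n : (forall a, (wdeg w a < n)%N -> u a = v a) ->
  forall a, (wdeg w a < n.+1)%N -> err u a = err v a.
Proof.
move=> uv a; rewrite ltnS => an; congr (- _); apply: eq_bigr => i _.
apply: ps_mul_congr => b c e.
have [->|/eqP /tail_gt lt] := eqVneq (tail i c) 0; first by rewrite !mulr0.
rewrite /qt uv //; apply: leq_trans an.
by rewrite -e !wdegD [X in (X < _)%N]addnC ltn_add2l.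
Qed.

(* [fixp f] solves [F = f + err F]: since [err] raises the weighted degree, the
   coefficients of the Picard iterates become stationary. *)
Let it f n := iter n (fun u a => f a + err u a) (fun=> 0).
Let fixp f : idx -> K := fun a => it f (wdeg w a).+1 a.

Let it_stable f n a : (wdeg w a < n)%N -> it f n a = fixp f a.
Proof.
have step k : forall a, (wdeg w a < k)%N -> it f k.+1 a = it f k a.
  elim: k => // k ih b bk; rewrite /it /=; congr (_ + _).
  exact: (err_local ih).
elim: n => // n ih; rewrite ltnS leq_eqVlt => /orP [/eqP <- //|lt].
by rewrite step // ih.
Qed.

Let fixpE f a : fixp f a = f a + err (fixp f) a.
Proof.
rewrite /fixp /it iterS -/(it f (wdeg w a)); congr (_ + _).
by apply: (@err_local _ _ (wdeg w a)) => // b /it_stable.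
Qed.

Let qt_shift i u a : ps_mul (qt i u) (g i) a = ps_mul (qt i u) (tail i) a +
    (if sel a == Some i then u a else 0).
Proof.
have -> : ps_mul (qt i u) (g i) a = ps_mul (qt i u) (tail i) a +
    ps_mul (qt i u) (fun a => if a == mu i then g i (mu i) else 0) a.
  rewrite /ps_mul -big_split; apply: eq_bigr => b _ /=.
  rewrite -big_split; apply: eq_bigr => c _ /=; rewrite -mulrDr /tail.
  by case: eqP => [->|_]; rewrite ?add0r ?addr0.
congr (_ + _); rewrite -/(ps_mul _ _ a) ps_mulC.
have [le|nle] := boolP (mle (mu i) a).
  rewrite -{1}(maddK le) ps_mul_single ?eqxx.
    rewrite /qt (maddK le); case: ifP; rewrite ?mulr0 // => _.
    by rewrite mulrC divfK //; apply/eqP/lc0.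
  by move=> b c _ /eqP /negbTE ->; rewrite mul0r.
rewrite ps_mul_eq0.
  case: ifP => // /eqP; rewrite /sel; case: pickP => // j le [e].
  by move: nle; rewrite -e le.
move=> b c e; case: eqP => [eb|]; last by rewrite mul0r.
by move: nle; rewrite -e eb; case: mleP => // -[]; exists c.
Qed.

(** The [s] tails together then cost at most a factor 1/2; [s.+1] keeps the inverse meaningful when
    there is no divisor. *)
Let small := (2%:R * s.+1%:R : K)^-1.

Let err_norm e u M : 0 < e ->
  (forall i N, wnorm w e (tail i) N <= small * `|g i (mu i)| * e ^+ wdeg w (mu i)) ->
  (forall N, wnorm w e u N <= M) -> forall N, wnorm w e (err u) N <= M / 2%:R.
Proof.
move=> e0 ht hu N.
have M0 : 0 <= M by apply: le_trans (hu 0%N); apply: wnorm_ge0.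
have gi i : 0 < `|g i (mu i)| by rewrite normr_gt0; apply/eqP/lc0.
have qn i : wnorm w e (qt i u) N * (`|g i (mu i)| * e ^+ wdeg w (mu i)) <= M.
  apply: le_trans (hu (mdegree (mu i) + N)%N).
  apply: le_trans (wnorm_shift w u (mu i) N e0).
  rewrite mulrA ler_wpM2r ?exprn_ge0 ?(ltW e0) // mulr_suml.
  apply: ler_sum => b _; rewrite mulrAC ler_wpM2r ?exprn_ge0 ?(ltW e0) // /qt.
  by case: ifP => _; rewrite ?normr0 ?mul0r // normrM normfV divfK // gt_eqF.
have -> : wnorm w e (err u) N = wnorm w e (fun a => \sum_i ps_mul (qt i u) (tail i) a) N.
  by apply: eq_bigr => b _; rewrite normrN.
apply: (le_trans (wnorm_sum _ _ _ _ e0)).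
apply: (@le_trans _ _ (\sum_(i < s) small * M)).
  apply: ler_sum => i _; apply: (le_trans (wnormM _ _ _ _ e0)).
  apply: (le_trans (ler_wpM2l (wnorm_ge0 _ _ _ e0) (ht i N))).
  by rewrite -mulrA mulrCA ler_wpM2l // invr_ge0 mulr_ge0.
rewrite sumr_const card_ord -mulrnAl mulrC ler_wpM2l // /small.
rewrite -mulr_natr invfM -mulrA ler_piMr ?invr_ge0 //.
by rewrite ler_pdivrMl ?ltr0n // mulr1 ler_nat.
Qed.

(** The bound [2 M] reproduces itself along the iteration because M + (2 M) / 2 = 2 M, and on a
    given box the fixed point coincides with a late enough iterate. *)
Let fixp_norm e f M : 0 < e ->
  (forall i N, wnorm w e (tail i) N <= small * `|g i (mu i)| * e ^+ wdeg w (mu i)) ->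
  (forall N, wnorm w e f N <= M) -> forall N, wnorm w e (fixp f) N <= 2%:R * M.
Proof.
move=> e0 ht hf N.
have M0 : 0 <= M by apply: le_trans (hf 0%N); apply: wnorm_ge0.
have itn n : forall N, wnorm w e (it f n) N <= 2%:R * M.
  elim: n => [|n ih] N'.
    rewrite /it /= /wnorm big1 ?mulr_ge0 // => b _.
    by rewrite normr0 mul0r.
  apply: (le_trans (wnormD _ _ _ _ e0)); rewrite mulr_natl mulr2n lerD ?hf //.
  by apply: le_trans (err_norm e0 ht ih N') _; rewrite mulrAC divff ?mul1r ?pnatr_eq0.
have -> : wnorm w e (fixp f) N = wnorm w e (it f (\sum_i w i * N)%N.+1) N; last exact: itn.
apply: eq_bigr => b _; congr (`|_| * _); apply/esym/it_stable.
rewrite ltnS; apply: leq_sum => i _.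
by rewrite ffunE leq_mul2l (ltnW (ltn_ord (b i))) orbT.
Qed.

Let qt_norm e i u M : 0 < e -> (forall N, wnorm w e u N <= M) ->
  forall N, wnorm w e (qt i u) N <= M / (`|g i (mu i)| * e ^+ wdeg w (mu i)).
Proof.
move=> e0 hu N.
have gi : 0 < `|g i (mu i)| by rewrite normr_gt0; apply/eqP/lc0.
rewrite ler_pdivlMr ?mulr_gt0 ?exprn_gt0 //.
apply: le_trans (hu (mdegree (mu i) + N)%N).
apply: le_trans (wnorm_shift w u (mu i) N e0).
rewrite mulrA ler_wpM2r ?exprn_ge0 ?(ltW e0) // mulr_suml.
apply: ler_sum => b _; rewrite mulrAC ler_wpM2r ?exprn_ge0 ?(ltW e0) // /qt.
by case: ifP => _; rewrite ?normr0 ?mul0r // normrM normfV divfK // gt_eqF.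
Qed.

Let conv_wnorm u : ps_convergent u -> exists2 e0 : K, 0 < e0 &
  forall e, 0 < e -> e <= e0 -> exists M, forall N, wnorm w e u N <= M.
Proof.
(* The constant term is split off because [wnorm_small] with [k = 0] needs positive weights on the
   support. *)
move=> cu; pose v a := if a == mzero m then 0 else u a.
have cv : ps_convergent v.
  by apply: ps_convergent_le cu _ => a; rewrite /v; case: ifP; rewrite ?normr0.
have [a|e0 e00 h] := wnorm_small w0 (k := 0) cv ltr01.
  rewrite /v; case: eqP => // ne _; rewrite lt0n; apply/eqP => a0.
  apply: ne; apply: mdegree_eq0; apply/eqP; rewrite -leqn0 -a0.
  exact: mdegree_le_wdeg.
exists e0 => // e epos ele; exists (1 * e ^+ 0 + `|u (mzero m)|) => N.
pose z a := if a == mzero m then u (mzero m) else 0.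
have -> : wnorm w e u N = wnorm w e (v \+ z) N.
  by apply: eq_bigr => b _; rewrite /v /z /=; case: eqP => [->|]; rewrite ?add0r ?addr0.
apply: (le_trans (wnormD _ _ _ _ epos)); apply: lerD; first exact: h.
rewrite /wnorm (bigID (fun b => box_index b == mzero m)) /= [X in _ + X]big1 ?addr0.
  rewrite (@box_sum1 m K N _ (fun a => `|z a| * e ^+ wdeg w a)); case: ifP => // _.
  by rewrite /z eqxx /wdeg big1 ?expr0 ?mulr1 // => i _; rewrite ffunE muln0.
by move=> b /negbTE nb; rewrite /z nb normr0 mul0r.
Qed.

(** The last clause bounds the order of the quotients from below by that of [f]; it is the input for
    Artin-Rees. *)
Theorem ps_division (f : A) : exists (q : 'I_s -> A) (r : A),
  [/\ f = \sum_i q i * g i + r,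
      forall a, r a <> 0 -> forall i, ~ mle (mu i) a &
      forall n, (forall i a, g i a <> 0 -> (mdegree (mu i) <= mdegree a)%N) ->
        (forall a, (mdegree a < n)%N -> f a = 0) ->
        forall i a, (mdegree (mu i) + mdegree a < n)%N -> q i a = 0].
Proof.
have small0 : 0 < small by rewrite invr_gt0 mulr_gt0 ?ltr0n.
have [e1 e10 he1] := conv_wnorm (coef_conv f).
have ht i : exists2 e0, 0 < e0 & forall e, 0 < e -> e <= e0 -> (fun (i : 'I_s) e =>
    e <= e1 /\
    forall N, wnorm w e (tail i) N <= small * `|g i (mu i)| * e ^+ wdeg w (mu i)) i e.
  have ct : ps_convergent (tail i).
    by apply: ps_convergent_le (coef_conv (g i)) _ => a; rewrite /tail; case: ifP; rewrite ?normr0.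
  have [||e2 e20 h] := @wnorm_small _ _ _ w0 _ (wdeg w (mu i)) (small * `|g i (mu i)|) ct.
  - by rewrite mulr_gt0 // normr_gt0; apply/eqP/lc0.
  - exact: tail_gt.
  have l3 : 0 < e1^-1 + e2^-1 by rewrite addr_gt0 ?invr_gt0.
  exists (e1^-1 + e2^-1)^-1 => [|e epos ele]; first by rewrite invr_gt0.
  split; last first.
    apply: h => //; apply: (le_trans ele); rewrite -[X in _ <= X]invrK.
    by rewrite lef_pV2 ?posrE ?invr_gt0 // lerDr invr_ge0 ltW.
  apply: (le_trans ele); rewrite -[X in _ <= X]invrK.
  by rewrite lef_pV2 ?posrE ?invr_gt0 // lerDl invr_ge0 ltW.
have [e [epos ele1 he]] : exists e, [/\ 0 < e, e <= 1 & e <= e1 /\ forall i N,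
    wnorm w e (tail i) N <= small * `|g i (mu i)| * e ^+ wdeg w (mu i)].
  have [e [? ? h]] := small_common ht.
  have [e' [e'0 e'1 h']] : exists e', [/\ 0 < e', e' <= 1 & e' <= e1].
    pose e' := (1 + e1^-1)^-1; have p : 0 < 1 + e1^-1 by rewrite addr_gt0 ?invr_gt0.
    exists e'; split; first by rewrite invr_gt0.
      by rewrite invf_le1 // lerDl invr_ge0 ltW.
    by rewrite -[e1]invrK lef_pV2 ?posrE ?invr_gt0 // lerDr ler01.
  (* The bound [e <= e1] is carried by the indices of the divisors; if there are none, [e'] supplies
     it. *)
  case: (posnP s) => [s0|s0]; last first.
    exists e; split=> //; split; first by have [] := h (Ordinal s0).
    by move=> i; have [] := h i.
  exists e'; split=> //; split=> // i; have := ltn_ord i; by rewrite {2}s0 ltn0.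
have [ee1 hte] := he; have [M hM] := he1 e epos ee1.
pose F := fixp f; have hF := fixp_norm epos hte hM.
have cq i : ps_convergent (qt i F) := wnorm_conv epos ele1 (qt_norm i epos hF).
have cF : ps_convergent F := wnorm_conv epos ele1 hF.
pose FF := cs_build cF.
exists (fun i => cs_build (cq i)), (cs_restrict FF (fun a => sel a == None)); split.
- apply: cs_ext => a; rewrite coefD coef_sum.
  under eq_bigr do rewrite coefM [ps_mul _ _ _]qt_shift.
  rewrite big_split /=.
  have -> : \sum_i ps_mul (qt i F) (tail i) a = f a - F a.
    by rewrite /F [X in _ - X]fixpE opprD addNKr /err opprK.
  rewrite -addrA [X in _ = _ + X](_ : _ = F a) ?subrK //.
  rewrite /cs_restrict /coef /=; case: (sel a) => [i|].
    rewrite addr0 (bigD1 i) //= eqxx big1 ?addr0 // => j ne.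
    by case: eqP => // -[e']; rewrite e' eqxx in ne.
  by rewrite big1 ?add0r.
- move=> a; rewrite /cs_restrict /coef /=; case: eqP => // + _ i le.
  by rewrite /sel; case: pickP => // /(_ i); rewrite le.
- move=> n hg hf i a lt; rewrite /coef /= /qt; case: ifP => // _.
  (* Every iterate has order at least [n]: replacing a leading monomial by a tail monomial of the
     same divisor never lowers the degree. *)
  suff h k : forall a, (mdegree a < n)%N -> it f k a = 0.
    by rewrite /F /fixp h ?mul0r // mdegreeD.
  elim: k => [//|k ih] b bn; rewrite /it iterS -/(it f k) hf // add0r /err.
  rewrite big1 ?oppr0 // => j _; apply: ps_mul_eq0 => c d E.
  have [->|/eqP td] := eqVneq (tail j d) 0; first by rewrite mulr0.
  rewrite /qt; case: ifP => _; rewrite ?mul0r // ih ?mul0r // mdegreeD.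
  apply: leq_ltn_trans bn; rewrite -E mdegreeD addnC leq_add2l.
  by move: td; rewrite /tail; case: eqP => // _ /hg.
Qed.

End Division.

(** Division of 1 by [f] with leading exponent 0: this exponent divides all others, so no remainder
    is left. *)
Lemma cs_unit (K : numFieldType) m (f : cseries K m) : f (mzero m) <> 0 ->
  exists h, f * h = 1.
Proof.
move=> f0.
have [|||q [r [e hr _]]] := @ps_division K m 1 (fun=> 1%N) (fun=> f) (fun=> mzero m) _ _ _ 1.
- by [].
- by [].
- move=> _ a _ ne; rewrite [X in (X < _)%N]/wdeg big1 => [|i _]; last by rewrite ffunE.
  rewrite lt0n; apply/eqP => h; apply: ne; apply: mdegree_eq0.
  by apply/eqP; rewrite -leqn0 -h mdegree_le_wdeg.
exists (q ord0); rewrite mulrC e big_ord_recl big_ord0 addr0.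
rewrite [r](_ : _ = 0) ?addr0 //; apply: cs_ext => a; apply: contrapT => /hr /(_ ord0).
by case; apply/forallP => i; rewrite ffunE.
Qed.

(** * Standard bases and the Artin-Rees property *)

(** Induction on the number of coordinates compared. With [M] chosen for the first [n], an exponent
    whose next entry is at least [D] is dominated by [M]; for each of the finitely many smaller
    values of that entry a separate finite list is used. *)
Lemma dickson m (S : set (mindex m)) : exists M : seq (mindex m),
  (forall mu, mu \in M -> S mu) /\
  forall a, S a -> exists2 mu, mu \in M & mle mu a.
Proof.
suff H n : forall S : set (mindex m), exists M : seq (mindex m),
    (forall mu, mu \in M -> S mu) /\
    forall a, S a -> exists2 mu, mu \in M & forall i : 'I_m, (i < n)%N -> (mu i <= a i)%N.
  have [M [h1 h2]] := H m S; exists M; split=> // a /h2 [mu ? h]; exists mu => //.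
  by apply/forallP => i; apply: h.
elim: n => [|n ih] {}S.
  have [[a Sa]|n0] := pselect (S !=set0); last first.
    by exists [::]; split=> // a Sa; case: n0; exists a.
  exists [:: a]; split=> [mu|b _]; first by rewrite inE => /eqP ->.
  by exists a; rewrite ?inE.
have [nm|mn] := ltnP n m; last first.
  have [M [h1 h2]] := ih S; exists M; split=> // a /h2 [mu ? h]; exists mu => // i _.
  by apply: h; apply: leq_trans mn.
pose l := Ordinal nm.
have [M [h1 h2]] := ih S.
pose D := (\max_(mu <- M) mu l).+1.
have /choice [N hN] : forall v, exists Mv : seq (mindex m),
    (forall mu, mu \in Mv -> S mu /\ mu l = v) /\
    forall a, S a -> a l = v ->
      exists2 mu, mu \in Mv & forall i : 'I_m, (i < n)%N -> (mu i <= a i)%N.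
  move=> v; have [Mv [k1 k2]] := ih [set a | S a /\ a l = v].
  by exists Mv; split=> // a Sa al; apply: k2.
exists (M ++ flatten [seq N v | v <- iota 0 D]); split.
  move=> mu; rewrite mem_cat => /orP [/h1 //|/flatten_mapP [v _ /(hN v).1 []]] //.
move=> a Sa; have [aD|Da] := ltnP (a l) D.
  have [mu mN h] := (hN (a l)).2 a Sa erefl; exists mu.
    rewrite mem_cat; apply/orP; right; apply/flatten_mapP; exists (a l) => //.
    by rewrite mem_iota.
  move=> i; rewrite ltnS leq_eqVlt => /orP [/eqP e|/h //].
  have -> : i = l by apply: val_inj.
  by have [_ ->] := (hN (a l)).1 _ mN.
have [mu mM h] := h2 a Sa; exists mu; first by rewrite mem_cat mM.
move=> i; rewrite ltnS leq_eqVlt => /orP [/eqP e|/h //].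
have -> : i = l by apply: val_inj.
by apply: leq_trans Da; apply/leqW; apply: leq_bigmax_seq.
Qed.

Section IdealClosure.
Variables (A : comPzRingType) (I : set A).
Hypothesis hI : is_ideal I.

Lemma ideal0 : I 0. Proof. by case: hI. Qed.
Lemma idealD x y : I x -> I y -> I (x + y). Proof. by case: hI => _ + _; apply. Qed.
Lemma idealMl a x : I x -> I (a * x). Proof. by case: hI => _ _; apply. Qed.
Lemma idealMr a x : I x -> I (x * a). Proof. by rewrite mulrC; apply: idealMl. Qed.
Lemma idealN x : I x -> I (- x). Proof. by rewrite -mulN1r; apply: idealMl. Qed.
Lemma idealB x y : I x -> I y -> I (x - y).
Proof. by move=> hx hy; apply: idealD => //; apply: idealN. Qed.
Lemma ideal_sum J (s : seq J) (P : pred J) (F : J -> A) :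
  (forall i, P i -> I (F i)) -> I (\sum_(i <- s | P i) F i).
Proof. by move=> h; apply: big_ind => //; [apply: ideal0 | apply: idealD]. Qed.

End IdealClosure.

Section ArtinRees.
Variables (K : numFieldType) (m : nat).
Local Notation A := (cseries K m).
Implicit Types (f g h : A) (J Q : set A).

(** The [n]-th power of the maximal ideal, described by coefficients. *)
Definition ord_ge n : set A := [set f | forall a, (mdegree a < n)%N -> f a = 0].

Lemma ord_ge_is_ideal n : is_ideal (ord_ge n).
Proof.
split=> // [f g hf hg a an|h f hf a an]; first by rewrite coefD hf ?hg ?addr0.
apply: ps_mul_eq0 => b c e; rewrite hf ?mulr0 //; apply: leq_ltn_trans an.
by rewrite -e mdegreeD leq_addl.
Qed.

(* [g] is a standard basis for the degree-lexicographic order, and [c] bounds the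
   degrees of its initial monomials. *)
Lemma standard_basis J : is_ideal J -> exists s (g : 'I_s -> A) c,
  (forall i, J (g i)) /\
  forall f, J f -> exists q : 'I_s -> A, f = \sum_i q i * g i /\
    forall n, ord_ge n f -> forall i, ord_ge (n - c) (q i).
Proof.
move=> hJ.
pose S := [set mu | exists2 f, J f & initial [set a | f a <> 0] mu].
have [M [M1 M2]] := dickson S.
pose s := size M; pose mu (i : 'I_s) := tnth (in_tuple M) i.
have /choice [g hg] : forall i, exists f, J f /\ initial [set a | f a <> 0] (mu i).
  by move=> i; have [f] := M1 _ (mem_tnth i (in_tuple M)); exists f.
pose c := (\max_i mdegree (mu i))%N.
have muc i : (mdegree (mu i) <= c)%N by apply: leq_bigmax.
exists s, g, c; split=> [i|f Jf]; first by have [] := hg i.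
(* [c.+1] exceeds the degrees of all leading exponents, so one weight is valid for every basis
   element. *)
have [|||q [r [e hr hq]]] := @ps_division K m s (lexw c.+1) g mu _ _ _ f.
- by move=> i; apply: lexw_gt0.
- by move=> i; have [_ []] := hg i.
- move=> i a ga ne; have [_ [_ /(_ a ga) [_ /(_ ne)]]] := hg i.
  by apply; rewrite ltnS.
have r0 : r = 0.
  apply: contrapT => nr.
  have [|nu inu] := @initial_ex m [set a | r a <> 0].
    by apply: contrapT => h; apply: nr; apply: cs_ext => a;
      apply: contrapT => ra; apply: h; exists a.
  have [|mu' mM le] := M2 nu.
    exists r => //; rewrite (_ : r = f - \sum_i q i * g i); last by rewrite e addrC addKr.
    apply: idealB => //; apply: ideal_sum => // i _; apply: idealMl => //.
    by have [] := hg i.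
  have [rnu _] := inu; have /seq_tnthP [i ei] : mu' \in in_tuple M by [].
  by apply: (hr nu rnu i); rewrite /mu -ei.
exists q; split; first by rewrite e r0 addr0.
move=> n fn i a an; apply: (hq n) => // [j b gb|].
  by have [_ [_ /(_ b gb) []]] := hg j.
apply: leq_ltn_trans (_ : c + mdegree a < n)%N; first by rewrite leq_add2r.
by move: an; rewrite ltn_subRL.
Qed.

(** Expand [z * y - p] in a standard basis of [Q + (y)] with coefficients [q i] of order at least
    [n - c]. Writing each basis element as an element of [Q] plus a multiple of [y], the
    corresponding combination [z'] of multipliers satisfies [(z - z') * y] in [Q], and primality
    cancels [y]. *)
Lemma artin_rees Q y : prime_ideal Q -> ~ Q y -> exists c, forall n z p, Q p ->
  ord_ge n (z * y - p) -> exists2 z', Q (z - z') & ord_ge (n - c) z'.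
Proof.
move=> [hQ _ prQ] Qy.
pose J : set A := [set f | exists p z, Q p /\ f = p + z * y].
have hJ : is_ideal J.
  split; first by exists 0, 0; rewrite mul0r addr0; split=> //; apply: ideal0.
    move=> _ _ [p [z [Qp ->]]] [p' [z' [Qp' ->]]]; exists (p + p'), (z + z').
    by split; [apply: idealD | rewrite mulrDl addrACA].
  move=> a _ [p [z [Qp ->]]]; exists (a * p), (a * z).
  by split; [apply: idealMl | rewrite mulrDr mulrA].
have [s [g [c [Jg hg]]]] := standard_basis hJ.
have /choice [gp hgp] : forall i, exists pz : A * A, Q pz.1 /\ g i = pz.1 + pz.2 * y.
  by move=> i; have [p [z ?]] := Jg i; exists (p, z).
exists c => n z p Qp hord.
have [|q [e hq]] := hg (z * y - p).
  by exists (- p), z; rewrite addrC; split=> //; apply: idealN.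
exists (\sum_i q i * (gp i).2); last first.
  by apply: (ideal_sum (ord_ge_is_ideal _)) => i _; apply: (idealMr (ord_ge_is_ideal _)); apply: hq.
suff : Q ((z - \sum_i q i * (gp i).2) * y) by case/prQ.
rewrite mulrBl -[z * y](subrK p) e mulr_suml addrAC -sumrB; apply: idealD => //.
apply: ideal_sum => // i _; have [Qi ->] := hgp i.
by rewrite mulrDr mulrA addrK; apply: idealMl.
Qed.

End ArtinRees.

(** * The Hilbert function and the dimension of the ring of convergent power series *)

(** A subspace of maximal dimension inside [P] is all of [P], since adjoining a vector of [P] cannot
    enlarge it. *)
Lemma vspace_of_pred (F : fieldType) (vT : vectType F) (P : set vT) :
  P 0 -> (forall a u v, P u -> P v -> P (a *: u + v)) ->
  exists U : {vspace vT}, forall v, v \in U <-> P v.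
Proof.
move=> P0 PD.
pose sub (U : {vspace vT}) := forall v, v \in U -> P v.
have ex : exists n, `[< exists2 U, sub U & \dim U = n >].
  exists 0%N; apply/asboolP; exists 0%VS; last exact: dimv0.
  by move=> v; rewrite memv0 => /eqP ->.
have bd n : `[< exists2 U, sub U & \dim U = n >] -> (n <= \dim (fullv : {vspace vT}))%N.
  by move=> /asboolP [U _ <-]; apply: dimvS; apply: subvf.
case: (ex_maxnP ex bd) => n /asboolP [U sU dU] mx.
exists U => v; split=> [|Pv]; first exact: sU.
have : (\dim (U + <[v]>)%VS <= n)%N.
  apply: mx; apply/asboolP; exists (U + <[v]>)%VS => // _ /memv_addP [u uU [_ /vlineP [k ->] ->]].
  by rewrite addrC; apply: PD => //; apply: sU.
move=> le; have := dimv_leqif_eq (addvSl U <[v]>%VS).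
move=> [le2 e2]; have : \dim U == \dim (U + <[v]>)%VS by rewrite eqn_leq le2 dU le.
rewrite e2 => /eqP ->; apply: (subvP (addvSr _ _)); exact: memv_line.
Qed.

Section HilbertFunction.
Variables (K : numFieldType) (m : nat).
Local Notation A := (cseries K m).
Local Notation idx := (mindex m).
Implicit Types (f g h : A) (Q : set A).

Definition small_index N := {b : mbox m N | (mdegree (box_index b) < N)%N}.
Local Notation nmon N := #|{: small_index N}|.
Local Notation V N := 'rV[K]_(nmon N).

Let ex N (i : 'I_(nmon N)) : idx := box_index (val (enum_val i)).

Let ex_inj N : injective (@ex N).
Proof. by move=> i j /box_index_inj /val_inj /enum_val_inj. Qed.

Let ex_lt N (i : 'I_(nmon N)) : (mdegree (ex i) < N)%N.
Proof. exact: (valP (enum_val i)). Qed.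

Let exP N a : (mdegree a < N)%N -> exists i : 'I_(nmon N), ex i = a.
Proof.
move=> aN; have /box_indexP [b eb] : in_box N a.
  by apply: in_boxW (in_box_degree a).
have h : (mdegree (box_index b) < N)%N by rewrite eb.
by exists (enum_rank (exist _ b h)); rewrite /ex enum_rankK.
Qed.

Lemma nmon_le N : (nmon N <= N ^ m)%N.
Proof.
rewrite card_sig; apply: leq_trans (max_card _) _.
by rewrite card_ffun !card_ord.
Qed.

Let trunc N f : V N := \row_i f (ex i).
Let lift N (v : V N) : A := cs_fin N (fun a => \sum_i v 0 i * (a == ex i)%:R).

Let coef_lift N (v : V N) i : lift v (ex i) = v 0 i.
Proof.
rewrite /lift /coef /=; have -> : in_box N (ex i) by apply/box_indexP; eexists.
rewrite (bigD1 i) //= eqxx mulr1 big1 ?addr0 // => j ne.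
by case: eqP => [/ex_inj e|]; [rewrite e eqxx in ne | rewrite mulr0].
Qed.

Let truncP N f g : trunc N f = trunc N g <-> ord_ge N (f - g).
Proof.
split=> [/rowP e a /exP [i <-]|h].
  by have := e i; rewrite !mxE coefB => ->; rewrite subrr.
apply/rowP => i; rewrite !mxE; apply/eqP; rewrite -subr_eq0 -coefB.
by rewrite h ?ex_lt.
Qed.

Let liftK N : cancel (@lift N) (trunc N).
Proof. by move=> v; apply/rowP => i; rewrite mxE coef_lift. Qed.

Let trunc_lift N f : ord_ge N (lift (trunc N f) - f).
Proof. by apply/truncP; rewrite liftK. Qed.

Let truncD N k f g : trunc N (cst m k * f + g) = k *: trunc N f + trunc N g.
Proof. by apply/rowP => i; rewrite !mxE coefD coef_cstM. Qed.

Let lift_linear N k (u v : V N) : ord_ge N (lift (k *: u + v) - (cst m k * lift u + lift v)).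
Proof. by apply/truncP; rewrite truncD !liftK. Qed.

Let mulmap N (y : A) (v : V N) : V N := trunc N (lift v * y).

Let mulmap_linear N y : linear (@mulmap N y).
Proof.
move=> k u v; rewrite /mulmap -truncD; apply/truncP.
rewrite mulrA -mulrDl -mulrBl; exact: (idealMr (@ord_ge_is_ideal K m N) y (lift_linear k u v)).
Qed.
HB.instance Definition _ N y :=
  GRing.isLinear.Build K (V N) (V N) _ (@mulmap N y) (@mulmap_linear N y).

(** The reduction from precision [N] to [M]. The value 0 when [M > N] keeps the map linear for every
    pair, so that it can be declared linear without a side condition. *)
Let resmap N M (v : V N) : V M := if (M <= N)%N then trunc M (lift v) else 0.

Let ord_geW N M f : (M <= N)%N -> ord_ge N f -> ord_ge M f.
Proof. by move=> le h a aM; apply: h; apply: leq_trans le. Qed.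

Let resmap_linear N M : linear (@resmap N M).
Proof.
move=> k u v; rewrite /resmap; case: ifP => [le|_]; last by rewrite scaler0 addr0.
rewrite -truncD; apply/truncP; apply: (ord_geW le); exact: lift_linear.
Qed.
HB.instance Definition _ N M :=
  GRing.isLinear.Build K (V N) (V M) _ (@resmap N M) (@resmap_linear N M).

Let resmap_trunc N M f : (M <= N)%N -> resmap M (trunc N f) = trunc M f.
Proof.
by move=> le; rewrite /resmap le; apply/truncP; apply: (ord_geW le); apply: trunc_lift.
Qed.

Let truncs Q N : set (V N) := [set v | exists2 f, Q f & trunc N f = v].

(** The image of [Q] modulo terms of degree at least [N]. The default makes [hilb] total in [Q]; it
    never occurs for an ideal. *)
Let tsp Q N : {vspace V N} := xget 0%VS [set U : {vspace V N} | forall v, v \in U <-> truncs Q v].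

Let tspP Q N v : is_ideal Q -> v \in tsp Q N <-> truncs Q v.
Proof.
move=> hQ; rewrite /tsp; case: xgetP => [U _ //|] /= none.
have [||U hU] := @vspace_of_pred _ _ (truncs Q (N := N)).
- by exists 0; [apply: ideal0 | apply/rowP => i; rewrite !mxE].
- move=> a _ _ [f Qf <-] [g Qg <-]; exists (cst m a * f + g); last exact: truncD.
  by apply: idealD => //; apply: idealMl.
by case: (none U).
Qed.

(* the dimension of [A / (Q + m^N)] *)
Definition hilb Q N : nat := (nmon N - \dim (tsp Q N))%N.

Let dimV N : \dim (fullv : {vspace V N}) = nmon N.
Proof. by rewrite dimvf dim_matrix; apply: mul1n. Qed.

Let tsp_le Q N : (\dim (tsp Q N) <= nmon N)%N.
Proof. by have := dimvS (subvf (tsp Q N)); rewrite dimV. Qed.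

Lemma hilb_le Q N : (hilb Q N <= N ^ m)%N.
Proof. exact: leq_trans (leq_subr _ _) (nmon_le N). Qed.

Let dim_resker N M : (M <= N)%N ->
  (\dim (lker (linfun (@resmap N M))) + nmon M)%N = nmon N.
Proof.
move=> le; have := limg_ker_dim (linfun (@resmap N M)) fullv.
rewrite capfv dimV => d; apply: etrans d; congr (_ + _)%N.
apply: etrans (esym (dimV M)) _; congr (\dim _); apply/eqP; rewrite eqEsubv subvf andbT.
apply/subvP => v _; apply/memv_imgP; exists (trunc N (lift v)); rewrite ?memvf //.
by rewrite lfunE /= resmap_trunc // liftK.
Qed.

(** The quotient at precision [N] maps onto the one at precision [M]; the proof compares dimensions
    of kernels and images of the reduction. *)
Lemma hilb_mono Q N M : is_ideal Q -> (M <= N)%N -> (hilb Q M <= hilb Q N)%N.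
Proof.
move=> hQ le; have e := dim_resker le.
have := limg_ker_dim (linfun (@resmap N M)) (tsp Q N).
have h1 : (\dim (tsp Q N :&: lker (linfun (@resmap N M))) <=
    \dim (lker (linfun (@resmap N M))))%N by apply: dimvS; apply: capvSr.
have h2 : (\dim (linfun (@resmap N M) @: tsp Q N) <= \dim (tsp Q M))%N.
  apply: dimvS; apply/subvP => _ /memv_imgP [v vU ->].
  move/(tspP _ hQ): vU => [f Qf <-]; apply/(tspP _ hQ); exists f => //.
  by rewrite lfunE /= resmap_trunc.
move=> d; have l1 := tsp_le Q M; have l2 := tsp_le Q N.
have arith (a b k u u' i t : nat) : (k + b = a -> i + t = u -> i <= k -> t <= u' ->
    u' <= b -> u <= a -> b - u' <= a - u)%N by lia.
exact: arith e d h1 h2 l1 l2.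
Qed.

(* Multiplication by some [y] in [Q'] outside [Q] maps onto [(Q + (y)) / Q]; by the
   Artin-Rees property its kernel modulo [m^N] is contained in [Q + m^(N - c)]. *)
Lemma hilb_step Q Q' : prime_ideal Q -> is_ideal Q' -> Q `<` Q' ->
  exists c, forall N, (hilb Q' N + hilb Q (N - c) <= hilb Q N)%N.
Proof.
move=> pQ hQ' [sQ /nonsubset [y [Q'y nQy]]].
have hQ : is_ideal Q by case: pQ.
have [c hc] := artin_rees pQ nQy; exists c => N.
have le : (N - c <= N)%N by apply: leq_subr.
pose phi := linfun (@mulmap N y); pose rho := linfun (@resmap N (N - c)).
(* [W1] holds the classes that [y] multiplies into [Q + m^N], [W2] those of precision [N] lying in
   [Q + m^(N - c)]. Their inclusion is Artin-Rees; the rest is rank counting. *)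
pose U := tsp Q N; pose W1 := (phi @^-1: U)%VS; pose W2 := (rho @^-1: tsp Q (N - c))%VS.
have W12 : (\dim W1 <= \dim W2)%N.
  apply: dimvS; apply/subvP => v; rewrite -!memv_preim => /(tspP _ hQ) [p Qp].
  rewrite lfunE /= => e; apply/(tspP _ hQ).
  have [z' Qz z'o] : exists2 z', Q (lift v - z') & ord_ge (N - c) z'.
    by apply: (hc N _ p) => //; apply/truncP.
  exists (lift v - z') => //; rewrite lfunE /= /resmap le; apply/truncP.
  by rewrite addrAC subrr add0r; exact: (idealN (@ord_ge_is_ideal K m _) z'o).
have kerS : (lker phi <= W1)%VS.
  by apply/subvP => v; rewrite memv_ker -memv_preim => /eqP ->; apply: mem0v.
have d1 : (\dim (lker phi) + \dim (U :&: limg phi) <= \dim W1)%N.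
  rewrite -(limg_ker_dim phi W1); apply: leq_add; first by rewrite (capv_idPr kerS).
  apply: dimvS; apply/subvP => u; rewrite memv_cap => /andP [uU /memv_imgP [v _ e]].
  by rewrite e memv_img // -memv_preim -e.
have d2 : (\dim (lker phi) + \dim (limg phi))%N = nmon N.
  by have := limg_ker_dim phi fullv; rewrite capfv dimV.
have d3 := dimv_sum_cap U (limg phi).
have d4 : (\dim (U + limg phi) <= \dim (tsp Q' N))%N.
  apply: dimvS; apply/subvP => _ /memv_addP [u uU [_ /memv_imgP [v _ ->] ->]].
  move/(tspP _ hQ): uU => [f Qf <-]; apply/(tspP _ hQ').
  exists (cst m 1 * f + lift v * y).
    by apply: idealD => //; apply: idealMl => //; apply: sQ.
  by rewrite truncD scale1r lfunE.
have d5 : (\dim W2 <= \dim (lker rho) + \dim (tsp Q (N - c)))%N.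
  rewrite -(limg_ker_dim rho W2); apply: leq_add; first by apply: dimvS; apply: capvSr.
  apply: dimvS; apply/subvP => _ /memv_imgP [v vW ->].
  by rewrite memv_preim.
have d6 := dim_resker le; rewrite -/rho in d6.
have l1 := tsp_le Q N; have l2 := tsp_le Q' N; have l3 := tsp_le Q (N - c).
have arith (n n' u u' u2 i b k s w1 w2 k2 : nat) : (w1 <= w2 -> k + i <= w1 ->
    k + b = n -> s + i = u + b -> s <= u' -> w2 <= k2 + u2 -> k2 + n' = n ->
    u <= n -> u' <= n -> u2 <= n' -> (n - u') + (n' - u2) <= n - u)%N by lia.
exact: arith W12 d1 d2 d3 d4 d5 d6 l1 l2 l3.
Qed.

(** If the quotient vanished, [Q] would contain a series congruent to 1 modulo the maximal ideal,
    which is a unit. *)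
Lemma hilb_gt0 Q N : prime_ideal Q -> (0 < N)%N -> (0 < hilb Q N)%N.
Proof.
move=> [hQ Q1 _] N0; rewrite lt0n; apply/eqP => h.
have full : tsp Q N = fullv.
  apply/eqP; rewrite eqEdim subvf dimV -subn_eq0; exact/eqP.
have /(tspP _ hQ) [f Qf /truncP e] : trunc N 1 \in tsp Q N by rewrite full memvf.
have /cs_unit [g fg] : f (mzero m) <> 0.
  have := e (mzero m); rewrite mdegree0 coefB coef1 eqxx => /(_ N0) /eqP.
  by rewrite subr_eq0 => /eqP -> /eqP; rewrite oner_eq0.
by apply: Q1; rewrite -fg; apply: idealMr.
Qed.

End HilbertFunction.

Section Height.
Variables (A : comPzRingType).
Implicit Types Q : set A.

(** Expresses that [Q] has height at least [n]. *)
Inductive chain_to : nat -> set A -> Prop :=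
| chain_to0 Q : prime_ideal Q -> chain_to 0 Q
| chain_toS n Q Q' : chain_to n Q -> Q `<` Q' -> prime_ideal Q' -> chain_to n.+1 Q'.

Lemma chain_to_prime n Q : chain_to n Q -> prime_ideal Q.
Proof. by case. Qed.

Lemma chain_to_sub n Q Q' : chain_to n Q -> Q `<=` Q' -> prime_ideal Q' ->
  chain_to n Q'.
Proof.
case=> [{}Q pQ|{}n P {}Q c lt pQ] sQ pQ'; first exact: chain_to0.
apply: (chain_toS c) => //; split; first by apply: subset_trans sQ; case: lt.
by move=> h; case: lt => _; apply; apply: subset_trans h.
Qed.

End Height.

Section Dimension.
Variables (K : numFieldType) (m : nat).
Local Notation A := (cseries K m).

Lemma chain_hilb n (Q : set A) : chain_to n Q -> exists C, forall N,
  (hilb Q N * N ^ n <= C * N ^ m)%N.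
Proof.
elim=> [{}Q _|{}n {}Q Q' cQ [C hC] lt pQ'].
  by exists 1%N => N; rewrite expn0 muln1 mul1n hilb_le.
have hQ' : is_ideal Q' by case: pQ'.
have [c hc] := hilb_step (chain_to_prime cQ) hQ' lt.
(* telescoping [hilb_step] along [N, N + c, ..., N + k c] *)
have key k N : (k * hilb Q' N <= hilb Q (N + k * c))%N.
  elim: k => // k ih; rewrite !mulSn.
  apply: leq_trans (hc _); apply: leq_add; first by apply: hilb_mono => //; apply: leq_addr.
  by rewrite addnCA addKn.
(* Telescoping with [k = N] replaces the argument [N] by [N * c.+1], whose [m]-th power contributes
   the new factor. *)
exists (C * c.+1 ^ m)%N => N.
rewrite -mulnA -expnMn; apply: leq_trans (hC _).
apply: (@leq_trans (hilb Q (N + N * c) * N ^ n)).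
  by rewrite expnS mulnA leq_mul2r [(_ * N)%N]mulnC key orbT.
rewrite mulSn [(c * N)%N]mulnC leq_mul2l; apply/orP; right.
by case: (posnP n) => [->//|n0]; rewrite leq_exp2r // leq_addr.
Qed.

(** At [N = C.+1] the Hilbert function is at least 1, so [n > m] would give [N ^ m.+1 <= C * N ^ m],
    contradicting [C < N]. *)
Theorem chain_le n (Q : set A) : chain_to n Q -> (n <= m)%N.
Proof.
move=> c; have [C hC] := chain_hilb c; rewrite leqNgt; apply/negP => lt.
have /(leq_trans (leq_mul (hilb_gt0 (chain_to_prime c) (ltn0Sn C)) (leqnn _))) := hC C.+1.
rewrite mul1n => h; have : (C.+1 ^ m.+1 <= C * C.+1 ^ m)%N.
  by apply: leq_trans h; apply: leq_pexp2l.
by rewrite expnS leq_mul2r expn_eq0 /= ltnn.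
Qed.

End Dimension.

(** * Chains of primes and regular sequences *)

Section PrimeSeparation.
Variable A : comPzRingType.
Implicit Types (I J Q T : set A) (a x : A) (s : seq A).

Definition adjoin I a : set A := [set x | exists p r, I p /\ x = p + r * a].

Lemma adjoin_is_ideal I a : is_ideal I -> is_ideal (adjoin I a).
Proof.
move=> hI; split; first by exists 0, 0; rewrite mul0r addr0; split=> //; apply: ideal0.
  move=> _ _ [p [z [Qp ->]]] [p' [z' [Qp' ->]]]; exists (p + p'), (z + z').
  by split; [apply: idealD | rewrite mulrDl addrACA].
move=> b _ [p [z [Qp ->]]]; exists (b * p), (b * z).
by split; [apply: idealMl | rewrite mulrDr mulrA].
Qed.

Lemma adjoin_sub I a : I `<=` adjoin I a.
Proof. by move=> x Ix; exists x, 0; rewrite mul0r addr0. Qed.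

Lemma adjoin_mem I a : is_ideal I -> adjoin I a a.
Proof. by move=> hI; exists 0, 1; rewrite mul1r add0r; split=> //; apply: ideal0. Qed.

Lemma adjoin_least I J a : is_ideal J -> I `<=` J -> J a -> adjoin I a `<=` J.
Proof.
by move=> hJ IJ Ja _ [p [r [/IJ Jp ->]]]; apply: idealD => //; apply: idealMl.
Qed.

Lemma prime_separation I T : is_ideal I -> T 1 ->
  (forall x y, T x -> T y -> T (x * y)) -> (forall x, T x -> ~ I x) ->
  exists Q, [/\ prime_ideal Q, I `<=` Q & forall x, T x -> ~ Q x].
Proof.
move=> hI T1 TM TI.
pose good J := [/\ is_ideal J, I `<=` J & forall x, T x -> ~ J x].
have gI : good I by split.
have [F FP totF|Q [PQ maxQ]] := @Zorn_bigcup A [set J | J = set0 \/ good J].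
  have [[J0 [FJ0 gJ0]]|none] := pselect (exists J, F J /\ good J); last first.
    left; rewrite -subset0 => x [J FJ Jx].
    have [J0|gJ] := FP _ FJ; first by rewrite J0 in Jx.
    by case: none; exists J.
  have gof J x : F J -> J x -> good J by move=> /FP [->|].
  right; split.
  - split; first by exists J0 => //; case: gJ0 => /ideal0.
      move=> x y [J FJ Jx] [J' FJ' Jy].
      have [hJ _ _] := gof _ _ FJ Jx; have [hJ' _ _] := gof _ _ FJ' Jy.
      have [s|s] := totF _ _ FJ FJ'; [exists J' | exists J] => //; apply: idealD => //;
        exact: s.
    move=> a x [J FJ Jx]; exists J => //; apply: idealMl => //.
    by case: (gof _ _ FJ Jx).
  - by move=> x Ix; exists J0 => //; case: gJ0 => _ + _; apply.
  - by move=> x Tx [J FJ Jx]; have [_ _ /(_ x Tx)] := gof _ _ FJ Jx.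
have [hQ IQ TQ] : good Q.
  case: PQ => // Q0; case: (maxQ I); last by right.
  by rewrite Q0; split=> // /(_ 0); apply; apply: ideal0.
exists Q; split=> //; split=> //; first exact: TQ.
move=> a b Qab; apply: contrapT => /not_orP [nQa nQb].
have hit c : ~ Q c -> exists x, T x /\ adjoin Q c x.
  move=> nQc; apply: contrapT => none; apply: (maxQ (adjoin Q c)).
    split; first exact: adjoin_sub.
    by move=> h; apply: nQc; apply: h; apply: adjoin_mem.
  right; split; first exact: adjoin_is_ideal.
    by apply: subset_trans IQ _; apply: adjoin_sub.
  by move=> x Tx Qx; apply: none; exists x.
have [x [Tx [p [r [Qp ex]]]]] := hit _ nQa.
have [y [Ty [p' [r' [Qp' ey]]]]] := hit _ nQb.
apply: (TQ _ (TM _ _ Tx Ty)); rewrite ex ey mulrDl; apply: idealD => //; first exact: idealMr.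
rewrite mulrDr; apply: idealD => //; first exact: idealMl.
by rewrite mulrACA; apply: idealMl.
Qed.

(** Separates [I] from the multiplicative set of all [t * y ^+ n] with [t] outside [Q], that is,
    finds a prime in the localization at [Q] with [y] inverted. *)
Lemma prime_below I Q y : is_ideal I -> prime_ideal Q ->
  (forall t n, ~ Q t -> ~ I (t * y ^+ n)) ->
  exists Q', [/\ prime_ideal Q', I `<=` Q', Q' `<=` Q & ~ Q' y].
Proof.
move=> hI [hQ Q1 prQ] h.
have [|||Q' [pQ' IQ' dQ']] := @prime_separation I [set x | exists t n, ~ Q t /\ x = t * y ^+ n] hI.
- by exists 1, 0%N; rewrite expr0 mulr1.
- move=> _ _ [t [n [Qs ->]]] [t' [n' [Qs' ->]]]; exists (t * t'), (n + n')%N.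
  by rewrite exprD mulrACA; split=> // /prQ [].
- by move=> _ [t [n [Qs ->]]]; apply: h.
exists Q'; split=> //.
  move=> x Q'x; apply: contrapT => Qx; apply: (dQ' x) => //.
  by exists x, 0%N; rewrite expr0 mulr1.
by apply: dQ'; exists 1, 1%N; rewrite mul1r expr1.
Qed.

Definition adjoins I s := foldl adjoin I s.

Lemma adjoins_is_ideal I s : is_ideal I -> is_ideal (adjoins I s).
Proof. by elim: s I => //= a s ih I hI; apply: ih; apply: adjoin_is_ideal. Qed.

Lemma adjoins_sub I s : I `<=` adjoins I s.
Proof.
elim: s I => [I x //|a s ih I] /=.
by apply: subset_trans (@adjoin_sub I a) _; apply: ih.
Qed.

Lemma adjoins_mem I s x : is_ideal I -> x \in s -> adjoins I s x.
Proof.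
elim: s I => //= a s ih I hI; rewrite inE => /orP [/eqP ->|]; last first.
  by apply: ih; apply: adjoin_is_ideal.
by apply: (adjoins_sub s); apply: adjoin_mem.
Qed.

Lemma adjoins_least I J s : is_ideal J -> I `<=` J -> (forall x, x \in s -> J x) ->
  adjoins I s `<=` J.
Proof.
move=> hJ; elim: s I => [//|a s ih] I IJ sJ /=; apply: ih.
  by apply: adjoin_least => //; apply: sJ; rewrite mem_head.
by move=> x xs; apply: sJ; rewrite inE xs orbT.
Qed.

Lemma adjoinsP I s x : adjoins I s x <->
  exists p (c : nat -> A), I p /\ x = p + \sum_(i < size s) c i * s`_i.
Proof.
elim: s I x => [|a s ih] I x /=.
  split=> [Ix|[p [c [Ip ->]]]]; last by rewrite big_ord0 addr0.
  by exists x, (fun=> 0); rewrite big_ord0 addr0.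
split=> [/ih [_ [c [[p [r [Ip ->]]] ->]]]|[p [c [Ip ->]]]].
  exists p, (fun n => if n is n'.+1 then c n' else r); split=> //.
  by rewrite big_ord_recl /= addrA.
apply/ih; exists (p + c 0%N * a), (fun n => c n.+1); split; first by exists p, (c 0%N).
by rewrite big_ord_recl /= addrA.
Qed.

(** Weak regularity on [A / I]: the final quotient is allowed to be zero. *)
Fixpoint wreg I s : Prop :=
  if s is a :: s' then (forall v, I (a * v) -> I v) /\ wreg (adjoin I a) s' else True.

Lemma wregP I s : wreg I s <-> forall i v, (i < size s)%N ->
  adjoins I (take i s) (s`_i * v) -> adjoins I (take i s) v.
Proof.
elim: s I => [|a s ih] I /=; first by split.
split=> [[h1 /ih h2] [|i] v //=|h]; first by move=> _; apply: h1.
  exact: h2.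
split=> [v|]; first exact: (h 0%N v).
by apply/ih => i v si; apply: (h i.+1 v).
Qed.

Lemma wreg_chain I s n0 : is_ideal I -> wreg I s ->
  (forall Q, prime_ideal Q -> I `<=` Q -> chain_to n0 Q) ->
  forall Q, prime_ideal Q -> adjoins I s `<=` Q -> chain_to (n0 + size s) Q.
Proof.
elim: s I n0 => [|a s ih] I n0 hI /=; first by rewrite addn0.
move=> [reg ws] hc Q pQ sQ; rewrite addnS -addSn.
apply: (ih (adjoin I a)) => //; first exact: adjoin_is_ideal.
move=> {sQ pQ}Q pQ sQ; have IQ : I `<=` Q by apply: subset_trans sQ; apply: adjoin_sub.
have [hQ Q1 prQ] := pQ.
have Qa : Q a by apply: sQ; apply: adjoin_mem.
have [|Q' [pQ' IQ' Q'Q Q'a]] := @prime_below I Q a hI pQ.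
  move=> t n Qt; elim: n => [|n ihn]; first by rewrite expr0 mulr1 => /IQ.
  by rewrite exprS mulrCA => /reg.
apply: (chain_toS (hc _ pQ' IQ')) => //; split=> // /(_ _ Qa) //.
Qed.

End PrimeSeparation.

Section CoordinateChains.
Variables (K : numFieldType) (m : nat).
Local Notation A := (cseries K m).
Local Notation var i := (mono K (munit i)).

Lemma chain_to_coord n (E F : {set 'I_m}) : chain_to n (@coord_prime K m E) ->
  E \subset F -> chain_to (n + #|F :\: E|)%N (@coord_prime K m F).
Proof.
move=> + EF; move e : #|F :\: E| => d; elim: d n E EF e => [|d ih] n E EF e c.
  have -> : F = E; last by rewrite addn0.
  by apply/eqP; rewrite finset.eqEsubset EF andbT -finset.setD_eq0 -cards_eq0 e.
have [i iFE] : exists i, i \in F :\: E by apply/set0Pn; rewrite -card_gt0 e.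
move: (iFE); rewrite inE => /andP [iE iF].
rewrite addnS -addSn; apply: (ih _ (i |: E)).
- by apply/fintype.subsetP => j; rewrite !inE => /orP [/eqP -> //|]; apply: (fintype.subsetP EF).
- rewrite (_ : F :\: (i |: E) = (F :\: E) :\ i); last first.
    by apply/setP => j; rewrite !inE negb_or -andbA; case: (j == i).
  by move: e; rewrite (cardsD1 i) iFE => -[].
apply: (chain_toS c); last exact: coord_primeP.
split; first by apply: coord_primeS; apply: finset.subsetUr.
move=> /(_ (var i)) h; move: iE; apply/negP; rewrite negbK.
by apply/(@coord_prime_var K); apply: h; apply/coord_prime_var; rewrite !inE eqxx.
Qed.

(** A chain ending at [coord_prime E] continues through the remaining [m - #|E|] coordinates up to
    the maximal ideal, where [chain_le] applies. *)
Lemma height_coord n (E : {set 'I_m}) : chain_to n (@coord_prime K m E) -> (n <= #|E|)%N.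
Proof.
move=> /chain_to_coord /(_ (finset.subsetT E)) /chain_le.
have := cardsID E finset.setT; rewrite finset.setTI cardsT card_ord.
lia.
Qed.

Lemma coord_chain (E : {set 'I_m}) : chain_to #|E| (@coord_prime K m E).
Proof.
have := @chain_to_coord 0 finset.set0 E (chain_to0 (coord_primeP K finset.set0)) (finset.sub0set E).
by rewrite finset.setD0.
Qed.

(* A regular sequence of length [#|E|] cannot lie in a prime strictly below the
   height [#|E|] prime [coord_prime E]. *)
Lemma coord_minimal (s : seq A) (E : {set 'I_m}) i : wreg [set 0] s -> size s = #|E| ->
  (forall x, x \in s -> coord_prime E x) -> i \in E ->
  exists t n, ~ coord_prime E t /\ adjoins [set 0] s (t * var i ^+ n).
Proof.
move=> ws sz sE iE; apply: contrapT => none.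
have h0 : is_ideal [set 0 : A].
  by split=> // [_ _ -> ->|a _ ->]; rewrite /= ?addr0 ?mulr0.
have hs : is_ideal (adjoins [set 0] s) by apply: adjoins_is_ideal.
have [|Q [pQ sQ QE Qi]] := @prime_below _ _ _ (var i) hs (@coord_primeP K m E).
  by move=> t n tE h; apply: none; exists t, n.
have c : chain_to (0 + size s) Q.
  by apply: wreg_chain ws _ _ pQ sQ => // Q' pQ' _; apply: chain_to0.
suff /height_coord : chain_to (size s).+1 (@coord_prime K m E) by rewrite sz ltnn.
apply: (chain_toS c); last exact: coord_primeP.
by split=> // /(_ (var i)) h; apply: Qi; apply: h; apply/coord_prime_var.
Qed.

End CoordinateChains.

(** * Ideals generated by linear forms *)

(** A row basis has an invertible square block of columns; multiplying by its inverse gives a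
    reduced echelon form with pivots [g]. *)
Lemma row_echelon (F : fieldType) p m (U : 'M[F]_(p, m)) :
  exists r (g : 'I_r -> 'I_m) (B : 'M[F]_(r, m)),
    [/\ injective g, (B :=: U)%MS & forall i j, B i (g j) = (i == j)%:R].
Proof.
pose B0 := row_base U.
have full : row_full B0^T by rewrite /row_full mxrank_tr eq_row_base.
pose g := fullrankfun full; pose N := colsub g B0.
have uN : N \in unitmx.
  have -> : N = (rowsub g B0^T)^T by apply/matrixP => i j; rewrite !mxE.
  by rewrite unitmx_tr fullrowsub_unit.
exists (\rank U), g, (invmx N *m B0); split; first exact: fullrankfun_inj.
  apply: eqmx_trans (eq_row_base U); apply: eqmxMfull.
  by rewrite row_full_unit unitmx_inv.
move=> i j; have /matrixP /(_ i j) := mulVmx uN; rewrite !mxE => <-.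
by apply: eq_bigr => l _; rewrite !mxE.
Qed.

Section LinearIdeals.
Variables (K : numFieldType) (m : nat).
Local Notation idx := (mindex m).
Local Notation A := (cseries K m).
Implicit Types (f g h : A) (u v : 'rV[K]_m).
Local Notation var i := (mono K (munit i)).

Lemma cstD (x y : K) : cst m (x + y) = cst m x + cst m y.
Proof. by apply: cs_ext => a; rewrite coefD !coef_cst mulrDl. Qed.

Lemma cstM (x y : K) : cst m (x * y) = cst m x * cst m y.
Proof. by apply: cs_ext => a; rewrite coef_cstM !coef_cst mulrA. Qed.

Lemma cst1 : cst m (1 : K) = 1.
Proof. by apply: cs_ext => a; rewrite coef_cst mul1r coef1. Qed.

Lemma cst0 : cst m (0 : K) = 0.
Proof. by apply: cs_ext => a; rewrite coef_cst mul0r coef0. Qed.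

Lemma cst_sum I (s : seq I) (P : pred I) (F : I -> K) :
  cst m (\sum_(i <- s | P i) F i) = \sum_(i <- s | P i) cst m (F i).
Proof. by elim/big_rec2: _ => [|i x y _ <-]; rewrite ?cst0 ?cstD. Qed.

Definition lin u : A := \sum_i cst m (u 0 i) * var i.

Lemma coef_lin u a : lin u a = \sum_i u 0 i * (a == munit i)%:R.
Proof. by rewrite coef_sum; apply: eq_bigr => i _; rewrite coef_cstM coef_mono. Qed.

Lemma munit_inj : injective (@munit m).
Proof.
move=> i j /ffunP /(_ i); by rewrite !ffunE eqxx; case: eqP.
Qed.

Lemma coef_lin_unit u i : lin u (munit i) = u 0 i.
Proof.
rewrite coef_lin (bigD1 i) //= eqxx mulr1 big1 ?addr0 // => j ne.
by case: eqP => [/munit_inj e|]; [rewrite e eqxx in ne | rewrite mulr0].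
Qed.

Lemma coef_lin_neq0 u a : lin u a <> 0 -> exists2 i, a = munit i & u 0 i <> 0.
Proof.
move=> h; apply: contrapT => none; apply: h; rewrite coef_lin big1 // => i _.
case: eqP => [e|]; last by rewrite mulr0.
have [->|/eqP ne] := eqVneq (u 0 i) 0; first by rewrite mul0r.
by case: none; exists i.
Qed.

Lemma coef_lin0 u : lin u (mzero m) = 0.
Proof.
apply: contrapT => /coef_lin_neq0 [i /ffunP /(_ i)].
by rewrite !ffunE eqxx.
Qed.

Lemma linD u v : lin (u + v) = lin u + lin v.
Proof.
by rewrite /lin -big_split; apply: eq_bigr => i _; rewrite mxE cstD mulrDl.
Qed.

Lemma linZ x u : lin (x *: u) = cst m x * lin u.
Proof.
by rewrite /lin mulr_sumr; apply: eq_bigr => i _; rewrite mxE cstM mulrA.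
Qed.

Lemma linB u v : lin (u - v) = lin u - lin v.
Proof. by apply/eqP; rewrite eq_sym subr_eq -linD subrK. Qed.

Lemma lin0 : lin 0 = 0.
Proof. by rewrite -(scale0r 0) linZ cst0 mul0r. Qed.

Lemma lin_sum I (s : seq I) (P : pred I) (F : I -> 'rV[K]_m) :
  lin (\sum_(i <- s | P i) F i) = \sum_(i <- s | P i) lin (F i).
Proof. by elim/big_rec2: _ => [|i x y _ <-]; rewrite ?lin0 ?linD. Qed.

Lemma lin_mul p (D : 'rV[K]_p) (U : 'M[K]_(p, m)) :
  lin (D *m U) = \sum_i cst m (D 0 i) * lin (row i U).
Proof. by rewrite mulmx_sum_row lin_sum; apply: eq_bigr => i _; rewrite linZ. Qed.

Lemma lin_inj : injective lin.
Proof. by move=> u v e; apply/rowP => i; rewrite -!coef_lin_unit e. Qed.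

Definition linear_ideal p (U : 'M[K]_(p, m)) : set A :=
  [set f | exists q : 'I_p -> A, f = \sum_i q i * lin (row i U)].

Lemma linear_ideal_is_ideal p (U : 'M[K]_(p, m)) : is_ideal (linear_ideal U).
Proof.
split; first by exists (fun=> 0); rewrite big1 // => i _; rewrite mul0r.
  move=> _ _ [q ->] [q' ->]; exists (fun i => q i + q' i).
  by rewrite -big_split; apply: eq_bigr => i _; rewrite mulrDl.
move=> h _ [q ->]; exists (fun i => h * q i).
by rewrite mulr_sumr; apply: eq_bigr => i _; rewrite mulrA.
Qed.

Lemma lin_linear_ideal p (U : 'M[K]_(p, m)) u : (u <= U)%MS -> linear_ideal U (lin u).
Proof. by move=> /submxP [D ->]; rewrite lin_mul; exists (fun i => cst m (D 0 i)). Qed.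

Lemma linear_ideal_least p (U : 'M[K]_(p, m)) (J : set A) : is_ideal J ->
  (forall u, (u <= U)%MS -> J (lin u)) -> linear_ideal U `<=` J.
Proof.
move=> hJ h _ [q ->]; apply: ideal_sum => // i _; apply: idealMl => //.
by apply: h; apply: row_sub.
Qed.

Lemma linear_idealS p q (U : 'M[K]_(p, m)) (V : 'M[K]_(q, m)) :
  (U <= V)%MS -> linear_ideal U `<=` linear_ideal V.
Proof.
move=> UV; apply: linear_ideal_least; first exact: linear_ideal_is_ideal.
by move=> u uU; apply: lin_linear_ideal; apply: submx_trans UV.
Qed.

Lemma linear_ideal_coef0 p (U : 'M[K]_(p, m)) f : linear_ideal U f -> f (mzero m) = 0.
Proof.
by move=> [q ->]; rewrite coef_sum big1 // => i _; rewrite coefMz coef_lin0 mulr0.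
Qed.

Lemma pderiv_lin l u : pderiv l (lin u) = cst m (u 0 l).
Proof.
apply: cs_ext => a; rewrite coef_pderiv coef_cst.
have [->|ne] := eqVneq a (mzero m).
  by rewrite madd0 coef_lin_unit mulr1 ffunE mulr1n.
rewrite mulr0; case: (eqVneq (lin u (madd a (munit l))) 0) => [->|/eqP]; first by rewrite mul0rn.
move=> /coef_lin_neq0 [i e _]; case/eqP: ne; apply: mdegree_eq0.
have := congr1 (@mdegree m) e; rewrite mdegreeD !mdegree_unit => /eqP.
by rewrite addn1 eqSS => /eqP.
Qed.

(** Differentiation along [v] kills every generator, so by the product rule it acts on the
    coefficients only. *)
Lemma linear_ideal_deriv p (U : 'M[K]_(p, m)) (v : 'cV[K]_m) f : U *m v = 0 ->
  linear_ideal U f -> linear_ideal U (\sum_l cst m (v l 0) * pderiv l f).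
Proof.
move=> Uv [q ->]; exists (fun i => \sum_l cst m (v l 0) * pderiv l (q i)).
under eq_bigr do rewrite pderiv_sum mulr_sumr.
rewrite exchange_big; apply: eq_bigr => i _ /=.
under eq_bigr do rewrite pderivM pderiv_lin mulrDr [X in _ + X]mulrCA.
rewrite big_split /= [X in _ + X](_ : _ = q i * cst m ((U *m v) i 0)).
  rewrite Uv mxE cst0 mulr0 addr0 mulr_suml; apply: eq_bigr => l _.
  by rewrite mulrA.
rewrite mxE cst_sum mulr_sumr; apply: eq_bigr => l _.
by rewrite -cstM mxE [v l 0 * _]mulrC.
Qed.

Definition supp_off (S : {set 'I_m}) f := forall a, f a <> 0 -> off S a.

Lemma supp_offM S f g : supp_off S f -> supp_off S g -> supp_off S (f * g).
Proof.
by move=> hf hg a /ps_mul_neq0 [b [c [<- /hf ob /hg oc]]]; apply/offD.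
Qed.

Lemma coord_prime_supp_off S f : coord_prime S f -> supp_off S f -> f = 0.
Proof.
move=> h1 h2; apply: cs_ext => a; apply: contrapT => fa; apply: (fa); apply: h1.
exact: h2.
Qed.

Section Echelon.
Variables (r : nat) (g : 'I_r -> 'I_m) (B : 'M[K]_(r, m)).
Hypothesis Bg : forall i j, B i (g j) = (i == j)%:R.
Let S := [set g j | j : 'I_r]%SET.

Lemma echelon_division f : exists2 q, supp_off S q & linear_ideal B (f - q).
Proof.
(* Weight 1 on the pivots and 2 elsewhere makes the pivot variable the leading monomial of each row,
   so the remainder contains no pivot. *)
have [|||q [t [e ht _]]] := @ps_division K m r (fun l => if l \in S then 1%N else 2%N)
  (fun i => lin (row i B)) (fun i => munit (g i)) _ _ _ f.
- by move=> i; case: ifP.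
- by move=> i; rewrite coef_lin_unit mxE Bg eqxx; apply/eqP; apply: oner_neq0.
- have wu w l : wdeg w (munit l) = w l :> nat.
    rewrite /wdeg (bigD1 l) //= ffunE eqxx muln1 big1 ?addn0 // => j ne.
    by rewrite ffunE (negbTE ne) muln0.
  move=> i a /coef_lin_neq0 [l -> Bl] ne; rewrite !wu imset_f //.
  case: ifP => // /imsetP [j _ ej]; move: Bl; rewrite mxE ej Bg; case: eqP => // eij.
  by case: ne; rewrite ej eij.
exists t.
  move=> a /ht h _ /imsetP [j _ ->]; case E: (a (g j)) => [//|n].
  case: (h j); apply/forallP => l; rewrite ffunE; case: eqP => // ->.
  by rewrite E.
by exists q; rewrite e addrK.
Qed.

(* For [v] in the kernel of [B], differentiation along [v] preserves the ideal;
   on series not involving the pivot variables the remaining partial derivatives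
   are of this form, so all their iterates have vanishing constant term. *)
Lemma echelon_supp_off f : linear_ideal B f -> supp_off S f -> f = 0.
Proof.
move=> If sf; apply: cs_ext => a; move e: (mdegree a) => n.
elim: n f If sf a e => [|n ih] f If sf a e.
  by rewrite (mdegree_eq0 e) (linear_ideal_coef0 If).
apply: contrapT => fa.
have [l al] : exists l, (0 < a l)%N.
  apply: contrapT => none; move: e; rewrite /mdegree big1 // => l _.
  by apply/eqP; rewrite -leqn0 leqNgt; apply/negP => h; apply: none; exists l.
have lS : l \notin S by apply/negP => /(sf a fa) h; rewrite h in al.
have pd0 j : pderiv (g j) f = 0.
  apply: cs_ext => b; rewrite coef_pderiv.
  have [->|/eqP /sf] := eqVneq (f (madd b (munit (g j)))) 0; first by rewrite mul0rn.
  by move=> /(_ (g j) (imset_f _ _)); rewrite !ffunE eqxx addn1 => /(_ isT).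
(* The kernel vector of [B] attached to the free column [l]. On a series without pivot variables the
   derivative along it is the partial derivative in x_l. *)
pose v : 'cV[K]_m := \col_k ((k == l)%:R - \sum_j B j l * (k == g j)%:R).
have Bv : B *m v = 0.
  apply/matrixP => i j; rewrite !mxE.
  under eq_bigr do rewrite mxE mulrBr.
  rewrite sumrB (bigD1 l) //= eqxx mulr1 big1 ?addr0 => [|k /negbTE ->]; last by rewrite mulr0.
  under eq_bigr do rewrite mulr_sumr.
  rewrite exchange_big (bigD1 i) //= (bigD1 (g i)) //= eqxx mulr1 Bg eqxx mul1r.
  rewrite big1 => [|k /negbTE ->]; last by rewrite !mulr0.
  rewrite addr0 big1 ?addr0 ?subrr // => k ki.
  rewrite (bigD1 (g k)) //= eqxx mulr1 Bg eq_sym (negbTE ki) mul0r add0r.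
  by rewrite big1 // => t /negbTE ->; rewrite !mulr0.
have := linear_ideal_deriv Bv If.
have -> : \sum_k cst m (v k 0) * pderiv k f = pderiv l f.
  rewrite (bigD1 l) //= big1 => [|k kl].
    rewrite addr0 mxE eqxx big1 ?subr0 ?cst1 ?mul1r // => j _.
    case: eqP => [ej|]; last by rewrite mulr0.
    by move: lS; rewrite ej imset_f.
  rewrite mxE (negbTE kl) sub0r.
  have [/imsetP [j _ ->]|kS] := boolP (k \in S); first by rewrite pd0 mulr0.
  rewrite big1 ?oppr0 ?cst0 ?mul0r // => j _; case: eqP => [ek|]; last by rewrite mulr0.
  by move: kS; rewrite ek imset_f.
move=> Id; have le : mle (munit l) a.
  by apply/forallP => j; rewrite ffunE; case: eqP => // ->.
have od : supp_off S (pderiv l f).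
  move=> b; rewrite coef_pderiv.
  have [->|/eqP /sf /offD [ob _] _ //] := eqVneq (f (madd b (munit l))) 0.
  by rewrite mul0rn.
have dn : mdegree (msub a (munit l)) = n.
  by move: e; rewrite -{1}(maddK le) mdegreeD mdegree_unit => -[].
have /eqP := ih _ Id od _ dn; rewrite coef_pderiv maddC maddK //.
by rewrite mulrn_eq0 => /eqP.
Qed.

(** Each class modulo the ideal is represented by a series free of pivots, uniquely by
    [echelon_supp_off]; such series are closed under products and the power series ring is a
    domain. *)
Lemma echelon_prime : prime_ideal (linear_ideal B).
Proof.
have hI := linear_ideal_is_ideal B; split=> // [/linear_ideal_coef0|f h fh].
  by rewrite coef1 eqxx; apply/eqP; rewrite oner_eq0.
have [p op ip] := echelon_division f; have [q oq iq] := echelon_division h.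
have pq0 : p * q = 0.
  apply: echelon_supp_off; last exact: supp_offM.
  rewrite (_ : p * q = f * h - ((f - p) * h + p * (h - q))); last first.
    by rewrite mulrBl mulrBr addrA subrK opprB addrC subrK.
  by apply: idealB => //; apply: idealD => //; [apply: idealMr | apply: idealMl].
have [_ _ dom] := coord_primeP K (finset.set0 : {set 'I_m}).
rewrite coord_prime0 in dom; have [//|e|e] := dom p q.
  by left; rewrite -(subr0 f) -e.
by right; rewrite -(subr0 h) -e.
Qed.

Lemma echelon_lin u : linear_ideal B (lin u) -> (u <= B)%MS.
Proof.
move=> Iu; pose D : 'rV[K]_r := \row_j u 0 (g j).
suff /lin_inj -> : lin u = lin (D *m B) by apply: submxMl.
apply/eqP; rewrite -subr_eq0; apply/eqP; apply: echelon_supp_off.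
  apply: idealB => //; first exact: linear_ideal_is_ideal.
  by apply: lin_linear_ideal; apply: submxMl.
rewrite -linB => a /coef_lin_neq0 [l -> nz] _ /imsetP [j _ ->].
rewrite ffunE; case: eqP => // e; case: nz; rewrite -e !mxE (bigD1 j) //= Bg eqxx mulr1 mxE.
rewrite big1 ?addr0 ?subrr // => i ij.
by rewrite Bg (negbTE ij) mulr0.
Qed.

End Echelon.

Lemma linear_ideal_eqmx p q (U : 'M[K]_(p, m)) (V : 'M[K]_(q, m)) : (U :=: V)%MS ->
  linear_ideal U = linear_ideal V.
Proof. by move=> e; apply/seteqP; split; apply: linear_idealS; rewrite e. Qed.

Lemma linear_ideal_prime p (U : 'M[K]_(p, m)) : prime_ideal (linear_ideal U).
Proof.
have [r [g [B [_ BU Bg]]]] := row_echelon U.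
by rewrite -(linear_ideal_eqmx BU); apply: echelon_prime Bg.
Qed.

Lemma mem_linear_ideal p (U : 'M[K]_(p, m)) u : linear_ideal U (lin u) <-> (u <= U)%MS.
Proof.
split; last exact: lin_linear_ideal.
have [r [g [B [_ BU Bg]]]] := row_echelon U.
by rewrite -(linear_ideal_eqmx BU) => /(echelon_lin Bg); rewrite BU.
Qed.

Lemma adjoin_lin p (U : 'M[K]_(p, m)) u :
  adjoin (linear_ideal U) (lin u) = linear_ideal (U + u)%MS.
Proof.
apply/seteqP; split.
  apply: adjoin_least; first exact: linear_ideal_is_ideal.
    by apply: linear_idealS; apply: addsmxSl.
  by apply: lin_linear_ideal; apply: addsmxSr.
apply: linear_ideal_least; first by apply: adjoin_is_ideal; apply: linear_ideal_is_ideal.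
move=> _ /sub_addsmxP [[D d] ->] /=.
exists (lin (D *m U)), (cst m (d 0 0)); split; first by apply: lin_linear_ideal; apply: submxMl.
by rewrite linD [d]mx11_scalar mul_scalar_mx linZ mxE eqxx mulr1n.
Qed.

Definition span_rows (U : 'M[K]_m) (s : seq 'rV[K]_m) : 'M[K]_m :=
  foldl (fun V u => (V + u)%MS) U s.

Lemma adjoins_lin (U : 'M[K]_m) s :
  adjoins (linear_ideal U) [seq lin u | u <- s] = linear_ideal (span_rows U s).
Proof. by elim: s U => //= u s ih U; rewrite adjoin_lin ih. Qed.

Definition coord_mx (E : {set 'I_m}) : 'M[K]_m :=
  \matrix_(i, j) ((i == j) && (i \in E))%:R.

Lemma coord_mxP (E : {set 'I_m}) u :
  reflect (forall i, i \notin E -> u 0 i = 0) (u <= coord_mx E)%MS.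
Proof.
apply: (iffP submxP) => [[D ->] i iE|h].
  rewrite mxE big1 // => j _; rewrite mxE; case: eqP => [->|]; last by rewrite mulr0.
  by rewrite (negbTE iE) mulr0.
exists u; apply/rowP => j; rewrite mxE (bigD1 j) //= mxE eqxx big1 ?addr0 => [|i ij].
  by case: (boolP (j \in E)) => [_|/h ->]; rewrite ?mulr1 ?mul0r.
by rewrite mxE (negbTE ij) mulr0.
Qed.

Lemma lin_delta i : lin (delta_mx 0 i) = var i.
Proof.
apply: cs_ext => a; rewrite coef_mono coef_lin (bigD1 i) //= mxE !eqxx mul1r.
by rewrite big1 ?addr0 // => j ji; rewrite mxE (negbTE ji) mul0r.
Qed.

(** Dividing by the variables of [E] leaves a remainder free of them, which is zero as soon as it
    lies in [coord_prime E]. *)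
Lemma coord_prime_linear (E : {set 'I_m}) : coord_prime E = linear_ideal (coord_mx E).
Proof.
have hC := @coord_prime_is_ideal K m E; apply/seteqP; split; last first.
  apply: linear_ideal_least => // u /coord_mxP uE; apply: (ideal_sum hC) => i _.
  case: (boolP (i \in E)) => [iE|/uE ->]; last first.
    by rewrite cst0 mul0r; apply: (ideal0 hC).
  by apply: (idealMl hC); apply/coord_prime_var.
move=> f fE.
have [|||q [r [e hr _]]] := @ps_division K m #|E| (fun=> 1%N)
  (fun i => var (enum_val i)) (fun i => munit (enum_val i)) _ _ _ f.
- by [].
- by move=> i; rewrite coef_mono eqxx; apply/eqP; rewrite oner_eq0.
- by move=> i a; rewrite coef_mono; case: eqP.
have r0 : r = 0.
  apply: (@coord_prime_supp_off E).
    rewrite (_ : r = f - \sum_i q i * var (enum_val i)); last by rewrite e addrC addKr.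
    apply: (idealB hC) => //; apply: (ideal_sum hC) => i _; apply: (idealMl hC).
    by apply/coord_prime_var; apply: enum_valP.
  move=> a /hr h i iE; case E' : (a i) => [//|n].
  case: (h (enum_rank_in iE i)); rewrite enum_rankK_in //.
  by apply/forallP => l; rewrite ffunE; case: eqP => // ->; rewrite E'.
rewrite e r0 addr0; apply: ideal_sum; first exact: linear_ideal_is_ideal.
move=> i _; apply: idealMl; first exact: linear_ideal_is_ideal.
rewrite -lin_delta; apply: lin_linear_ideal; apply/coord_mxP => j jE.
rewrite mxE eqxx /=; case: eqP => //= ej; move: jE; rewrite ej; case/negP.
exact: enum_valP.
Qed.

Lemma coord_mx_rank (E : {set 'I_m}) : \rank (coord_mx E) = #|E|.
Proof.
pose P : 'M[K]_(#|E|, m) := \matrix_(t, j) (enum_val t == j)%:R.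
have PP : P *m P^T = 1%:M.
  apply/matrixP => s t; rewrite !mxE (bigD1 (enum_val s)) //= !mxE eqxx mul1r.
  rewrite big1 ?addr0 => [|j /negbTE ne].
    by rewrite (inj_eq enum_val_inj) eq_sym.
  by rewrite !mxE [_ == j]eq_sym ne mul0r.
have cE : coord_mx E = P^T *m P.
  apply/matrixP => i j; rewrite !mxE; case: (boolP (i \in E)) => iE; last first.
    rewrite andbF big1 // => t _; rewrite !mxE; case: eqP => [e|]; last by rewrite mul0r.
    by move: iE; rewrite -e enum_valP.
  rewrite andbT (bigD1 (enum_rank_in iE i)) //= !mxE enum_rankK_in // eqxx mul1r.
  rewrite big1 ?addr0 // => t ne; rewrite !mxE; case: eqP => [e|]; last by rewrite mul0r.
  by case/eqP: ne; apply: enum_val_inj; rewrite enum_rankK_in.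
have free : row_free P by apply/row_freeP; exists P^T.
rewrite -(eqP free); apply/eqP; rewrite eqn_leq; apply/andP; split; apply: mxrankS.
  by rewrite cE submxMl.
have {1}-> : P = P *m coord_mx E by rewrite cE mulmxA PP mul1mx.
exact: submxMl.
Qed.

End LinearIdeals.

(** * Vanishing ideals of unions of coordinate subspaces *)

Lemma le_common (K : numFieldType) (a b : K) : 0 < a -> 0 < b ->
  exists e, [/\ 0 < e, e <= 1, e <= a & e <= b].
Proof.
move=> a0 b0; have ia : 0 < a^-1 by rewrite invr_gt0.
have ib : 0 < b^-1 by rewrite invr_gt0.
have s0 : 0 < 1 + (a^-1 + b^-1) by rewrite !addr_gt0.
exists (1 + (a^-1 + b^-1))^-1; split; first by rewrite invr_gt0.
- by rewrite invf_le1 // lerDl addr_ge0 // ltW.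
- by rewrite -[X in _ <= X]invrK lef_pV2 ?posrE // addrCA lerDl addr_ge0 ?ler01 // ltW.
- by rewrite -[X in _ <= X]invrK lef_pV2 ?posrE // addrA lerDr addr_ge0 ?ler01 // ltW.
Qed.

Section Vanishing.
Variables (R : realType) (m : nat).
Local Notation C := (cplx R).
Local Notation A := (cseries C m).
Implicit Types (f : A) (E : {set 'I_m}) (X : set 'rV[C]_m).

Lemma coord_prime_vanishing E f : coord_prime E f ->
  forall z, coord_subspace E z -> forall N, ps_partial f z N = 0.
Proof.
move=> fE z zE N; rewrite /ps_partial big1 // => b _.
have [ob|] := pselect (off E (box_index b)); first by rewrite fE ?mul0r.
move=> /existsNP [i /not_implyP [iE bi]].
rewrite /monomial (bigD1 i) //= zE // expr0n.
by case: (box_index b i) bi => // n _; rewrite /= mul0r mulr0.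
Qed.

(** Let [mu] be initial among the monomials of [f] free of [E]. At the points of X_E with free
    coordinates [e ^+ w i], the term of [mu] is at least twice the sum of the others for small [e],
    so [f] does not vanish there. *)
Lemma vanishing_coord_prime E X f : coord_subspace E `<=` X -> vanishing X f ->
  coord_prime E f.
Proof.
move=> EX vf; apply: contrapT => nf.
have [|mu imu] := @initial_ex m [set a | off E a /\ f a <> 0].
  by move: nf => /existsNP [a /not_implyP [? ?]]; exists a.
have [[omu fmu] mumin] := imu.
pose w := lexw (mdegree mu).+1 : 'I_m -> nat.
have w0 i : (0 < w i)%N by apply: lexw_gt0.
pose offb (a : mindex m) := [forall i in E, a i == 0%N].
have offP a : reflect (off E a) (offb a).
  apply: (iffP forallP) => [h i iE|h i]; first by have /implyP /(_ iE) /eqP := h i.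
  by apply/implyP => iE; apply/eqP/h.
pose tail a := if offb a && (a != mu) then f a else 0.
have ct : ps_convergent tail.
  by apply: ps_convergent_le (coef_conv f) _ => a; rewrite /tail; case: ifP; rewrite ?normr0.
have fmu0 : 0 < `|f mu| by rewrite normr_gt0; apply/eqP.
have [||e0 e00 he0] := @wnorm_small _ _ _ w0 tail (wdeg w mu) (`|f mu| / 2%:R) ct.
- by rewrite divr_gt0.
- move=> a; rewrite /tail; case: ifP => // /andP [/offP oa /eqP ne] fa.
  by have [_ /(_ ne)] := mumin a (conj oa fa); apply.
have /nbhs_ballP [d d0 hd] := vf.
have [|e [epos e1 ee0 ed]] := @le_common C e0 (d / 2%:R) e00; first by rewrite divr_gt0.
pose z : 'rV[C]_m := \row_i (if i \in E then 0 else e ^+ w i).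
have zE : coord_subspace E z by move=> i iE; rewrite mxE iE.
have zmon a : monomial z a = if offb a then e ^+ wdeg w a else 0.
  case: offP => [oa|/existsNP [i /not_implyP [iE ai]]].
    rewrite /monomial /wdeg expr_sum; apply: eq_bigr => i _; rewrite mxE.
    by case: ifP => [/oa ->|_]; rewrite ?muln0 // exprM.
  rewrite /monomial (bigD1 i) //= mxE iE expr0n.
  by case: (a i) ai => // n _; rewrite mul0r.
have bz : ball (0 : 'rV[C]_m) d z.
  split=> // i j; rewrite /ball /= !mxE sub0r normrN.
  case: ifP => _; first by rewrite normr0.
  rewrite ger0_norm ?exprn_ge0 ?(ltW epos) //.
  apply: (@le_lt_trans _ _ (d / 2%:R)).
    by apply: le_trans ed; rewrite -[X in _ <= X]expr1; apply: ler_wiXn2l => //; apply: ltW.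
  by rewrite ltr_pdivrMr // ltr_pMr // ltr1n.
have lim0 := hd z bz (EX z zE).
have p0 : 0 < `|f mu| / 2%:R * e ^+ wdeg w mu by rewrite mulr_gt0 ?divr_gt0 ?exprn_gt0.
have [N0 _ hN0] := cvgr0_norm_lt _ lim0 _ p0.
pose N := maxn N0 (mdegree mu).+1.
have := hN0 N (leq_maxl _ _); apply/negP; rewrite -real_leNgt ?normr_real //; last exact: gtr0_real.
have muN : in_box N mu by apply: in_boxW (in_box_degree mu); apply: leq_maxr.
have -> : ps_partial f z N = f mu * e ^+ wdeg w mu +
    \sum_(b : mbox m N) tail (box_index b) * e ^+ wdeg w (box_index b).
  have -> : f mu * e ^+ wdeg w mu =
      \sum_(b : mbox m N | box_index b == mu) f (box_index b) * e ^+ wdeg w (box_index b).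
    by rewrite (@box_sum1 m C N mu (fun a => f a * e ^+ wdeg w a)) muN.
  rewrite big_mkcond -big_split; apply: eq_bigr => b _ /=; rewrite zmon /tail.
  case: eqP => [->|_]; first by rewrite andbF mul0r addr0; case: offP.
  by rewrite andbT add0r; case: ifP; rewrite ?mulr0 ?mul0r.
set s := \sum_(b : mbox m N) _.
have ns : `|s| <= `|f mu| / 2%:R * e ^+ wdeg w mu.
  apply: le_trans (he0 e epos ee0 N); apply: le_trans (ler_norm_sum _ _ _) _.
  apply: ler_sum => b _; rewrite normrM [`|e ^+ _|]ger0_norm // exprn_ge0 //.
  exact: ltW.
apply: le_trans (lerB_normD _ _); rewrite lerBrDr.
apply: (le_trans (lerD (lexx _) ns)); rewrite normrM [`|e ^+ _|]ger0_norm ?exprn_ge0 ?(ltW epos) //.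
by rewrite -mulrDl -splitr.
Qed.

Lemma vanishing_normal_crossing r (E : 'I_r -> {set 'I_m}) f :
  vanishing (\bigcup_j coord_subspace (E j)) f <-> forall j, coord_prime (E j) f.
Proof.
split=> [vf j|h]; first by apply: vanishing_coord_prime vf => z zj; exists j.
rewrite /vanishing /mkset; near=> z => -[j _ zj].
rewrite (_ : (fun N => _) = fun=> (0 : C)); first exact: cvg_cst.
by apply/funext => N; apply: coord_prime_vanishing (h j) _ zj _.
Unshelve. all: by end_near.
Qed.

End Vanishing.

(** * Jacobian minors along coordinate subspaces *)

Section IncreasingEnumeration.
Variables (m k : nat) (E : {set 'I_m}).
Hypothesis cardE : #|E| = k.

Lemma increasing_enum :
  exists2 e : 'I_k -> 'I_m, {homo e : i j / (i < j)%N} & forall i, e i \in E.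
Proof.
exists (fun i => enum_val (cast_ord (esym cardE) i)); last by move=> i; apply: enum_valP.
move=> i j ij.
pose x := enum_val (cast_ord (esym cardE) i); rewrite !(enum_val_nth x).
have so : sorted (relpre val ltn) (enum E).
  rewrite {1}/enum_mem; apply: sorted_filter; first by move=> ? ? ?; apply: ltn_trans.
  by rewrite -enumT -sorted_map val_enum_ord iota_ltn_sorted.
apply: (@sorted_ltn_nth _ (relpre val ltn) _ x _ so) => //.
- by move=> ? ? ?; apply: ltn_trans.
- by rewrite inE -fintype.cardE; apply: ltn_ord.
- by rewrite inE -fintype.cardE; apply: ltn_ord.
Qed.

Lemma increasing_inj (e : 'I_k -> 'I_m) : {homo e : i j / (i < j)%N} -> injective e.
Proof.
move=> he i j eij; apply: val_inj; case: (ltngtP i j) => // /he.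
  by rewrite eij ltnn.
by rewrite eij ltnn.
Qed.

Lemma increasing_onto (e : 'I_k -> 'I_m) : {homo e : i j / (i < j)%N} ->
  (forall i, e i \in E) -> forall j, j \in E -> exists i, j = e i.
Proof.
move=> he eE j; have <- : [set e i | i : 'I_k]%SET = E.
  apply/eqP; rewrite eqEcard card_imset ?card_ord ?cardE ?leqnn ?andbT.
    by apply/fintype.subsetP => _ /imsetP [i _ ->].
  exact: increasing_inj.
by move=> /imsetP [i _ ->]; exists i.
Qed.

(** Hence only one of the [max_minors] has its columns in a given [E]. *)
Lemma increasing_uniq (e e' : 'I_k -> 'I_m) :
  {homo e : i j / (i < j)%N} -> (forall i, e i \in E) ->
  {homo e' : i j / (i < j)%N} -> (forall i, e' i \in E) -> e =1 e'.
Proof.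
move=> he eE he' eE'.
have so (g : 'I_k -> 'I_m) : {homo g : i j / (i < j)%N} ->
    sorted (relpre val ltn) [seq g i | i <- enum 'I_k].
  move=> hg; apply: (@homo_sorted _ _ g (relpre val ltn)); first exact: hg.
  by rewrite -sorted_map val_enum_ord iota_ltn_sorted.
have me (g : 'I_k -> 'I_m) : {homo g : i j / (i < j)%N} -> (forall i, g i \in E) ->
    [seq g i | i <- enum 'I_k] =i E.
  move=> hg gE x; apply/mapP/idP => [[i _ ->] //|/(increasing_onto hg gE) [i ->]].
  by exists i; rewrite ?mem_enum.
have /eq_in_map h : [seq e i | i <- enum 'I_k] = [seq e' i | i <- enum 'I_k].
  apply: (@irr_sorted_eq _ (relpre val ltn)); try exact: so.
  - by move=> ? ? ?; apply: ltn_trans.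
  - by move=> ?; apply: ltnn.
  - by move=> x; rewrite !me.
by move=> i; apply: h; rewrite mem_enum.
Qed.

End IncreasingEnumeration.

Lemma det_ideal (A : comPzRingType) (I : set A) n (M N : 'M[A]_n) : is_ideal I ->
  (forall i j, I (M i j - N i j)) -> I (\det M - \det N).
Proof.
move=> hI h; rewrite /determinant -sumrB; apply: (ideal_sum hI) => s _.
rewrite -mulrBr; apply: (idealMl hI).
apply: (@big_ind2 A A (fun x y => I (x - y))) => //; first by rewrite subrr; apply: ideal0.
move=> x1 x2 y1 y2 h1 h2.
rewrite (_ : _ - _ = y1 * (x1 - x2) + x2 * (y1 - y2)); last first.
  by rewrite !mulrBr addrA [y1 * x2]mulrC subrK [y1 * _]mulrC.
by apply: idealD => //; apply: idealMl.
Qed.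

Section RegularSequences.
Variable A : comPzRingType.
Implicit Type s : seq A.

Lemma ideal_zero : is_ideal [set 0 : A].
Proof. by split=> // [_ _ -> ->|a _ ->]; rewrite /= ?addr0 ?mulr0. Qed.

Lemma seq_submod_adjoins s x : @seq_submod A A^o s x <-> adjoins [set 0] s x.
Proof.
split=> [[w ->]|/adjoinsP [_ [c [-> ->]]]].
  apply/adjoinsP; exists 0, (fun n => oapp w 0 (insub n)); split=> //.
  by rewrite add0r; apply: eq_bigr => i _; rewrite valK mulrC.
by exists (fun i => c i); rewrite add0r; apply: eq_bigr => i _; rewrite mulrC.
Qed.

Lemma regular_seq_wreg s : @regular_seq A A^o s <->
  wreg [set 0] s /\ ~ adjoins [set 0] s 1.
Proof.
split=> [[h1 [v hv]]|[/wregP h1 h2]]; split.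
- by apply/wregP => i v' si /seq_submod_adjoins h; apply/seq_submod_adjoins; apply: h1.
- move=> h; apply: hv; apply/seq_submod_adjoins; rewrite -[v]mulr1.
  by apply: idealMl h; apply: adjoins_is_ideal; apply: ideal_zero.
- by move=> i v si /seq_submod_adjoins h; apply/seq_submod_adjoins; apply: h1.
- by exists 1 => /seq_submod_adjoins.
Qed.

Lemma span_adjoins s : span_ideal [set` s] = adjoins [set 0] s :> set A.
Proof.
have h0 := ideal_zero.
apply/seteqP; split=> [x /(_ _ (conj (adjoins_is_ideal s h0) _))|].
  by apply => y; apply: adjoins_mem.
apply: adjoins_least; first exact: span_is_ideal.
  by move=> _ ->; apply: ideal0; apply: span_is_ideal.
by move=> x xs J [_]; apply.
Qed.

End RegularSequences.

Section Minors.
Variables (K : numFieldType) (m k : nat) (E : {set 'I_m}) (f : k.-tuple (cseries K m)).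
Hypothesis cardE : #|E| = k.
Hypothesis fE : forall i, coord_prime E (tnth f i).
Local Notation A := (cseries K m).
Local Notation var i := (mono K (munit i)).

(** A derivative in a direction tangent to X_E preserves its ideal, so an entire column lies in the
    prime. *)
Lemma minor_off (g : 'I_k -> 'I_m) c : g c \notin E ->
  coord_prime E (\det (colsub g (jacobian f))).
Proof.
move=> gc; have hE := @coord_prime_is_ideal K m E.
rewrite (expand_det_col _ c); apply: (ideal_sum hE) => i _; apply: (idealMr hE).
by rewrite !mxE; apply: coord_prime_pderiv.
Qed.

(* Locally at the generic point of [X_E] the radical ideal [(f)] is the whole
   prime of [X_E]; differentiating [t x_i = sum_a c_ia f_a] on [X_E] exhibits the
   Jacobian minor as a divisor of a power of [t]. *)
Lemma minor_on (e : 'I_k -> 'I_m) : injective e -> (forall i, e i \in E) ->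
  wreg [set 0] f -> radical_ideal (adjoins [set 0] f) ->
  ~ coord_prime E (\det (colsub e (jacobian f))).
Proof.
move=> einj eE wf [hf radf] D; have hE := @coord_prime_is_ideal K m E.
have [_ P1 prE] := coord_primeP K E.
have fE' x : x \in tval f -> coord_prime E x by move=> /tnthP [i ->].
have /choice [t ht] : forall c, exists t, ~ coord_prime E t /\ adjoins [set 0] f (t * var (e c)).
  move=> c; have [|t [n [tE tn]]] := coord_minimal wf _ fE' (eE c); first by rewrite size_tuple.
  (* (t x)^(n+1) is a multiple of t x^n; the exponent [n.+1] also covers n = 0. *)
  exists t; split=> //; apply: (radf _ n.+1).
  by rewrite exprMn exprSr [var _ ^+ n.+1]exprS mulrACA; apply: (idealMl hf).
pose T := \prod_c t c.
have nT : ~ coord_prime E T.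
  rewrite /T; elim/big_rec: _ => [//|c x _ nx /prE [] //].
  by have [] := ht c.
have /choice [q hq] : forall c, exists q : nat -> A, T * var (e c) = \sum_(a < k) q a * tnth f a.
  move=> c; have [_ h] := ht c.
  have : adjoins [set 0] f (T * var (e c)).
    by rewrite /T (bigD1 c) //= mulrAC; apply: (idealMr hf).
  move=> /adjoinsP [_ [q [-> ->]]]; exists q; rewrite add0r size_tuple.
  by apply: eq_bigr => a _; rewrite (tnth_nth 0).
pose Q : 'M[A]_k := \matrix_(c, a) q c a.
pose J := colsub e (jacobian f).
have TQJ c l : coord_prime E ((T%:M : 'M[A]_k) c l - (Q *m J) c l).
  rewrite !mxE.
  have := congr1 (pderiv (e l)) (hq c); rewrite pderiv_sum pderivM.
  under eq_bigr do rewrite pderivM.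
  rewrite big_split /= => h.
  rewrite (_ : T *+ (c == l) = T * pderiv (e l) (var (e c))); last first.
    rewrite -lin_delta pderiv_lin mxE eqxx /= (inj_eq einj) eq_sym.
    by case: (l == c); rewrite ?cst1 ?cst0 ?mulr1 ?mulr0.
  rewrite (eq_bigr (fun a : 'I_k => q c a * pderiv (e l) (tnth f a))); last first.
    by move=> a _; rewrite !mxE.
  rewrite -[T * _](addKr (pderiv (e l) T * var (e c))) h addrA addrK.
  apply: (idealD hE).
    by apply: (idealN hE); apply: (idealMl hE); apply/coord_prime_var.
  by apply: (ideal_sum hE) => a _; apply: (idealMl hE).
have TJ := det_ideal hE TQJ.
have : coord_prime E (T ^+ k).
  rewrite -det_scalar -[\det _](subrK (\det (Q *m J))) det_mulmx.
  by rewrite det_mulmx in TJ; apply: (idealD hE) => //; apply: (idealMl hE).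
move: {1}k => n; elim: n => [|n ih]; first by rewrite expr0.
by rewrite exprS => /prE [/nT|/ih].
Qed.

End Minors.

(** * Linear forms in general position *)

Section GenericVectors.
Variables (K : numFieldType) (m : nat).
Implicit Types (u v x : 'rV[K]_m) (U W : 'M[K]_m).

(** Two points of the line in the same [U] would put [v] in [U], so each subspace excludes at most
    one value of [n]. *)
Lemma line_avoids x v (Us : seq 'M[K]_m) : (forall U, U \in Us -> ~~ (v <= U)%MS) ->
  exists N, forall n, (N <= n)%N -> forall U, U \in Us -> ~~ ((x + n%:R *: v)%R <= U)%MS.
Proof.
elim: Us => [|U Us ih] h; first by exists 0%N.
have [|N hN] := ih; first by move=> V VU; apply: h; rewrite inE VU orbT.
have vU : ~~ (v <= U)%MS by apply: h; rewrite mem_head.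
have [[n0 hn0]|none] := pselect (exists n, ((x + n%:R *: v)%R <= U)%MS); last first.
  exists N => n Nn V; rewrite inE => /orP [/eqP ->|]; last exact: hN.
  by apply/negP => h'; apply: none; exists n.
exists (maxn N n0.+1) => n; rewrite geq_max => /andP [Nn n0n] V.
rewrite inE => /orP [/eqP ->|]; last exact: hN.
apply: contra vU => hn.
have : ((x + n%:R *: v - (x + n0%:R *: v))%R <= U)%MS by apply: addmx_sub; rewrite ?eqmx_opp.
rewrite opprD addrACA subrr add0r -scalerBl -natrB ?(ltnW n0n) // => h'.
have nz : ((n - n0)%:R : K) != 0 by rewrite pnatr_eq0 subn_eq0 -ltnNge.
by rewrite -[v]scale1r -(mulVf nz) -scalerA scalemx_sub.
Qed.

Lemma avoid_subspaces W (Us : seq 'M[K]_m) : (forall U, U \in Us -> ~~ (W <= U)%MS) ->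
  exists2 u : 'rV[K]_m, (u <= W)%MS & forall U, U \in Us -> ~~ (u <= U)%MS.
Proof.
elim: Us => [|U Us ih] h; first by exists (0 : 'rV[K]_m); rewrite ?sub0mx.
have [|v vW vUs] := ih; first by move=> V VU; apply: h; rewrite inE VU orbT.
have [vU|nvU] := boolP (v <= U)%MS; last first.
  by exists v => // V; rewrite inE => /orP [/eqP -> //|]; apply: vUs.
have /row_subPn [i xU] : ~~ (W <= U)%MS by apply: h; rewrite mem_head.
have [N hN] := line_avoids (row i W) vUs.
exists (row i W + N%:R *: v); first by rewrite addmx_sub ?row_sub // scalemx_sub.
move=> V; rewrite inE => /orP [/eqP ->|]; last exact: hN.
apply: contra xU => hU; rewrite -[row i W](addrK (N%:R *: v)); apply: addmx_sub => //.
by rewrite eqmx_opp scalemx_sub.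
Qed.

End GenericVectors.

Section GenericFamilies.
Variables (K : numFieldType) (m : nat) (T : finType).
Implicit Types (v : T -> 'rV[K]_m) (S : {set T}) (U : 'M[K]_m).

Definition fspan (v : T -> 'rV[K]_m) (S : {set T}) : 'M[K]_m := (\sum_(p in S) <<v p>>)%MS.

Lemma fspan_sub v S U : (forall p, p \in S -> (v p <= U)%MS) -> (fspan v S <= U)%MS.
Proof. by move=> h; apply/sumsmx_subP => p /h; rewrite genmxE. Qed.

Lemma mem_fspan v (S : {set T}) p : p \in S -> (v p <= fspan v S)%MS.
Proof. by move=> pS; apply: (sumsmx_sup p) => //; rewrite genmxE. Qed.

Lemma rank_fspan_le v S : (\rank (fspan v S) <= #|S|)%N.
Proof.
rewrite -sum1_card; apply: leq_trans (mxrank_sum_leqif _) _ => /=.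
by apply: leq_sum => p _; rewrite mxrank_gen rank_leq_row.
Qed.

Local Notation rk p := (enum_rank p : nat).

(** The vectors are chosen one at a time along the enumeration of [T], each avoiding the finitely
    many spans of subfamilies that do not contain its whole space [W p]. *)
Lemma generic_vectors (W : T -> 'M[K]_m) (Av : T -> seq 'M[K]_m) :
  (forall p U, U \in Av p -> ~~ (W p <= U)%MS) ->
  exists v : T -> 'rV[K]_m, forall p, [/\ (v p <= W p)%MS,
    forall U, U \in Av p -> ~~ (v p <= U)%MS &
    forall S : {set T}, (forall q, q \in S -> (rk q < rk p)%N) ->
      (v p <= fspan v S)%MS -> (W p <= fspan v S)%MS].
Proof.
move=> hAv; pose P (v : T -> 'rV[K]_m) p := [/\ (v p <= W p)%MS,
    forall U, U \in Av p -> ~~ (v p <= U)%MS &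
    forall S : {set T}, (forall q, q \in S -> (rk q < rk p)%N) ->
      (v p <= fspan v S)%MS -> (W p <= fspan v S)%MS].
suff H n : exists v, forall p, (rk p < n)%N -> P v p.
  by have [v hv] := H #|T|; exists v => p; apply: hv; apply: ltn_ord.
elim: n => [|n [v hv]]; first by exists (fun=> 0).
have [nT|Tn] := ltnP n #|T|; last first.
  by exists v => p _; apply: hv; apply: leq_trans (ltn_ord _) Tn.
pose p := enum_val (Ordinal nT); have rp : rk p = n by rewrite /p enum_valK.
have [|u uW uU] := @avoid_subspaces _ _ (W p)
    (Av p ++ [seq fspan v F | F <- enum {: {set T}} & ~~ (W p <= fspan v F)%MS]).
  move=> U; rewrite mem_cat => /orP [/hAv //|/mapP [S]].
  by rewrite mem_filter => /andP [h _] ->.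
pose v' q := if q == p then u else v q.
have v'E q : (rk q < n)%N -> v' q = v q.
  by rewrite /v'; case: eqP => // ->; rewrite rp ltnn.
have spE S : (forall q, q \in S -> (rk q < n)%N) -> fspan v' S = fspan v S.
  by move=> h; apply: eq_bigr => q /h /v'E ->.
exists v' => q; rewrite ltnS leq_eqVlt => /orP [/eqP e|lt].
  have {q e}-> : q = p by apply: enum_rank_inj; apply: val_inj; rewrite /= e.
  rewrite /P {1 2}/v' eqxx; split=> // [U UA|S hS].
    by rewrite uU // mem_cat UA.
  rewrite spE => [|q /hS]; last by rewrite rp.
  rewrite /v' eqxx => uS; apply: contraLR uS => h; apply: uU.
  rewrite mem_cat; apply/orP; right; apply/mapP; exists S => //.
  by rewrite mem_filter h mem_enum.
have [h1 h2 h3] := hv q lt; rewrite /P v'E //; split=> // S hS.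
by rewrite spE => [|l /hS /ltn_trans]; [apply: h3 | apply].
Qed.

(** If no member depended on those of lower rank, the family would be independent. This moves a
    dependence to the only position that [generic_vectors] controls. *)
Lemma dependent_last v (S : {set T}) p0 : p0 \in S -> (v p0 <= fspan v (S :\ p0))%MS ->
  exists2 p, p \in S & (v p <= fspan v [set q in S | (rk q < rk p)%N])%MS.
Proof.
move=> p0S dep; apply: contrapT => none.
have indep n : forall F : {set T}, #|F| = n -> (forall p, p \in F ->
    ~~ (v p <= fspan v [set q in F | (rk q < rk p)%N])%MS) -> (n <= \rank (fspan v F))%N.
  elim: n => // n ih F cF hF.
  have [q qF] : exists q, q \in F by apply/set0Pn; rewrite -card_gt0 cF.
  case: (@arg_maxnP _ q (mem F) (fun q => rk q) qF) => p pF' pmax.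
  have pF : p \in F := pF'.
  have eF : [set q in F | (rk q < rk p)%N] = F :\ p.
    apply/setP => l; rewrite !inE andbC; case: (boolP (l \in F)) => [lF|]; rewrite ?andbF //.
    have le : (rk l <= rk p)%N := pmax _ lF.
    rewrite ?andbT ltn_neqAle le andbT; congr (~~ _).
    by apply/eqP/eqP => [/val_inj/enum_rank_inj|->].
  have cF' : #|F :\ p| = n by move: cF; rewrite (cardsD1 p) pF => -[].
  have := hF p pF; rewrite eF => npF.
  have sFF : (fspan v (F :\ p) <= fspan v F)%MS.
    by apply: fspan_sub => l; rewrite inE => /andP [_ lF]; apply: mem_fspan.
  apply: leq_ltn_trans (ih _ cF' _) _.
    move=> l; rewrite inE => /andP [_ lF]; apply: contra (hF l lF) => h.
    apply: submx_trans h _; apply: fspan_sub => j; rewrite !inE => /andP [/andP [_ jF] jl].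
    by apply: mem_fspan; rewrite inE jF.
  have : (fspan v (F :\ p) < fspan v F)%MS.
    rewrite /ltmx sFF; apply: contra npF => h.
    by apply: submx_trans h; apply: mem_fspan.
  by rewrite ltmxErank => /andP [].
have := indep _ S erefl; rewrite leqNgt; case/(_ _)/negP.
  by move=> p pS; apply/negP => h; apply: none; exists p.
apply: leq_ltn_trans (_ : \rank (fspan v (S :\ p0)) < _)%N.
  apply: mxrankS; apply: fspan_sub => q qS.
  have [->//|ne] := eqVneq q p0.
  by apply: mem_fspan; rewrite !inE ne.
apply: leq_ltn_trans (rank_fspan_le _ _) _.
by rewrite [X in (_ < X)%N](cardsD1 p0) p0S.
Qed.

End GenericFamilies.

(** * Complete intersections of products of linear forms *)

Lemma adjoinsC (A : comPzRingType) (I : set A) a s : is_ideal I ->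
  adjoins (adjoin I a) s = adjoin (adjoins I s) a.
Proof.
move=> hI; have hIs := adjoins_is_ideal s hI.
apply/seteqP; split.
  apply: adjoins_least; first exact: adjoin_is_ideal.
    apply: adjoin_least; [exact: adjoin_is_ideal | | exact: adjoin_mem].
    by apply: subset_trans (@adjoins_sub _ I s) _; apply: adjoin_sub.
  by move=> x xs; apply: adjoin_sub; apply: adjoins_mem.
have hIa : is_ideal (adjoins (adjoin I a) s) by apply: adjoins_is_ideal; apply: adjoin_is_ideal.
apply: adjoin_least => //; last by apply: adjoins_sub; apply: adjoin_mem.
apply: adjoins_least => //.
  by apply: subset_trans (@adjoin_sub _ I a) _; apply: adjoins_sub.
by move=> x xs; apply: adjoins_mem => //; apply: adjoin_is_ideal.
Qed.

Section LinearProducts.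
Variables (K : numFieldType) (m k r : nat) (v : 'I_k * 'I_r -> 'rV[K]_m).
Hypothesis r_gt0 : (0 < r)%N.
Local Notation A := (cseries K m).
Implicit Types (U : 'M[K]_m) (ts : seq 'I_k) (phi : 'I_k -> 'I_r).

Definition linprod (t : 'I_k) : A := \prod_j lin (v (t, j)).

Definition choice_span U ts phi := span_rows U [seq v (t, phi t) | t <- ts].

Lemma choice_span_sub U ts phi (X : 'M[K]_m) : (U <= X)%MS ->
  (forall t, t \in ts -> (v (t, phi t) <= X)%MS) -> (choice_span U ts phi <= X)%MS.
Proof.
rewrite /choice_span; elim: ts U => //= t ts ih U UX h; apply: ih.
  by rewrite addsmx_sub UX h ?mem_head.
by move=> s sts; apply: h; rewrite inE sts orbT.
Qed.

Lemma choice_span_base U ts phi : (U <= choice_span U ts phi)%MS.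
Proof.
rewrite /choice_span; elim: ts U => //= t ts ih U.
by apply: submx_trans (ih _); apply: addsmxSl.
Qed.

Lemma choice_span_mem U ts phi t : t \in ts -> (v (t, phi t) <= choice_span U ts phi)%MS.
Proof.
rewrite /choice_span; elim: ts U => //= s ts ih U; rewrite inE => /orP [/eqP ->|]; last exact: ih.
by apply: submx_trans (choice_span_base _ _ _); apply: addsmxSr.
Qed.

Lemma linprod_mem U ts phi t : t \in ts ->
  linear_ideal (choice_span U ts phi) (linprod t).
Proof.
move=> tts; rewrite /linprod (bigD1 (phi t)) //=.
apply: (idealMr (linear_ideal_is_ideal _)); apply: lin_linear_ideal.
exact: choice_span_mem.
Qed.

Lemma adjoins_linprod_sub U ts phi :
  adjoins (linear_ideal U) [seq linprod t | t <- ts] `<=` linear_ideal (choice_span U ts phi).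
Proof.
apply: adjoins_least; first exact: linear_ideal_is_ideal.
  by apply: linear_idealS; apply: choice_span_base.
by move=> _ /mapP [t tts ->]; apply: linprod_mem.
Qed.

(* [I + (ab) = (I + (a)) /\ (I + (b))] when [a] is regular modulo [I + (b)]; so
   the ideal of products is the intersection of the primes obtained by choosing
   one factor from each product. *)
Lemma adjoins_linprod U ts : uniq ts ->
  (forall phi t a, t \in ts -> a != phi t -> ~~ (v (t, a) <= choice_span U ts phi)%MS) ->
  forall x, (forall phi, linear_ideal (choice_span U ts phi) x) ->
  adjoins (linear_ideal U) [seq linprod t | t <- ts] x.
Proof.
elim: ts U => [|t ts ih] U /=.
  by move=> _ _ x /(_ (fun=> Ordinal r_gt0)).
move=> /andP [tts uts] gen x hx; rewrite adjoinsC; last exact: linear_ideal_is_ideal.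
set B := adjoins _ _; have hB : is_ideal B.
  by apply: adjoins_is_ideal; apply: linear_ideal_is_ideal.
pose upd phi j := fun s => if s == t then j else phi s.
have updE phi j : choice_span U (t :: ts) (upd phi j) = choice_span (U + v (t, j))%MS ts phi.
  rewrite /choice_span /= {1}/upd eqxx; congr span_rows.
  by apply/eq_in_map => s sts; rewrite /upd; case: (eqVneq s t) => // e; rewrite -e sts in tts.
have BE j : adjoin B (lin (v (t, j))) =
    adjoins (linear_ideal (U + v (t, j))%MS) [seq linprod s | s <- ts].
  by rewrite -adjoin_lin adjoinsC //; apply: linear_ideal_is_ideal.
have gen' j phi s a : s \in ts -> a != phi s ->
    ~~ (v (s, a) <= choice_span (U + v (t, j))%MS ts phi)%MS.
  move=> sts ne; rewrite -updE; apply: gen; first by rewrite inE sts orbT.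
  by rewrite /upd; case: (eqVneq s t) => // e; rewrite -e sts in tts.
have Bcap j y : (forall phi, linear_ideal (choice_span (U + v (t, j))%MS ts phi) y) ->
    adjoin B (lin (v (t, j))) y.
  by rewrite BE; apply: ih => // phi s a; apply: gen'.
have Bsub j y phi : adjoin B (lin (v (t, j))) y ->
    linear_ideal (choice_span (U + v (t, j))%MS ts phi) y.
  by rewrite BE; apply: adjoins_linprod_sub.
(* By induction [B] plus one factor is an intersection of primes, and general position keeps every
   other factor of the same product out of each of them. *)
have Breg j j0 y : j0 != j -> adjoin B (lin (v (t, j))) (y * lin (v (t, j0))) ->
    adjoin B (lin (v (t, j))) y.
  move=> ne h; apply: Bcap => phi; have := Bsub _ _ phi h.
  have [_ _ pr] := linear_ideal_prime (choice_span (U + v (t, j))%MS ts phi).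
  move=> /pr [//|/mem_linear_ideal]; rewrite -updE => h'.
  by have := gen (upd phi j) t j0 (mem_head _ _); rewrite /upd eqxx ne h' => /(_ isT).
have hx' j : adjoin B (lin (v (t, j))) x by apply: Bcap => phi; rewrite -updE; apply: hx.
rewrite /linprod -(big_enum _ _ _ (fun j => lin (v (t, j)))) /=.
have {hx hx'} : forall j, j \in enum 'I_r -> adjoin B (lin (v (t, j))) x by move=> j _.
have := enum_uniq 'I_r; elim: (enum _) x => [|j0 js ihj] x /=.
  by move=> _ _; rewrite big_nil; exists 0, x; rewrite mulr1 add0r; split=> //; apply: ideal0.
move=> /andP [j0js ujs] hx; rewrite big_cons; set b := \prod_(j <- js) _.
have [i [u [Bi xE]]] := hx j0 (mem_head _ _).
have [i' [w [Bi' uE]]] : adjoin B b u.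
  apply: ihj => // j jjs; apply: (Breg j j0).
    by apply: contraNneq j0js => ->.
  have hBj := adjoin_is_ideal (lin (v (t, j))) hB.
  rewrite (_ : u * _ = x - i); last by rewrite xE addrC addKr.
  apply: (idealB hBj); first by apply: hx; rewrite inE jjs orbT.
  exact: adjoin_sub.
exists (i + i' * lin (v (t, j0))), w; split; first by apply: idealD => //; apply: idealMr.
by rewrite xE uE mulrDl addrA -mulrA [b * _]mulrC.
Qed.

Lemma linear_ideal0 : linear_ideal (0 : 'M[K]_m) = [set 0].
Proof.
apply/seteqP; split.
  apply: linear_ideal_least; first exact: ideal_zero.
  by move=> u; rewrite submx0 => /eqP ->; rewrite lin0.
by move=> _ ->; apply: ideal0; apply: linear_ideal_is_ideal.
Qed.

Hypothesis choice_gen : forall phi ts t a, uniq ts -> t \in ts -> a != phi t ->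
  ~~ (v (t, a) <= choice_span 0 ts phi)%MS.
Hypothesis choice_free : forall phi ts t a, uniq ts -> t \notin ts ->
  ~~ (v (t, a) <= choice_span 0 ts phi)%MS.

Lemma adjoins_linprodP ts x : uniq ts -> adjoins [set 0] [seq linprod t | t <- ts] x <->
  forall phi, linear_ideal (choice_span 0 ts phi) x.
Proof.
rewrite -linear_ideal0 => uts; split=> [h phi|h]; first exact: adjoins_linprod_sub h.
by apply: adjoins_linprod => // phi t a; apply: choice_gen.
Qed.

(** The ideal of the earlier products is an intersection of primes spanned by linear forms, and no
    factor of a new product lies in any of them. *)
Lemma wreg_linprod ts : uniq ts -> wreg [set 0] [seq linprod t | t <- ts].
Proof.
move=> uts; apply/wregP => i x; rewrite size_map => its; rewrite -map_take.
have t0 : 'I_k by case: (ts) its => [|t ? _]; [rewrite ltn0 | exact: t].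
rewrite (nth_map t0) // => h.
have ut : uniq (take i ts) by apply: take_uniq.
apply/adjoins_linprodP => // phi; move/adjoins_linprodP: h => /(_ ut phi).
have [hI I1 prI] := linear_ideal_prime (choice_span 0 (take i ts) phi).
move=> /prI [|//]; rewrite /linprod.
elim/big_rec: _ => [//|a y _ ihy /prI [/mem_linear_ideal|//]].
rewrite (negbTE (choice_free _ _ _ _)) //.
apply/negP => /(nthP t0) [j]; rewrite size_take its => ji; rewrite nth_take //.
by move/eqP; rewrite nth_uniq ?(ltn_trans ji) // (ltn_eqF ji).
Qed.

Lemma radical_linprod ts : uniq ts -> radical_ideal (adjoins [set 0] [seq linprod t | t <- ts]).
Proof.
move=> uts; split; first by apply: adjoins_is_ideal; apply: ideal_zero.
move=> a n /adjoins_linprodP h; apply/adjoins_linprodP => // phi.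
have [hI I1 prI] := linear_ideal_prime (choice_span 0 ts phi).
by have := h uts phi; elim: n {h} => [|n ihn]; rewrite ?expr0 // exprS => /prI [].
Qed.

End LinearProducts.

Lemma coord_mx_sub (K : numFieldType) m (E F : {set 'I_m}) :
  (coord_mx K E <= coord_mx K F)%MS -> E \subset F.
Proof.
move=> h; apply/fintype.subsetP => i iE; apply/negPn/negP => iF.
have /coord_mxP /(_ i iF) : ((delta_mx 0 i : 'rV[K]_m) <= coord_mx K F)%MS.
  apply: submx_trans h; apply/coord_mxP => j jE; rewrite mxE eqxx /=.
  by case: eqP => // e; rewrite e iE in jE.
by rewrite mxE !eqxx => /eqP; rewrite oner_eq0.
Qed.

(** In a dependent family of at most k + 1 vectors, the last dependent [v p] forces all of
    [coord_mx] of its set into the span of its predecessors. By rank these are all k other members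
    and span exactly that space; as each vector avoids the coordinate spaces of the other sets, all
    indices [j] agree. A second factor from the same product has a different index, and a factor
    from a new product leaves at most k vectors. *)
Lemma generic_linear_forms (K : numFieldType) m k r (E : 'I_r -> {set 'I_m}) :
  injective E -> (forall j, #|E j| = k) ->
  exists v : 'I_k * 'I_r -> 'rV[K]_m,
    [/\ forall p, (v p <= coord_mx K (E p.2))%MS,
        forall phi ts t a, uniq ts -> t \in ts -> a != phi t ->
          ~~ (v (t, a) <= choice_span v 0 ts phi)%MS &
        forall phi ts t a, uniq ts -> t \notin ts ->
          ~~ (v (t, a) <= choice_span v 0 ts phi)%MS].
Proof.
move=> Einj cE.
have Esub i j : E i \subset E j -> i = j.
  by move=> s; apply: Einj; apply/eqP; rewrite eqEcard s !cE leqnn.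
have [|v hv] := @generic_vectors K m _ (fun p : 'I_k * 'I_r => coord_mx K (E p.2))
    (fun p => [seq coord_mx K (E b) | b <- enum 'I_r & b != p.2]).
  move=> p U /mapP [b]; rewrite mem_filter => /andP [bp _] ->.
  by apply: contra bp => /coord_mx_sub /Esub ->.
have key (S : {set 'I_k * 'I_r}) p0 : p0 \in S -> (v p0 <= fspan v (S :\ p0))%MS ->
    (#|S| <= k.+1)%N -> (k < #|S|)%N /\ forall q q', q \in S -> q' \in S -> q.2 = q'.2.
  move=> p0S dep cS; have [p pS vp] := dependent_last p0S dep.
  set F := [set q in S | _]%SET in vp.
  have WF : (coord_mx K (E p.2) <= fspan v F)%MS.
    by have [_ _] := hv p; apply=> // q; rewrite inE => /andP [].
  have rW : (k <= \rank (coord_mx K (E p.2)))%N by rewrite coord_mx_rank cE.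
  have FS : F \subset S :\ p.
    apply/fintype.subsetP => q; rewrite !inE => /andP [-> lt]; rewrite andbT.
    by apply: contraTneq lt => ->; rewrite ltnn.
  have cSp : #|S| = #|S :\ p|.+1 by rewrite (cardsD1 p) pS.
  have kF : (k <= #|F|)%N.
    by apply: leq_trans (rank_fspan_le v F); apply: leq_trans rW (mxrankS WF).
  have kS : (k < #|S|)%N by rewrite cSp ltnS; apply: leq_trans kF (subset_leq_card FS).
  have eF : F = S :\ p.
    by apply/eqP; rewrite eqEcard FS; apply: leq_trans kF; rewrite -ltnS -cSp.
  have FW : (fspan v F <= coord_mx K (E p.2))%MS.
    rewrite -(mxrank_leqif_sup WF) coord_mx_rank cE eqn_leq.
    rewrite (leq_trans rW (mxrankS WF)) andTb.
    apply: leq_trans (rank_fspan_le v F) _.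
    by rewrite eF -ltnS -cSp.
  suff h q : q \in S -> q.2 = p.2 by split=> // q q' /h -> /h ->.
  move=> qS; have [->//|qp] := eqVneq q p.
  have qF : q \in F by rewrite eF !inE qp.
  have vq := submx_trans (mem_fspan v qF) FW.
  apply/eqP/negPn/negP => ne; have [_ /(_ (coord_mx K (E p.2))) h _] := hv q.
  move: vq; apply/negP; apply: h; apply/mapP; exists p.2 => //.
  by rewrite mem_filter mem_enum eq_sym ne.
have sz (ts : seq 'I_k) : uniq ts -> (size ts <= k)%N.
  by move=> /card_uniqP <-; rewrite -[k in (_ <= k)%N]card_ord max_card.
have choose phi ts t a : uniq ts -> (t, a) \notin [seq (s, phi s) | s <- ts] ->
    (v (t, a) <= choice_span v 0 ts phi)%MS ->
    (k < #|(t, a) |: [set p in [seq (s, phi s) | s <- ts]]|)%N /\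
    forall s, s \in ts -> phi s = a.
  move=> uts nS dep.
  set S := ((t, a) |: _)%SET.
  have cS : #|S| = (size ts).+1.
    rewrite cardsU1 inE nS cardsE; congr _.+1.
    rewrite (card_uniqP _) ?size_map // map_inj_uniq // => s s' [].
    by [].
  have [|||h1 h2] := key S (t, a); first by rewrite !inE eqxx.
  - apply: submx_trans dep _; apply: choice_span_sub; first exact: sub0mx.
    move=> s sts; apply: mem_fspan; rewrite !inE.
    have sm : (s, phi s) \in [seq (s, phi s) | s <- ts] by apply/mapP; exists s.
    by rewrite sm orbT andbT; apply: contraNneq nS => <-.
  - by rewrite cS ltnS sz.
  split=> // s sts; apply: (h2 (s, phi s) (t, a)); rewrite !inE ?eqxx //.
  by apply/orP; right; apply/mapP; exists s.
exists v; split.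
- by move=> p; have [] := hv p.
- move=> phi ts t a uts tts ne; apply/negP => /choose.
  case=> // [|_ /(_ t tts) e]; last by rewrite e eqxx in ne.
  by apply/negP => /mapP [s _ [e1 e2]]; move: ne; rewrite e2 e1 eqxx.
- move=> phi ts t a uts tts; apply/negP => /choose [] //.
    by apply/negP => /mapP [s sts [e _]]; rewrite e sts in tts.
  rewrite cardsU1 cardsE => h _.
  have : (k < (size ts).+1)%N.
    apply: leq_trans h _; rewrite -add1n leq_add //; first by case: (_ \notin _).
    by apply: leq_trans (card_size _) _; rewrite size_map.
  by rewrite ltnNge (sz (t :: ts)) //= tts.
Qed.

(** * The Jacobian module *)

Section QuotientMap.
Variables (A : comPzRingType) (I : ideal A).
Local Notation pi := (@quo_pi A I).

Lemma quo_piZM x y : pi (x * y) = pi x * pi y.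
Proof. exact: quo_piM. Qed.

Lemma quo_pi0 : pi 0 = 0.
Proof. by apply: (addIr (pi 0)); rewrite -quo_piD !add0r. Qed.

Lemma quo_pi_sum T (s : seq T) (F : T -> A) :
  pi (\sum_(i <- s) F i) = \sum_(i <- s) pi (F i).
Proof. by elim/big_rec2: _ => [|i x y _ <-]; rewrite ?quo_pi0 // quo_piD. Qed.

Lemma quo_pi_eq0 x : pi x = 0 <-> ideal_set I x.
Proof. by rewrite -quo_pi0 quo_piP subr0. Qed.

Lemma quo_pi_lift (s : seq (quo I)) : exists t : seq A, s = [seq pi x | x <- t].
Proof.
elim: s => [|y s [t ->]]; first by exists [::].
by have [x <-] := quo_piE y; exists (x :: t).
Qed.

Lemma image_primeP (P : set A) : prime_ideal P -> I `<=` P ->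
  prime_ideal (pi @` P) /\ forall x, (pi @` P) (pi x) <-> P x.
Proof.
move=> [hP P1 prP] IP.
have mem x : (pi @` P) (pi x) <-> P x.
  split=> [[y Py /quo_piP h]|Px]; last by exists x.
  by rewrite -[x](subKr y); apply: idealB => //; apply: IP.
split=> //; split; last 1 first.
- move=> y z; have [a <-] := quo_piE y; have [b <-] := quo_piE z.
  by rewrite -quo_piZM => /mem /prP [/mem|/mem]; [left|right].
- split; first by exists 0; [apply: ideal0 | apply: quo_pi0].
    by move=> _ _ [a Pa <-] [b Pb <-]; exists (a + b); [apply: idealD | rewrite quo_piD].
  move=> y _ [b Pb <-]; have [a <-] := quo_piE y.
  by exists (a * b); [apply: idealMl | rewrite quo_piZM].
- by move=> /mem.
Qed.

Lemma preimage_prime (P : set (quo I)) : prime_ideal P ->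
  prime_ideal (pi @^-1` P) /\ I `<=` pi @^-1` P.
Proof.
move=> [hP P1 prP]; split; last first.
  by move=> x Ix; rewrite /preimage /mkset (quo_pi_eq0 x).2 //; apply: ideal0.
split=> //.
- split; rewrite /preimage /mkset /=; first by rewrite quo_pi0; apply: ideal0.
    by move=> x y hx hy; rewrite quo_piD; apply: idealD.
  by move=> a x hx; rewrite quo_piZM; apply: idealMl.
- by move=> a b; rewrite /preimage /mkset /= quo_piZM; apply: prP.
Qed.

End QuotientMap.

Section NormalCrossing.
Variables (R : realType) (m k r : nat) (E : 'I_r -> {set 'I_m}).
Hypothesis r_gt0 : (0 < r)%N.
Hypothesis E_inj : injective E.
Hypothesis card_E : forall j, #|E j| = k.
Local Notation C := (cplx R).
Local Notation A := (cseries C m).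
Local Notation X := (\bigcup_j @coord_subspace R m (E j)).
Local Notation I := (germ_ideal X).
Local Notation pi := (@quo_pi A I).
Local Notation P j := (@coord_prime C m (E j)).
Let j0 : 'I_r := Ordinal r_gt0.
Let hP j := @coord_prime_is_ideal C m (E j).

Let memI a : ideal_set I a <-> forall j, P j a.
Proof. exact: vanishing_normal_crossing. Qed.

Let not_sub i j : i != j -> exists2 l, l \in E i & l \notin E j.
Proof.
move=> ij; apply/subsetPn; apply: contra ij => s; apply/eqP/E_inj/eqP.
by rewrite eqEcard s !card_E leqnn.
Qed.

Lemma reduced_ci_exists : exists f : k.-tuple A, reduced_ci X f.
Proof.
have [v [vE gen free]] := @generic_linear_forms C m k r E E_inj card_E.
pose f : k.-tuple A := [tuple linprod v t | t < k].
have fE : tval f = [seq linprod v t | t <- enum 'I_k] by [].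
have uk := enum_uniq 'I_k.
have Pf j i : P j (tnth f i).
  rewrite tnth_mktuple /linprod (bigD1 j) //=; apply: (idealMr (hP j)).
  by rewrite coord_prime_linear; apply: lin_linear_ideal; apply: (vE (i, j)).
exists f; split.
- by move=> i; apply/memI => j.
- apply/regular_seq_wreg; rewrite fE; split; first exact: wreg_linprod.
  move=> h; have [_ P1 _] := coord_primeP C (E j0); apply: P1.
  apply: adjoins_least h => //; first by move=> _ ->; apply: ideal0.
  by rewrite -fE => _ /tnthP [i ->].
- by rewrite span_adjoins fE; apply: radical_linprod.
Qed.

Variable f : k.-tuple A.
Hypothesis ci_f : reduced_ci X f.

Let delta_ex : exists e : 'I_r -> 'I_k -> 'I_m, forall j,
  {homo e j : a b / (a < b)%N} /\ forall i, e j i \in E j.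
Proof.
have /choice [e he] : forall j, exists e : 'I_k -> 'I_m,
    {homo e : a b / (a < b)%N} /\ forall i, e i \in E j.
  by move=> j; have [e ? ?] := increasing_enum (card_E j); exists e.
by exists e.
Qed.

Let e := projT1 (cid delta_ex).
Let e_incr j : {homo e j : a b / (a < b)%N}.
Proof. exact: (projT2 (cid delta_ex) j).1. Qed.
Let e_mem j i : e j i \in E j.
Proof. exact: (projT2 (cid delta_ex) j).2. Qed.

Let delta j := \det (colsub (e j) (jacobian f)).

Let Pf j i : P j (tnth f i).
Proof. by have [/(_ i) /memI + _ _] := ci_f; apply. Qed.

Let delta_on j : ~ P j (delta j).
Proof.
have [_ /regular_seq_wreg [wf _] rf] := ci_f.
apply: minor_on => //; first exact: (increasing_inj (@e_incr j)).
by rewrite -span_adjoins.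
Qed.

Let delta_off i j : i != j -> P j (delta i).
Proof.
move=> /not_sub [l li lj].
have [c ec] := increasing_onto (card_E i) (@e_incr i) (@e_mem i) li.
by rewrite ec in lj; exact: (minor_off (@Pf j) lj).
Qed.

(** Represents the element with components [b j] of the direct sum of the A / P_j; [comb_eq] and
    [J_elim] make this an isomorphism onto the Jacobian ideal. *)
Let comb (b : 'I_r -> A) := \sum_j b j * delta j.

Let comb_mod b j : P j (comb b - b j * delta j).
Proof.
rewrite /comb (bigD1 j) //= addrAC subrr add0r; apply: (ideal_sum (hP j)) => i ij.
by apply: (idealMl (hP j)); apply: delta_off.
Qed.

Let P_delta j x : P j (x * delta j) -> P j x.
Proof. by have [_ _ pr] := coord_primeP C (E j); move=> /pr [//|/delta_on]. Qed.

Local Notation J := (jacobian_ideal X f).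
Local Notation M := (ideal_mod J).

Let J_comb b : ideal_set J (pi (comb b)).
Proof.
have hJ := idealP J; rewrite /comb quo_pi_sum; apply: (ideal_sum hJ) => j _.
rewrite quo_piZM; apply: (idealMl hJ) => S [_]; apply; exists (delta j) => //.
by exists (e j) => //; apply: e_incr.
Qed.

(** A minor either has the columns of some [E j], and then is [delta j], or has for every [j] a
    column outside [E j], and then is zero on X. *)
Let J_elim y : ideal_set J y -> exists b, y = pi (comb b).
Proof.
move=> /(_ [set y | exists b, y = pi (comb b)]); apply; split; first split.
- exists (fun=> 0); rewrite /comb big1 ?quo_pi0 // => j _; exact: mul0r.
- move=> _ _ [b ->] [c ->]; exists (fun j => b j + c j).
  rewrite -quo_piD /comb -big_split; congr (pi _); apply: eq_bigr => j _.
  by rewrite mulrDl.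
- move=> z _ [b ->]; have [a <-] := quo_piE z; exists (fun j => a * b j).
  rewrite -quo_piZM /comb mulr_sumr; congr (pi _); apply: eq_bigr => j _.
  by rewrite mulrA.
move=> _ [_ [g g_incr ->] <-].
have [[j gE]|none] := pselect (exists j, forall c, g c \in E j).
  have ge := increasing_uniq (card_E j) g_incr gE (@e_incr j) (@e_mem j).
  exists (fun i => (i == j)%:R); congr (pi _).
  rewrite /comb (bigD1 j) //= eqxx mul1r big1 ?addr0 => [|i /negbTE ->]; last exact: mul0r.
  by congr (\det _); apply/matrixP => a c; rewrite !mxE ge.
exists (fun=> 0); have -> : comb (fun=> 0) = 0 by rewrite /comb big1 // => j _; exact: mul0r.
rewrite quo_pi0.
apply/quo_pi_eq0/memI => j; have /existsNP [c /negP gc] : ~ forall c, g c \in E j.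
  by move=> h; apply: none; exists j.
exact: (minor_off (@Pf j) gc).
Qed.

Let J_mem y : y \in ideal_submod J <-> ideal_set J y.
Proof. by rewrite /ideal_submod /ideal_pred; split=> [|h]; rewrite inE. Qed.

Let elt_ex b : exists w : M, ideal_mod_val w = pi (comb b).
Proof. by exists (IdealMod ((J_mem _).2 (J_comb b))). Qed.

Let elt_comb (w : M) : exists b, ideal_mod_val w = pi (comb b).
Proof. by apply: J_elim; apply/J_mem; apply: (valP w). Qed.

Let val_sum T (s : seq T) (F : T -> M) :
  ideal_mod_val (\sum_(i <- s) F i) = \sum_(i <- s) ideal_mod_val (F i).
Proof. by elim/big_rec2: _ => // i x y _ <-. Qed.

Let val_scale a (w : M) : ideal_mod_val (a *: w) = a * ideal_mod_val w.
Proof. by []. Qed.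

Let combMl a b : comb (fun j => a * b j) = a * comb b.
Proof. by rewrite /comb mulr_sumr; apply: eq_bigr => j _; rewrite mulrA. Qed.

Let comb_eq b b' : pi (comb b) = pi (comb b') <-> forall j, P j (b j - b' j).
Proof.
rewrite quo_piP; have -> : comb b - comb b' = comb (fun j => b j - b' j).
  by rewrite /comb -sumrB; apply: eq_bigr => j _; rewrite mulrBl.
split=> [/memI h j|h]; [apply: P_delta | apply/memI => j].
  rewrite -[_ * _](subKr (comb (fun j => b j - b' j))).
  by apply: (idealB (@hP j)) => //; apply: comb_mod.
rewrite -[comb _](subrK ((b j - b' j) * delta j)); apply: (idealD (@hP j)).
  exact: (comb_mod (fun j => b j - b' j)).
exact: (idealMr (@hP j)).
Qed.

Let comb_lin (t : seq A) (c : nat -> 'I_r -> A) :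
  pi (comb (fun j => \sum_(l < size t) c l j * t`_l)) =
  \sum_(l < size [seq pi x | x <- t]) [seq pi x | x <- t]`_l * pi (comb (c l)).
Proof.
rewrite size_map /comb; under eq_bigr do rewrite mulr_suml.
rewrite exchange_big quo_pi_sum; apply: eq_bigr => l _.
rewrite (nth_map 0) // -quo_piZM mulr_sumr; congr (pi _); apply: eq_bigr => i _ /=.
by rewrite mulrA [t`_l * _]mulrC.
Qed.

(* Under [J ~ (+)_j A / P_j], the submodule [s J] is [(+)_j (s + P_j) / P_j]. *)
Let submodP (t : seq A) (b : 'I_r -> A) (w : M) : ideal_mod_val w = pi (comb b) ->
  seq_submod [seq pi x | x <- t] w <-> forall j, adjoins (P j) t (b j).
Proof.
move=> wE; split=> [[u uE] j|h].
  have /choice [c cE] : forall l, exists c, ideal_mod_val (u l) = pi (comb c).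
    by move=> l; apply: elt_comb.
  pose c' n := oapp c (fun=> 0) (insub n : option 'I_(size [seq pi x | x <- t])).
  have : pi (comb b) = pi (comb (fun j => \sum_(l < size t) c' l j * t`_l)).
    rewrite comb_lin -wE uE val_sum; apply: eq_bigr => l _.
    by rewrite val_scale cE /c' valK.
  move=> /comb_eq /(_ j) hb.
  apply/adjoinsP; exists (b j - \sum_(l < size t) c' l j * t`_l), (fun n => c' n j).
  by rewrite subrK.
have /choice [c cE] : forall j, exists c : nat -> A, P j (b j - \sum_(l < size t) c l * t`_l).
  by move=> j; have /adjoinsP [p [c [Pp ->]]] := h j; exists c; rewrite addrK.
have /choice [u uE] : forall l : nat, exists u : M, ideal_mod_val u = pi (comb (fun j => c j l)).
  by move=> l; apply: elt_ex.
exists (fun l => u l); apply: val_inj; rewrite /= val_sum wE.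
transitivity (pi (comb (fun j => \sum_(l < size t) c j l * t`_l))); first exact/comb_eq.
rewrite (comb_lin t (fun l j => c j l)); apply: eq_bigr => l _.
by rewrite val_scale uE.
Qed.

Let regularP (t : seq A) : (forall j, wreg (P j) t) <->
  forall i (w : M), (i < size [seq pi x | x <- t])%N ->
    seq_submod (take i [seq pi x | x <- t]) ([seq pi x | x <- t]`_i *: w) ->
    seq_submod (take i [seq pi x | x <- t]) w.
Proof.
have scale i b w : (i < size t)%N -> ideal_mod_val w = pi (comb b) ->
    ideal_mod_val ([seq pi x | x <- t]`_i *: w : M) = pi (comb (fun j => t`_i * b j)).
  by move=> it wE; rewrite val_scale wE (nth_map 0) // -quo_piZM combMl.
split=> [h i w|h j].
  rewrite size_map -map_take => it; have [b wE] := elt_comb w.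
  move=> /(submodP _ (scale _ _ _ it wE)) hs; apply/(submodP _ wE) => j.
  by have /wregP := h j; apply.
apply/wregP => i v it hv.
(* Regularity on one summand is tested on elements concentrated in that component. *)
have [w wE] := elt_ex (fun l => if l == j then v else 0).
have hi l : is_ideal (adjoins (P l) (take i t)) by apply: adjoins_is_ideal.
have := h i w; rewrite size_map -map_take => /(_ it) hw.
have /(submodP _ wE) /(_ j) : seq_submod [seq pi x | x <- take i t] w.
  apply: hw; apply/(submodP _ (scale _ _ _ it wE)) => l.
  by case: eqP => [->//|_]; rewrite mulr0; apply: ideal0.
by rewrite eqxx.
Qed.

Let P_top j : P j `<=` @coord_prime C m finset.setT.
Proof. by apply: coord_primeS; apply: finset.subsetT. Qed.

Let topE x : @coord_prime C m finset.setT x <-> x (mzero m) = 0.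
Proof.
split=> [h|x0 a ha]; first by apply: h => i _; rewrite ffunE.
by rewrite (_ : a = mzero m) //; apply/ffunP => i; rewrite ffunE ha ?inE.
Qed.

Let nonunitsP x : nonunits (pi x) <-> x (mzero m) = 0.
Proof.
split=> [h|x0 [y]].
  apply: contrapT => /cs_unit [y xy]; apply: h; exists (pi y).
  by rewrite -quo_piZM xy.
have [z <-] := quo_piE y; rewrite -quo_piZM => /quo_piP /memI /(_ j0) /P_top /topE.
rewrite coefB coefMz x0 mul0r coef1 eqxx sub0r => /eqP.
by rewrite oppr_eq0 oner_eq0.
Qed.

Let k_le_m : (k <= m)%N.
Proof. by rewrite -(card_E j0) -[m in (_ <= m)%N]card_ord max_card. Qed.

Let chain_P j Q : prime_ideal Q -> P j `<=` Q -> chain_to k Q.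
Proof.
by move=> pQ s; apply: chain_to_sub s pQ; rewrite -(card_E j); apply: coord_chain.
Qed.

(** A sequence regular on the module is regular modulo [P j0], so it raises the height of the
    maximal ideal to at least [k + size s], which is at most [m]. *)
Let depth_le (s : seq (quo I)) : {in s, forall a, nonunits a} ->
  @regular_seq _ M s -> (size s <= m - k)%N.
Proof.
have [t ->] := quo_pi_lift s => nu [/regularP /(_ j0) wt _].
have tT : adjoins (P j0) t `<=` @coord_prime C m finset.setT.
  apply: adjoins_least; [exact: coord_prime_is_ideal | exact: P_top |].
  by move=> x xt; apply/topE/nonunitsP/nu/map_f.
have c := wreg_chain (@hP j0) wt (@chain_P j0) (coord_primeP C _) tT.
by rewrite size_map -(leq_add2l k) subnKC //; exact: chain_le c.
Qed.

(** The values of the monomial of degree [t] at the nodes 0, ..., m - 1. Distinctness of the nodes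
    puts these vectors in general position to all coordinate subspaces at once. *)
Let theta (t : nat) : 'rV[C]_m := \row_i (i%:R ^+ t).

Lemma span_rowsP (U : 'M[C]_m) s u : (u <= span_rows U s)%MS ->
  exists u0 (c : nat -> C), (u0 <= U)%MS /\ u = u0 + \sum_(l < size s) c l *: s`_l.
Proof.
elim: s U => [|a s ih] U /=; first by exists u, (fun=> 0); rewrite big_ord0 addr0.
move=> /ih [_ [c [/sub_addsmxP [[D d] ->] ->]]] /=.
exists (D *m U), (fun n => if n is n'.+1 then c n' else d 0 0); split; first exact: submxMl.
by rewrite big_ord_recl /= addrA {1}[d]mx11_scalar mul_scalar_mx.
Qed.

(* The coefficients of [theta 0], ..., [theta (i - 1)], [theta i] form a Vandermonde
   matrix: otherwise a monic polynomial of degree [i] has [m - #|F| > i] roots. *)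
Let theta_free (F : {set 'I_m}) i : (i + #|F| < m)%N ->
  ~~ (theta i <= span_rows (coord_mx C F) [seq theta t | t <- iota 0 i])%MS.
Proof.
move=> iF; apply/negP => /span_rowsP [u0 [c [/coord_mxP u0F thE]]].
rewrite size_map size_iota in thE.
pose p : {poly C} := 'X^i - \poly_(l < i) c l.
have sp' : size p = i.+1.
  by rewrite /p size_polyDl ?size_polyXn // size_polyN ltnS size_poly.
have p0 : p != 0 by rewrite -size_poly_eq0 sp'.
have := @max_poly_roots _ p [seq (val x)%:R : C | x <- enum (~: F)] p0.
rewrite size_map -cardE sp' ltnS leqNgt => h; case/(_ _ _)/negP: h.
- apply/allP => _ /mapP [x xF ->]; rewrite mem_enum inE in xF.
  rewrite /root /p hornerD hornerN hornerXn horner_poly.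
  have := congr1 (fun u : 'rV[C]_m => u 0 x) thE; rewrite !mxE u0F // add0r summxE => ->.
  rewrite subr_eq0; apply/eqP/eq_bigr => l _.
  by rewrite mxE (nth_map 0%N) ?size_iota // nth_iota // mxE.
- rewrite map_inj_uniq ?enum_uniq // => x y /eqP; rewrite eqr_nat => /eqP.
  exact: val_inj.
- by rewrite -(ltn_add2l #|F|) cardsC card_ord addnC.
Qed.

(** Modulo each [P j] the first forms generate a prime ideal of linear forms, and [theta_free] keeps
    the next form out of it. *)
Let depth_ge : exists s : seq (quo I), [/\ {in s, forall a, nonunits a},
  @regular_seq _ M s & size s = (m - k)%N].
Proof.
pose t := [seq lin (theta i) | i <- iota 0 (m - k)].
have t0 x : x \in t -> x (mzero m) = 0 by move=> /mapP [i _ ->]; apply: coef_lin0.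
exists [seq pi x | x <- t]; split; last by rewrite !size_map size_iota.
  by move=> _ /mapP [x xt ->]; apply/nonunitsP/t0.
split.
  apply/regularP => j; apply/wregP => i x; rewrite size_map size_iota => im.
  rewrite coord_prime_linear /t -map_take (nth_map 0%N) ?size_iota // nth_iota // add0n.
  rewrite take_iota (minn_idPl (ltnW im)) map_comp adjoins_lin.
  have [_ _ pr] := linear_ideal_prime (span_rows (coord_mx C (E j)) [seq theta t | t <- iota 0 i]).
  move=> /pr [/mem_linear_ideal|//]; apply: contraTP => _; apply: theta_free.
  by rewrite card_E; lia.
have [w wE] := elt_ex (fun=> 1); exists w => /(submodP _ wE) /(_ j0).
have sT : adjoins (P j0) t `<=` @coord_prime C m finset.setT.
  by apply: adjoins_least; [exact: coord_prime_is_ideal | exact: P_top |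
    move=> x /t0 /topE].
by move=> /sT /topE /eqP; rewrite coef1 eqxx oner_eq0.
Qed.

Let ann0 : annihilator M = [set 0].
Proof.
apply/seteqP; split=> [y|_ -> w]; last exact: scale0r.
have [a <-] := quo_piE y => h; apply/quo_pi_eq0/memI => j.
(* The element with all components 1 is killed only by the intersection of the [P j], which is zero
   in the ring of X. *)
have [w wE] := elt_ex (fun=> 1).
have [z zE] := elt_ex (fun=> 0).
have := congr1 (@ideal_mod_val _ _) (h w); rewrite val_scale wE -quo_piZM -combMl.
have -> : ideal_mod_val (0 : M) = pi (comb (fun=> 0)).
  have -> : comb (fun=> 0) = 0 by rewrite /comb big1 // => i _; exact: mul0r.
  by rewrite quo_pi0.
by move=> /comb_eq /(_ j); rewrite mulr1 subr0.
Qed.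

Let dim_le n p : prime_chain (annihilator M) n p -> (n <= m - k)%N.
Proof.
move=> [hp lt]; pose q i := pi @^-1` p i.
have pq i : (i <= n)%N -> prime_ideal (q i) /\ I `<=` q i.
  by move=> /hp [/preimage_prime].
(* The bottom prime contains the intersection of the [P j], hence one of them, so the chain starts
   at height at least [k]. *)
have [j Pq] : exists j, P j `<=` q 0%N.
  have [[hq q1 prq] Iq] := pq 0%N (leq0n _).
  apply: contrapT => none.
  have /choice [z hz] : forall j, exists z, P j z /\ ~ q 0%N z.
    by move=> j; apply: contrapT => nz; apply: none; exists j => z Pz; apply: contrapT => qz;
      apply: nz; exists z.
  have : q 0%N (\prod_j z j).
    apply: Iq; apply/memI => j; rewrite (bigD1 j) //=; apply: (idealMr (@hP j)).
    by have [] := hz j.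
  by elim/big_rec: _ => // j x _ nx /prq []; [have [] := hz j | ].
have c i : (i <= n)%N -> chain_to (k + i) (q i).
  elim: i => [_|i ih i_n]; first by rewrite addn0; apply: (@chain_P j) => //; case: (pq 0%N).
  rewrite addnS; apply: (chain_toS (ih (ltnW i_n))); last by case: (pq i.+1).
  have [s ns] := lt i i_n; split; first by move=> x; apply: s.
  move=> h; apply: ns => y; have [a <-] := quo_piE y; exact: h.
by rewrite -(leq_add2l k) subnKC //; exact: chain_le (c n (leqnn n)).
Qed.

Let dim_ge : exists p, prime_chain (annihilator M) (m - k) p.
Proof.
(* The coordinates outside [E j0] are added one at a time. *)
pose S i := E j0 :|: [set x in take i (enum (~: E j0))].
have SE i : E j0 \subset S i by apply: finset.subsetUl.
have IS i : I `<=` @coord_prime C m (S i).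
  by move=> x /memI /(_ j0); apply: coord_primeS.
have pS i := image_primeP (@coord_primeP C m (S i)) (IS i).
have cE : size (enum (~: E j0)) = (m - k)%N.
  by rewrite -cardE; have := cardsC (E j0); rewrite card_ord card_E; lia.
exists (fun i => pi @` @coord_prime C m (S i)); split=> i im.
  split; first by case: (pS i).
  by rewrite ann0 => _ ->; have [[/ideal0]] := pS i.
have x0 : 'I_m by case: (enum _) cE => [|x ? _]; [rewrite /= => e'; rewrite -e' in im | exact: x].
have Ss : S i \subset S i.+1.
  apply/fintype.subsetP => x; rewrite !inE => /orP [->//|xt]; apply/orP; right.
  by rewrite (take_nth x0) ?cE // mem_rcons inE xt orbT.
split; first by apply: image_subset; apply: coord_primeS.
pose x := nth x0 (enum (~: E j0)) i.
have xE : x \in enum (~: E j0) by apply: mem_nth; rewrite cE.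
move=> /(_ (pi (mono C (munit x)))) h.
have /(pS i).2 /coord_prime_var : (pi @` @coord_prime C m (S i)) (pi (mono C (munit x))).
  apply: h; apply/(pS i.+1).2/coord_prime_var; rewrite !inE; apply/orP; right.
  by rewrite (take_nth x0) ?cE // mem_rcons mem_head.
rewrite !inE => /orP [xE'|].
  by move: xE; rewrite mem_enum inE xE'.
move=> /(nthP x0) [l]; rewrite size_take cE im => li; rewrite nth_take // => /eqP.
by rewrite nth_uniq ?enum_uniq ?cE // ?(ltn_trans li) // (ltn_eqF li).
Qed.

Lemma jacobian_cohen_macaulay : cohen_macaulay M.
Proof.
exists (m - k)%N; split; first by split; [exact: depth_ge | exact: depth_le].
by split; [exact: dim_ge | exact: dim_le].
Qed.

End NormalCrossing.

Theorem corollary5p5 (R : realType) (m k : nat) (X : set 'rV[cplx R]_m)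
    (hk : (0 < k < m)%N) (hX : normal_crossing k X) :
  free_singularity k X.
Proof.
case: hX => r [E [r0 Einj cE ->]]; split; first exact: reduced_ci_exists.
by move=> f cf; apply: jacobian_cohen_macaulay.
Qed.
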